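(* Let $q\neq 2$ be a prime power and let $p_1,p_2,p_3\in\mathbf{P}^2(\overline{\mathbf{F}}_q)$ be three collinear points that are conjugate over $\mathbf{F}_q$ (i.e. they form one Galois orbit of three distinct points). Let $X$ be the weak del Pezzo surface over $\mathbf{F}_q$ obtained by blowing up $\mathbf{P}^2_{\mathbf{F}_q}$ at $p_1,p_2,p_3$. Then the anticanonical code associated to $X$ has parameters $[q^2+1,\,7,\,q^2-2q]$.
   Context: Parameters $[n,k,d]$ of a linear code over $\mathbf{F}_q$: length $n$, dimension $k$, minimum distance $d$. ''Conjugate'' means permuted transitively by the $q$-Frobenius. Weak del Pezzo surface: a smooth projective surface $X$ whose anticanonical divisor $-K_X$ is big ($K_X^2>0$) and nef; its degree is $d=K_X^2$. Anticanonical model: for $X$ a weak del Pezzo surface of degree $d$ with $3\le d\le 6$, the complete linear system $|-K_X|$ is base point free and defines a morphism $\varphi:X\to\mathbf{P}(H^0(X,-K_X))=\mathbf{P}^d$. Its image $X_s=\varphi(X)$ is the anticanonical model (a normal surface). Put $K_{X_s}=\varphi_*(K_X)$; it is a Cartier divisor on $X_s$ with $\varphi^*K_{X_s}=K_X$. Evaluation code: for an irreducible (not necessarily smooth) surface $S$ over $\mathbf{F}_q$, a Cartier divisor $D=(U_i,f_i)_i$ on $S$ and a set $\mathcal P$ of rational points of $S$, $\mathcal{C}_S(D,\mathcal P)$ is the image of $H^0(S,D)\to \mathbf{F}_q^{\#\mathcal P}$, $s\mapsto ((sf_{i_p})(p))_{p\in\mathcal P}$, where $H^0(S,D)=\{s\in\mathbf{F}_q(S)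 : sf_i\in\mathcal{O}_S(U_i)\ \forall i\}$ and $i_p$ is chosen with $p\in U_{i_p}$ (other choices rescale coordinates by nonzero constants). Anticanonical code associated to $X$: the code $\mathcal{C}_{X_s}(-K_{X_s},X_s(\mathbf{F}_q))$. *)

(* Defs.v *)
From HB Require Import structures.
From mathcomp Require Import all_boot all_order all_algebra fraction.
From mathcomp Require Import mpoly.

Set Implicit Arguments.
Unset Strict Implicit.
Unset Printing Implicit Defensive.

Import GRing.Theory.
Local Open Scope ring_scope.

(* Surfaces are handled as in Zariski's theory of models.  All the surfaces
   below are birational to P^2 over F, so they share the function field
   K = F(x, y), and an L-point of a surface (L an algebraic closure of F) is
   known through its local ring, a subring of K, together with the evaluation
   of regular functions in L.  L-points of a variety over F with the same image
   (a closed point) have the same local ring but different evaluations.  Local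
   equations of Cartier divisors are elements of K^*. *)

(** ** Projective points *)

Definition nonzero (R : nzRingType) (n : nat) (P : 'I_n -> R) : Prop :=
  exists i, P i != 0.

Definition proportional (R : nzRingType) (n : nat) (P Q : 'I_n -> R) : Prop :=
  exists2 c : R, c != 0 & forall i, Q i = c * P i.

Definition collinear (R : nzRingType) (m : nat) (p : 'I_m -> 'I_3 -> R) : Prop :=
  exists2 a : 'I_3 -> R, nonzero a & forall i, \sum_j a j * p i j = 0.

Definition frobenius (R : nzRingType) (q m n : nat) (P : 'I_n -> R) : 'I_n -> R :=
  fun i => P i ^+ (q ^ m).

Definition conjugate_points (R : nzRingType) (q m n : nat)
    (p : 'I_m -> 'I_n -> R) : Prop :=
  [/\ forall i j, i != j -> ~ proportional (p i) (p j),
      forall i, exists j, proportional (frobenius q 1 (p i)) (p j) &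
      forall i j, exists k, proportional (frobenius q k (p i)) (p j)].

(** ** The function field F(x, y) and its rational 2-forms *)

Definition ratfun (F : finFieldType) : fieldType := {fraction {mpoly F[2]}}.

Definition ratfun_const (F : finFieldType) : F -> ratfun F :=
  @tofrac {mpoly F[2]} \o @mpolyC 2 F.

Definition ratfun_var (F : finFieldType) (i : 'I_2) : ratfun F :=
  tofrac ('X_i : {mpoly F[2]}).

(* Quotient rule, on the canonical representative of the fraction. *)
Definition ratfun_deriv (F : finFieldType) (i : 'I_2) (f : ratfun F) : ratfun F :=
  let n := \n_(repr f) in let d := \d_(repr f) in
  tofrac (n^`M(i) * d - n * d^`M(i)) / tofrac (d ^+ 2).

(* du /\ dv = jacobian u v * (dx /\ dy) in the K-line of rational 2-forms. *)
Definition jacobian (F : finFieldType) (u v : ratfun F) : ratfun F :=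
  ratfun_deriv ord0 u * ratfun_deriv ord_max v
  - ratfun_deriv ord_max u * ratfun_deriv ord0 v.

(** ** Local rings with evaluation *)

(* [v f a] means: f is regular at the point v and takes the value a there. *)
Definition germ (F : finFieldType) (L : fieldType) : Type := ratfun F -> L -> Prop.

Definition regular (F : finFieldType) (L : fieldType) (v : germ F L)
    (f : ratfun F) : Prop := exists a, v f a.

(* The variety of generic point [s_0 : ... : s_n-1], that is, the closure in
   P^(n-1) of the image of the rational map with components s_i, has as local
   ring at P the functions G(s) / H(s), with G and H forms of the same degree
   and H(P) != 0. *)
Definition proj_germ (F : finFieldType) (L : fieldType) (iota : {rmorphism F -> L})
    (n : nat) (s : 'I_n -> ratfun F) (P : 'I_n -> L) : germ F L :=
  fun f a => exists (d : nat) (G H : {mpoly F[n]}),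
    [/\ G \is d.-homog, H \is d.-homog, mmap iota P H != 0,
        f = mmap (@ratfun_const F) s G / mmap (@ratfun_const F) s H &
        a = mmap iota P G / mmap iota P H].

Definition proj_ratfun (F : finFieldType) (n : nat) (s : 'I_n -> ratfun F)
    (f : ratfun F) : Prop :=
  exists (d : nat) (G H : {mpoly F[n]}),
    [/\ G \is d.-homog, H \is d.-homog, mmap (@ratfun_const F) s H != 0 &
        f = mmap (@ratfun_const F) s G / mmap (@ratfun_const F) s H].

Definition plane_generic (F : finFieldType) : 'I_3 -> ratfun F :=
  fun i => nth 0 [:: ratfun_var F ord0; ratfun_var F ord_max; 1] i.

Definition plane_germ (F : finFieldType) (L : fieldType) (iota : {rmorphism F -> L})
    (P : 'I_3 -> L) : germ F L := proj_germ iota (@plane_generic F) P.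

(** ** Blow-up of the plane *)

(* Stalk at P of the ideal sheaf of the reduced subscheme with points p i. *)
Definition center_ideal (F : finFieldType) (L : fieldType)
    (iota : {rmorphism F -> L}) (m : nat) (p : 'I_m -> 'I_3 -> L)
    (P : 'I_3 -> L) (f : ratfun F) : Prop :=
  exists2 a, plane_germ iota P f a & (exists i, proportional (p i) P) -> a = 0.

(* The affine chart O[I/t] of the blow-up of Spec O along I, O the ring of v. *)
Inductive blowup_chart (F : finFieldType) (L : fieldType) (v : germ F L)
    (I : ratfun F -> Prop) (t : ratfun F) : ratfun F -> Prop :=
| Chart_base f of regular v f : blowup_chart v I t f
| Chart_quot a of I a : blowup_chart v I t (a / t)
| Chart_sub f g of blowup_chart v I t f & blowup_chart v I t g :
    blowup_chart v I t (f - g)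
| Chart_mul f g of blowup_chart v I t f & blowup_chart v I t g :
    blowup_chart v I t (f * g).

(* An L-point e of the affine scheme Spec B over the point v. *)
Definition chart_point (F : finFieldType) (L : fieldType) (v : germ F L)
    (B : ratfun F -> Prop) (e : ratfun F -> L) : Prop :=
  [/\ forall f a, v f a -> e f = a,
      forall f g, B f -> B g -> e (f + g) = e f + e g &
      forall f g, B f -> B g -> e (f * g) = e f * e g].

(* Localization of B at the kernel of e. *)
Definition chart_germ (F : finFieldType) (L : fieldType) (B : ratfun F -> Prop)
    (e : ratfun F -> L) : germ F L :=
  fun f a => exists g h, [/\ B g, B h, e h != 0, f = g / h & a = e g / e h].

Inductive blowup (F : finFieldType) (L : fieldType) (iota : {rmorphism F -> L})
    (m : nat) (p : 'I_m -> 'I_3 -> L) : germ F L -> Prop :=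
| Blowup_point (P : 'I_3 -> L) (t : ratfun F) (e : ratfun F -> L)
    (B := blowup_chart (plane_germ iota P) (center_ideal iota p P) t)
    of nonzero P & center_ideal iota p P t & t != 0
     & chart_point (plane_germ iota P) B e :
    blowup iota p (chart_germ B e).

(** ** Divisors and their sections *)

(* A divisor is given by its local equations: [D x f] means that f is a local
   equation of D at x. *)
Definition sections (F : finFieldType) (L : fieldType) (X : germ F L -> Prop)
    (D : germ F L -> ratfun F -> Prop) (s : ratfun F) : Prop :=
  forall x f, X x -> D x f -> regular x (s * f).

(* Stalk at a smooth point x of the canonical sheaf: the forms w * (dx /\ dy)
   in the O_x-module generated by the du /\ dv with u and v in O_x. *)
Inductive canonical_stalk (F : finFieldType) (L : fieldType) (x : germ F L) :
    ratfun F -> Prop :=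
| Canonical0 : canonical_stalk x 0
| CanonicalD a u v w of regular x a & regular x u & regular x v
    & canonical_stalk x w : canonical_stalk x (a * jacobian u v + w).

(* With K_X := div (dx /\ dy): if f * (dx /\ dy) generates the canonical sheaf
   at x, then f^-1 is a local equation of K_X, and f one of -K_X. *)
Definition anticanonical_eq (F : finFieldType) (L : fieldType) (x : germ F L)
    (f : ratfun F) : Prop :=
  canonical_stalk x f /\
  forall w, canonical_stalk x w -> exists2 a, regular x a & w = a * f.

Definition basis_of_sections (F : finFieldType) (H : ratfun F -> Prop) (n : nat)
    (b : 'I_n -> ratfun F) : Prop :=
  [/\ forall i, H (b i),
      forall c : 'I_n -> F, \sum_i ratfun_const (c i) * b i = 0 ->
        forall i, c i = 0 &
      forall s, H s -> exists c : 'I_n -> F, s = \sum_i ratfun_const (c i) * b i].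

(** ** The anticanonical model *)

(* [anticanonical_map b x P]: the morphism given by the basis b of
   H^0(X, -K_X) maps x to P. *)
Definition anticanonical_map (F : finFieldType) (L : fieldType) (n : nat)
    (b : 'I_n -> ratfun F) (x : germ F L) (P : 'I_n -> L) : Prop :=
  nonzero P /\
  exists f (Q : 'I_n -> L),
    [/\ anticanonical_eq x f, forall i, x (b i * f) (Q i) & proportional Q P].

Definition anticanonical_model (F : finFieldType) (L : fieldType)
    (X : germ F L -> Prop) (n : nat) (b : 'I_n -> ratfun F) (P : 'I_n -> L) : Prop :=
  exists2 x, X x & anticanonical_map b x P.

(* Cartier divisors (U_i, f_i) on the variety S of generic point s; the open
   sets U_i are given by their L-points. *)
Record cartier (F : finFieldType) (L : fieldType) (iota : {rmorphism F -> L})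
    (n : nat) (s : 'I_n -> ratfun F) (S : ('I_n -> L) -> Prop) := Cartier {
  cartier_index : Type;
  cartier_open : cartier_index -> ('I_n -> L) -> Prop;
  cartier_fun : cartier_index -> ratfun F;
  cartier_sub : forall i P, cartier_open i P -> S P;
  cartier_openP : forall i P, cartier_open i P ->
    exists (d : nat) (G : {mpoly F[n]}),
      [/\ G \is d.-homog, mmap iota P G != 0 &
          forall Q, S Q -> mmap iota Q G != 0 -> cartier_open i Q];
  cartier_cover : forall P, S P -> exists i, cartier_open i P;
  cartier_neq0 : forall i, cartier_fun i != 0;
  cartier_ratfun : forall i, proj_ratfun s (cartier_fun i);
  cartier_compat : forall i j P, cartier_open i P -> cartier_open j P ->
    regular (proj_germ iota s P) (cartier_fun i / cartier_fun j)
}.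

Arguments cartier_open {F L iota n s S} c i P.
Arguments cartier_fun {F L iota n s S} c i.

(* H^0(S, D): the s with s f_i in O_S(U_i) for all i.  Such an s is in the
   function field of S, since f_i is. *)
Definition cartier_sections (F : finFieldType) (L : fieldType)
    (iota : {rmorphism F -> L}) (n : nat) (s : 'I_n -> ratfun F)
    (S : ('I_n -> L) -> Prop) (D : cartier iota s S) (g : ratfun F) : Prop :=
  forall i P, cartier_open D i P -> regular (proj_germ iota s P) (g * cartier_fun D i).

(* D = -K_(X_s), expressed by phi^* D = -K_X, where phi : X -> X_s is the
   anticanonical morphism; then D = phi_* (phi^* D) = - phi_* K_X, as phi is
   birational. *)
Definition is_anticanonical_divisor (F : finFieldType) (L : fieldType)
    (iota : {rmorphism F -> L}) (X : germ F L -> Prop) (n : nat)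
    (b : 'I_n -> ratfun F)
    (D : cartier iota b (anticanonical_model X b)) : Prop :=
  forall x P i, X x -> anticanonical_map b x P -> cartier_open D i P ->
    anticanonical_eq x (cartier_fun D i).

(** ** Evaluation codes *)

Definition enumerates_rational_points (F : finFieldType) (L : fieldType)
    (iota : {rmorphism F -> L}) (n : nat) (S : ('I_n -> L) -> Prop) (N : nat)
    (pt : 'I_N -> 'I_n -> F) : Prop :=
  [/\ forall j, S (iota \o pt j),
      forall j k, j != k -> ~ proportional (pt j) (pt k) &
      forall Q : 'I_n -> F, S (iota \o Q) -> exists j, proportional (pt j) Q].

Definition is_evaluation_code (F : finFieldType) (L : fieldType)
    (iota : {rmorphism F -> L}) (n : nat) (s : 'I_n -> ratfun F)
    (S : ('I_n -> L) -> Prop) (D : cartier iota s S) (N : nat)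
    (pt : 'I_N -> 'I_n -> F) (C : {vspace 'rV[F]_N}) : Prop :=
  exists2 ip : 'I_N -> cartier_index D,
    forall j, cartier_open D (ip j) (iota \o pt j) &
    forall c : 'rV[F]_N,
      c \in C <->
      exists2 g, cartier_sections D g &
        forall j, proj_germ iota s (iota \o pt j) (g * cartier_fun D (ip j))
                    (iota (c 0 j)).

(* C is an anticanonical code associated to the surface X, for some choice of
   the coordinates on P(H^0(X, -K_X)), of the representation (U_i, f_i) of
   -K_(X_s), and of an ordering and representatives of X_s(F). *)
Definition is_anticanonical_code (F : finFieldType) (L : fieldType)
    (iota : {rmorphism F -> L}) (X : germ F L -> Prop) (N : nat)
    (C : {vspace 'rV[F]_N}) : Prop :=
  exists (n : nat) (b : 'I_n -> ratfun F)
         (D : cartier iota b (anticanonical_model X b)) (pt : 'I_N -> 'I_n -> F),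
    [/\ basis_of_sections (sections X (@anticanonical_eq F L)) b,
        is_anticanonical_divisor D,
        enumerates_rational_points iota (anticanonical_model X b) pt &
        is_evaluation_code D pt C].

Definition hamming_distance (F : finFieldType) (N : nat) (c c' : 'rV[F]_N) : nat :=
  #|[set j | c 0 j != c' 0 j]|.

Definition has_parameters (F : finFieldType) (N : nat) (C : {vspace 'rV[F]_N})
    (n k d : nat) : Prop :=
  [/\ N = n, \dim C = k,
      exists c c', [/\ c \in C, c' \in C, c != c' & hamming_distance c c' = d] &
      forall c c', c \in C -> c' \in C -> c != c' -> (d <= hamming_distance c c')%N].

(* Main.v *)
Require Import Defs.
From HB Require Import structures.
From mathcomp Require Import all_boot all_order all_algebra.
From mathcomp Require Import mpoly.
From mathcomp Require Import fraction generic_quotient perm finfield.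
From mathcomp Require Import ring zify.
From Stdlib Require Import ClassicalEpsilon FunctionalExtensionality PropExtensionality.

Set Implicit Arguments.
Unset Strict Implicit.
Unset Printing Implicit Defensive.

Import GRing.Theory.
Local Open Scope ring_scope.

(** * Points of a cubic of the linear system over F *)

(** Choose linear coordinates over [F] in which the line through the three points is z = 0. The
    points become (theta_i : 1 : 0), where the theta_i are the roots of a monic cubic [N] over [F]
    that is the minimal polynomial of each of them ([normal_coordinates]). The line is rational
    because Frobenius permutes the points on it.

    Sections. On a blow-up of smooth points, K_X is the pullback of the canonical divisor of the
    plane plus the exceptional curves, so H^0(X, -K_X) consists of the plane cubics through the
    three points: c0 N(x, y) + z Q(x, y, z) with [N] made homogeneous and Q any quadratic form. This
    space has dimension 1 + 6 = 7 ([sectionsP], [bV_free]). That a section is such a cubic follows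
    from an extension principle over finitely many points ([poly_of_regular]) in two charts; the
    converse is a computation with Jacobians at the points over the centres
    ([anticanonical_stalk_center]).

    Rational points. The anticanonical morphism contracts the strict transform of z = 0, which has
    self-intersection 1 - 3 = -2, to a single point of X_s, and is an isomorphism elsewhere. The
    exceptional curves lie over points that are not rational, so besides the contracted point the
    rational points of X_s are the q^2 rational points with z != 0 ([model_rational],
    [enumeration_card]).

    The code. For any Cartier divisor representing -K on X_s, the sections are again exactly the
    cubics ([cartier_sections_cubic], [cubic_cartier_sections]). The delicate inclusion is at the
    contracted point, where it amounts to normality of X_s and is proved with a weight on F[T, w]
    ([singular_regular], [weight_factor]). Evaluation at a rational point is then, up to a nonzero
    factor in [F], a linear form in the coordinates of that point ([evaluation_matrix]).

    Counting. The weight of a codeword is q^2 + 1 minus the number of zeros of a cubic at these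
    points. The contracted point is a zero exactly when c0 = 0. If c0 = 0, what remains in the
    affine plane is a nonzero polynomial of degree at most 2, with at most 2q zeros
    ([card_zeros_quadric]). If c0 != 0, the curve has no rational point at infinity, and the lines
    through a well-chosen zero give at most 2q + 1 zeros ([card_zeros_cubic]). Either way there are
    at most 2q + 1 zeros, attained by two parallel lines ([quadric_with_2q_zeros]). For q > 2 this
    is less than q^2 + 1, so evaluation is injective, the dimension is 7 and the minimum distance is
    q^2 - 2q. *)

Section PlaneCubicPoints.
Variable F : finFieldType.
Implicit Types (a b c s u v x y : F) (S : {set F}).

Lemma card_roots_le1 a b S : (a, b) != 0 ->
  {in S, forall s, a + b * s = 0} -> (#|S| <= 1)%N.
Proof.
move=> ab0 hS; apply/card_le1_eqP => s t /hS hs /hS ht.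
have b0 : b != 0.
  apply: contraNneq ab0 => b0; move: hs; rewrite b0 mul0r addr0 => ->.
  by rewrite -/(0 : F * F).
by apply: (mulfI b0); apply: (addrI a); rewrite hs ht.
Qed.

Lemma card_roots_le2 a b c S : [|| a != 0, b != 0 | c != 0] ->
  {in S, forall s, a + b * s + c * s ^+ 2 = 0} -> (#|S| <= 2)%N.
Proof.
move=> abc0 hS; pose p : {poly F} := Poly [:: a; b; c].
have p0 : p != 0.
  apply: contraTneq abc0 => p0; rewrite !negb_or !negbK.
  have h i : p`_i = 0 by rewrite p0 coef0.
  by move: (h 0%N) (h 1%N) (h 2%N); rewrite !coef_Poly /= => -> -> ->; rewrite eqxx.
rewrite cardE; apply: (@leq_trans (size p).-1).
  rewrite -ltnS prednK ?size_poly_gt0 //; apply: max_poly_roots => //; last exact: enum_uniq.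
  apply/allP => s; rewrite mem_enum => /hS hs.
  by rewrite /root horner_Poly /= mul0r add0r -[X in _ == X]hs; apply/eqP; ring.
by rewrite -ltnS prednK ?size_poly_gt0 // (leq_trans (size_Poly _)).
Qed.

Lemma card_bigcup_le (I T : finType) (A : I -> {set T}) :
  (#|\bigcup_i A i| <= \sum_i #|A i|)%N.
Proof.
elim/big_rec2: _ => [|i n B _ h]; first by rewrite cards0.
by rewrite (leq_trans (leq_card_setU _ _)) // leq_add2l.
Qed.

Variables n0 n1 n2 : F.

Definition cubic_form x y := x ^+ 3 + n2 * x ^+ 2 * y + n1 * x * y ^+ 2 + n0 * y ^+ 3.

Definition cubic (c : 'I_7 -> F) x y :=
  c (inord 0) * cubic_form x y + c (inord 1) * x ^+ 2 + c (inord 2) * (x * y)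
  + c (inord 3) * y ^+ 2 + c (inord 4) * x + c (inord 5) * y + c (inord 6).

Definition cubic_zeros (c : 'I_7 -> F) : {set F * F} :=
  [set P | cubic c P.1 P.2 == 0].

Definition direction (d : option F) : F * F := if d is Some m then (1, m) else (0, 1).

Hypothesis N_neq0 : forall x, x ^+ 3 + n2 * x ^+ 2 + n1 * x + n0 != 0.

Lemma cubic_form_direction d :
  cubic_form (direction d).1 (direction d).2 != 0.
Proof.
case: d => [m|] /=; rewrite /cubic_form.
  case: (eqVneq m 0) => [->|m0]; first by rewrite !expr0n !mulr0 !addr0 expr1n oner_neq0.
  have := N_neq0 m^-1; apply: contraNneq => h.
  have -> : m^-1 ^+ 3 + n2 * m^-1 ^+ 2 + n1 * m^-1 + n0
    = (1 ^+ 3 + n2 * 1 ^+ 2 * m + n1 * 1 * m ^+ 2 + n0 * m ^+ 3) / m ^+ 3 by field.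
  by rewrite h mul0r.
by have := N_neq0 0; rewrite !expr0n /= !mulr0 !mul0r !add0r expr1n mulr1.
Qed.

Section LinesThroughPoint.
Variable c : 'I_7 -> F.
Let f := cubic c.
Let c0 := c (inord 0).

(** [dx] and [dy] are the formal partial derivatives of the affine cubic. [e1] and [e2] are its
    Taylor coefficients of order 1 and 2 along (u, v), with no division by 2, so that the expansion
    holds in every characteristic. *)
Let dx x y := c0 * (3%:R * x ^+ 2 + 2%:R * n2 * x * y + n1 * y ^+ 2)
   + 2%:R * c (inord 1) * x + c (inord 2) * y + c (inord 4).
Let dy x y := c0 * (n2 * x ^+ 2 + 2%:R * n1 * x * y + 3%:R * n0 * y ^+ 2)
   + c (inord 2) * x + 2%:R * c (inord 3) * y + c (inord 5).
Let e1 x y u v := dx x y * u + dy x y * v.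
Let e2 x y u v := c0 * (u ^+ 2 * (3%:R * x + n2 * y) + u * v * (2%:R * n2 * x + 2%:R * n1 * y)
   + v ^+ 2 * (n1 * x + 3%:R * n0 * y))
   + c (inord 1) * u ^+ 2 + c (inord 2) * (u * v) + c (inord 3) * v ^+ 2.

Lemma cubic_line x y u v s : f (x + s * u) (y + s * v)
  = f x y + e1 x y u v * s + e2 x y u v * s ^+ 2 + c0 * cubic_form u v * s ^+ 3.
Proof. by rewrite /f /cubic /e1 /e2 /dx /dy /cubic_form -/c0; ring. Qed.

Let onLine x y d := [set s | (s != 0) &&
  (f (x + s * (direction d).1) (y + s * (direction d).2) == 0)].

(** The q + 1 lines through (x, y) cover the plane; the summand 1 accounts for (x, y) itself, which
    [onLine] leaves out. *)
Lemma zeros_by_lines x y :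
  (#|cubic_zeros c| <= 1 + \sum_d #|onLine x y d|)%N.
Proof.
set Z := cubic_zeros c.
pose pt d s := (x + s * (direction d).1, y + s * (direction d).2).
have sub : Z \subset [set (x, y)] :|: \bigcup_d (pt d @: onLine x y d).
  apply/subsetP => -[x' y']; rewrite !inE /= => f0.
  case: eqVneq => //= ne.
  pose d := if x' == x then None else Some ((y' - y) / (x' - x)).
  pose s := if x' == x then y' - y else x' - x.
  have e : (x', y') = pt d s.
    rewrite /pt /d /s; case: eqVneq => [->|nx] /=; congr pair; rewrite ?mulr0 ?mulr1; [ring..|].
    by field; rewrite subr_eq0.
  apply/bigcupP; exists d => //; apply/imsetP; exists s => //.
  have [e1x e2x] := e; rewrite inE -e1x -e2x f0 andbT.
  rewrite /s; case: (eqVneq x' x) ne => [->|nx _]; last by rewrite subr_eq0.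
  by rewrite subr_eq0 xpair_eqE eqxx.
rewrite (leq_trans (subset_leq_card sub)) // (leq_trans (leq_card_setU _ _)) //.
rewrite cards1 leq_add2l (leq_trans (card_bigcup_le _)) //.
by apply: leq_sum => d _; rewrite leq_imset_card.
Qed.

Hypothesis c0_neq0 : c0 != 0.

Let lead_neq0 d : c0 * cubic_form (direction d).1 (direction d).2 != 0.
Proof. by rewrite mulf_neq0 ?cubic_form_direction. Qed.

Lemma onLine_root x y d s : f x y = 0 -> s \in onLine x y d ->
  e1 x y (direction d).1 (direction d).2 + e2 x y (direction d).1 (direction d).2 * s
  + c0 * cubic_form (direction d).1 (direction d).2 * s ^+ 2 = 0.
Proof.
move=> f0; rewrite inE => /andP[s0 /eqP]; rewrite cubic_line f0 add0r => h.
by apply: (mulfI s0); rewrite mulr0 -h; ring.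
Qed.

Lemma onLine_le2 x y d : f x y = 0 -> (#|onLine x y d| <= 2)%N.
Proof.
move=> f0; set u := (direction d).1; set v := (direction d).2.
apply: (@card_roots_le2 (e1 x y u v) (e2 x y u v) (c0 * cubic_form u v)).
  by rewrite lead_neq0 !orbT.
by move=> s /(onLine_root f0).
Qed.

(** On a tangent the base point absorbs two of the three roots, which leaves a factor of degree
    1. *)
Lemma onLine_tangent x y d : f x y = 0 ->
  e1 x y (direction d).1 (direction d).2 = 0 -> (#|onLine x y d| <= 1)%N.
Proof.
move=> f0 h; set u := (direction d).1; set v := (direction d).2.
apply: (@card_roots_le1 (e2 x y u v) (c0 * cubic_form u v)) => [|s sL].
  by rewrite xpair_eqE negb_and lead_neq0 orbT.
have := onLine_root f0 sL; rewrite h add0r -/u -/v => h'.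
have s0 : s != 0 by move: sL; rewrite inE => /andP[].
by apply: (mulfI s0); rewrite mulr0 -h'; ring.
Qed.

(** One linear condition on two coordinates always has a direction as solution; at a singular zero
    every direction qualifies, so smoothness need not be assumed. *)
Lemma tangent_direction x y : exists d, e1 x y (direction d).1 (direction d).2 = 0.
Proof.
case: (eqVneq (dy x y) 0) => h.
  by exists None; rewrite /e1 h mulr0 mul0r addr0.
by exists (Some (- dx x y / dy x y)); rewrite /e1 /=; field.
Qed.

Lemma sum_option_bound (r : option F -> nat) d0 :
  (forall d, r d <= 2)%N -> (\sum_d r d <= 2 * #|F| + r d0)%N.
Proof.
move=> r2; rewrite (bigD1 d0) //= addnC leq_add2r.
have -> : (2 * #|F| = \sum_(d | d != d0) 2)%N.
  by rewrite sum_nat_const mulnC cardC1 card_option.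
by apply: leq_sum => d _.
Qed.

Lemma sum_option_bound2 (r : option F -> nat) d0 d1 : d0 != d1 ->
  (forall d, r d <= 2)%N -> (r d0 <= 1)%N -> (r d1 <= 1)%N -> (\sum_d r d <= 2 * #|F|)%N.
Proof.
move=> d01 r2 r0 r1; rewrite (bigD1 d0) //= (bigD1 d1) /=; last by rewrite eq_sym.
have h : (\sum_(d | (d != d0) && (d != d1)) r d <= \sum_(d | (d != d0) && (d != d1)) 2)%N.
  by apply: leq_sum.
have e : (2 * #|F| = 2 + \sum_(d | (d != d0) && (d != d1)) 2)%N.
  have -> : (2 * #|F| = \sum_(d | d != d0) 2)%N.
    by rewrite sum_nat_const mulnC cardC1 card_option.
  by rewrite (bigD1 d1) //= eq_sym.
by rewrite e addnA leq_add // (leq_add r0 r1).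
Qed.

(* If the tangent at a zero P meets the curve at another zero P', then it meets
   it with multiplicity 1 at P', so that the tangent at P' is another line. *)
Lemma card_zeros_cubic : (#|cubic_zeros c| <= 2 * #|F| + 1)%N.
Proof.
set Z := cubic_zeros c.
case: (set_0Vmem Z) => [->|[[x y]]]; first by rewrite cards0.
rewrite inE /= => /eqP f0.
have [d0 hd0] := tangent_direction x y.
case: (set_0Vmem (onLine x y d0)) => [L0|[s0 s0L]].
  rewrite (leq_trans (zeros_by_lines x y)) // addnC leq_add2r.
  have := sum_option_bound (r := fun d => #|onLine x y d|) d0 (fun d => onLine_le2 d f0).
  by rewrite L0 cards0 addn0.
set u := (direction d0).1 in hd0; set v := (direction d0).2 in hd0.
pose x' := x + s0 * u; pose y' := y + s0 * v.
have [s00 f'0] : s0 != 0 /\ f x' y' = 0 by move: s0L; rewrite inE => /andP[? /eqP ?].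
have r := onLine_root f0 s0L; rewrite -/u -/v hd0 add0r in r.
(* The restriction to the tangent is c0 N(u, v) s^2 (s - s0), where [s0] is the parameter of the
   second intersection point. *)
have e2E : e2 x y u v = - (c0 * cubic_form u v * s0).
  by apply/eqP; rewrite -addr_eq0; apply/eqP; apply: (mulfI s00); rewrite mulr0 -r; ring.
(* The derivative of c0 N(u, v) s^2 (s - s0) at s = s0 is c0 N(u, v) s0^2, so the intersection at
   (x', y') is simple. *)
have ne' : e1 x' y' u v != 0.
  have -> : e1 x' y' u v = c0 * cubic_form u v * s0 ^+ 2.
    have -> : e1 x' y' u v = e1 x y u v + 2%:R * e2 x y u v * s0
        + 3%:R * (c0 * cubic_form u v) * s0 ^+ 2.
      by rewrite /x' /y' /e1 /e2 /dx /dy /cubic_form; ring.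
    by rewrite hd0 e2E; ring.
  by rewrite mulf_neq0 ?expf_neq0 // lead_neq0.
have [d1 hd1] := tangent_direction x' y'.
have d01 : d0 != d1 by apply: contraNneq ne' => e; rewrite /u /v e hd1.
(* Lines through (x', y'): the old tangent and the tangent at (x', y') carry at most one further
   zero each, the other q - 1 lines at most two, in total 1 + 1 + 1 + 2(q - 1). *)
rewrite (leq_trans (zeros_by_lines x' y')) // addnC leq_add2r.
apply: (sum_option_bound2 (r := fun d => #|onLine x' y' d|) d01).
- by move=> d; apply: onLine_le2.
- apply/card_le1_eqP => s t hs ht.
  (* Measured from (x', y'), the restriction is c0 N(u, v) s' (s0 + s')^2; its only nonzero root -s0
     is the point (x, y). *)
  have main s' : s' \in onLine x' y' d0 -> s' = - s0.
    rewrite inE => /andP[s'0 /eqP]; rewrite -/u -/v.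
    have -> : x' + s' * u = x + (s0 + s') * u by rewrite /x'; ring.
    have -> : y' + s' * v = y + (s0 + s') * v by rewrite /y'; ring.
    rewrite cubic_line -/f [f x y]f0 hd0 e2E add0r mul0r add0r => h.
    have {}h : c0 * cubic_form u v * s' * (s0 + s') ^+ 2 = 0 by rewrite -h; ring.
    move/eqP: h; rewrite mulf_eq0 mulf_eq0 (negPf (lead_neq0 d0)) (negPf s'0) /=.
    by rewrite expf_eq0 /= addrC addr_eq0 => /eqP.
  by rewrite (main s) // (main t).
- exact: onLine_tangent.
Qed.

End LinesThroughPoint.

Lemma card_zeros_quadric (c : 'I_7 -> F) : c (inord 0) = 0 -> (exists i, c i != 0) ->
  (#|cubic_zeros c| <= 2 * #|F|)%N.
Proof.
move=> c0 [i ci]; set Z := cubic_zeros c.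
(* A pencil of parallel lines, none of which is contained in the conic. *)
suff [pt [a [b [e [pt_surj h ne]]]]] : exists (pt : F -> F -> F * F) (a b e : F -> F),
   [/\ forall P, exists k s, P = pt k s,
      forall k s, cubic c (pt k s).1 (pt k s).2 = a k + b k * s + e k * s ^+ 2 &
      forall k, [|| a k != 0, b k != 0 | e k != 0]].
  have sub : Z \subset \bigcup_k (pt k @: [set s | cubic c (pt k s).1 (pt k s).2 == 0]).
    apply/subsetP => P; have [k [s ->]] := pt_surj P.
    rewrite inE => hP; apply/bigcupP; exists k => //; apply/imsetP; exists s => //.
    by rewrite inE.
  rewrite (leq_trans (subset_leq_card sub)) // (leq_trans (card_bigcup_le _)) //.
  rewrite mulnC -sum_nat_const; apply: leq_sum => k _.
  rewrite (leq_trans (leq_imset_card _ _)) //; apply: (card_roots_le2 (ne k)).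
  by move=> s; rewrite inE h => /eqP.
have horiz : [|| c (inord 1) != 0, (c (inord 2) == 0) && (c (inord 4) != 0)
    | [&& c (inord 2) == 0, c (inord 3) == 0, c (inord 4) == 0, c (inord 5) == 0
        & c (inord 6) != 0]] ->
   exists (pt : F -> F -> F * F) (a b e : F -> F),
   [/\ forall P, exists k s, P = pt k s,
      forall k s, cubic c (pt k s).1 (pt k s).2 = a k + b k * s + e k * s ^+ 2 &
      forall k, [|| a k != 0, b k != 0 | e k != 0]].
  move=> H; exists (fun k s => (s, k)), (fun k => c (inord 3) * k ^+ 2 + c (inord 5) * k + c (inord 6)),
    (fun k => c (inord 2) * k + c (inord 4)), (fun=> c (inord 1)); split.
  - by case=> x y; exists y, x.
  - by move=> k s /=; rewrite /cubic c0; ring.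
  move=> k; case/or3P: H => [->|/andP[/eqP-> h4]|]; rewrite ?orbT //.
    by rewrite mul0r add0r h4 orbT.
  by case/and5P=> /eqP-> /eqP-> /eqP-> /eqP-> h; rewrite !mul0r !add0r h.
case: (eqVneq (c (inord 1)) 0) => h1; last by apply: horiz; rewrite h1.
have vert : (c (inord 3) != 0) || ((c (inord 2) == 0) && (c (inord 5) != 0)) ->
   exists (pt : F -> F -> F * F) (a b e : F -> F),
   [/\ forall P, exists k s, P = pt k s,
      forall k s, cubic c (pt k s).1 (pt k s).2 = a k + b k * s + e k * s ^+ 2 &
      forall k, [|| a k != 0, b k != 0 | e k != 0]].
  move=> H; exists (fun k s => (k, s)), (fun k => c (inord 1) * k ^+ 2 + c (inord 4) * k + c (inord 6)),
    (fun k => c (inord 2) * k + c (inord 5)), (fun=> c (inord 3)); split.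
  - by case=> x y; exists x, y.
  - by move=> k s /=; rewrite /cubic c0; ring.
  move=> k; case/orP: H => [->|/andP[/eqP-> h]]; rewrite ?orbT //.
  by rewrite mul0r add0r h orbT.
case: (eqVneq (c (inord 3)) 0) => h3; last by apply: vert; rewrite h3.
case: (eqVneq (c (inord 2)) 0) => h2; last first.
  (* With no x^2 and no y^2 term but a nonzero xy term, both axis directions may give a line
     contained in the conic. On the diagonals y = x + k the quadratic coefficient is that of xy. *)
  exists (fun k s => (s, k + s)), (fun k => c (inord 5) * k + c (inord 6)),
    (fun k => c (inord 2) * k + c (inord 4) + c (inord 5)), (fun=> c (inord 2)); split.
  - by case=> x y; exists (y - x), x; rewrite subrK.
  - by move=> k s /=; rewrite /cubic c0 h1 h3; ring.
  - by move=> k; rewrite h2 !orbT.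
case: (eqVneq (c (inord 4)) 0) => h4; last by apply: horiz; rewrite h1 h2 eqxx h4 orbT.
case: (eqVneq (c (inord 5)) 0) => h5; last by apply: vert; rewrite h2 eqxx h5 orbT.
apply: horiz; rewrite h1 h2 h3 h4 h5 !eqxx /=.
case: i ci => i lt_i; have -> : Ordinal lt_i = inord i by apply: val_inj; rewrite /= inordK.
by move: i lt_i; do 7?[case; first by rewrite ?c0 ?h1 ?h2 ?h3 ?h4 ?h5 ?eqxx].
Qed.

(** The witness is x^2 - x, two parallel lines. As a cubic of the system it is the union of these
    lines and z = 0, so it also vanishes at the contracted point. *)
Lemma quadric_with_2q_zeros : exists c : 'I_7 -> F,
  [/\ c (inord 0) = 0, c (inord 1) != 0 & #|cubic_zeros c| = (2 * #|F|)%N].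
Proof.
pose c := fun i : 'I_7 => if i == inord 1 then 1 else if i == inord 4 then -1 else 0 : F.
have cE : (c (inord 0) = 0) * (c (inord 1) = 1) * (c (inord 2) = 0) * (c (inord 3) = 0)
   * (c (inord 4) = -1) * (c (inord 5) = 0) * (c (inord 6) = 0).
  by rewrite /c -!val_eqE /= !inordK.
exists c; rewrite !cE oner_neq0; split=> //.
have -> : cubic_zeros c = setX [set 0; 1] setT.
  apply/setP => -[x y]; rewrite !inE /= andbT /cubic !cE.
  have -> : 0 * cubic_form x y + 1 * x ^+ 2 + 0 * (x * y) + 0 * y ^+ 2 + -1 * x + 0 * y + 0
     = x * (x - 1) by ring.
  by rewrite mulf_eq0 subr_eq0.
by rewrite cardsX cards2 cardsT eq_sym oner_neq0.
Qed.

End PlaneCubicPoints.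

(** * Polynomials in two variables *)

Lemma ex_min_nat (P : nat -> Prop) : (exists n, P n) ->
  exists2 n, P n & forall m, P m -> (n <= m)%N.
Proof.
case=> n; elim/ltn_ind: n => n IH Pn.
case: (classic (exists2 m, P m & (m < n)%N)) => [[m Pm lt_mn]|h]; first exact: IH Pm.
exists n => // m Pm; rewrite leqNgt; apply/negP => lt_mn.
by apply: h; exists m.
Qed.

Section Eval2.
Variables (F : nzRingType) (R : comNzRingType) (phi : {rmorphism F -> R}).

Definition ev1 (u : R) : {poly F} -> R := horner_eval u \o map_poly phi.
HB.instance Definition _ u := GRing.RMorphism.copy (ev1 u) (horner_eval u \o map_poly phi).

Arguments ev1 : simpl never.

(** Polynomials in two variables are kept as F[T][w], [u] replacing the inner variable and [v] the
    outer one: division in w and reduction of the coefficients at a value of T are both used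
    below. *)
Definition ev2 (u v : R) : {poly {poly F}} -> R := horner_eval v \o map_poly (ev1 u).
HB.instance Definition _ u v :=
  GRing.RMorphism.copy (ev2 u v) (horner_eval v \o map_poly (ev1 u)).

Arguments ev2 : simpl never.

Lemma ev1_horner u p : ev1 u p = (map_poly phi p).[u].
Proof. by []. Qed.

Lemma ev2_horner u v G : ev2 u v G = (map_poly (ev1 u) G).[v].
Proof. by []. Qed.

Lemma ev1C u c : ev1 u c%:P = phi c.
Proof. by rewrite /ev1 /= map_polyC /horner_eval hornerC. Qed.

Lemma ev1X u : ev1 u 'X = u.
Proof. by rewrite /ev1 /= map_polyX /horner_eval hornerX. Qed.

Lemma ev2D u v : {morph ev2 u v : G H / G + H}. Proof. exact: rmorphD. Qed.
Lemma ev2B u v : {morph ev2 u v : G H / G - H}. Proof. exact: rmorphB. Qed.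
Lemma ev2M u v : {morph ev2 u v : G H / G * H}. Proof. exact: rmorphM. Qed.
Lemma ev2Xn u v n : {morph ev2 u v : G / G ^+ n}. Proof. exact: rmorphXn. Qed.
Lemma ev1D u : {morph ev1 u : G H / G + H}. Proof. exact: rmorphD. Qed.
Lemma ev1M u : {morph ev1 u : G H / G * H}. Proof. exact: rmorphM. Qed.
Lemma ev1Xn u n : {morph ev1 u : G / G ^+ n}. Proof. exact: rmorphXn. Qed.
Lemma ev2_zero u v : ev2 u v 0 = 0. Proof. exact: rmorph0. Qed.
Lemma ev1_zero u : ev1 u 0 = 0. Proof. exact: rmorph0. Qed.
Lemma ev2_one u v : ev2 u v 1 = 1. Proof. exact: rmorph1. Qed.

Lemma ev1E u (p : {poly F}) : ev1 u p = \sum_(i < size p) phi p`_i * u ^+ i.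
Proof.
rewrite -[in LHS](coefK p) poly_def rmorph_sum; apply: eq_bigr => i _.
by rewrite -mul_polyC rmorphM rmorphXn /= ev1C ev1X.
Qed.

Lemma ev2C u v (c : {poly F}) : ev2 u v c%:P = ev1 u c.
Proof. by rewrite /ev2 /= map_polyC /horner_eval hornerC. Qed.

Lemma ev2X u v : ev2 u v 'X = v.
Proof. by rewrite /ev2 /= map_polyX /horner_eval hornerX. Qed.

Lemma ev2E u v (G : {poly {poly F}}) : ev2 u v G = \sum_(m < size G) ev1 u G`_m * v ^+ m.
Proof.
rewrite -[in LHS](coefK G) poly_def rmorph_sum; apply: eq_bigr => i _.
by rewrite -mul_polyC rmorphM rmorphXn /= ev2C ev2X.
Qed.

Lemma ev2_0 u (G : {poly {poly F}}) : ev2 u 0 G = ev1 u G`_0.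
Proof.
elim/poly_ind: G => [|G c _]; first by rewrite coef0 !rmorph0.
by rewrite rmorphD rmorphM /= ev2X mulr0 add0r ev2C coefD coefMX coefC add0r.
Qed.

End Eval2.

Lemma rmorph_ev1 (F : nzRingType) (R S : comNzRingType) (phi : {rmorphism F -> R})
  (f : {rmorphism R -> S}) u p : f (ev1 phi u p) = ev1 (f \o phi) (f u) p.
Proof.
rewrite !ev1E rmorph_sum; apply: eq_bigr => i _.
by rewrite rmorphM rmorphXn.
Qed.

(** * Fractions in lowest terms over F[T][w] *)

Section LowestTerms.
Variables (F : fieldType) (L : closedFieldType) (iota : {rmorphism F -> L}).
Hypothesis L_alg : forall a : L, algebraicOver iota a.

Lemma min_poly_exists (t : L) : exists pi : {poly F},
  (1 < size pi)%N /\ forall G, root (map_poly iota G) t = (pi %| G).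
Proof.
have [n [p [p0 rp <-]] n_min] : exists2 n,
    (exists p : {poly F}, [/\ p != 0, root (map_poly iota p) t & size p = n]) &
    forall m, (exists p : {poly F}, [/\ p != 0, root (map_poly iota p) t & size p = m]) -> (n <= m)%N.
  apply: ex_min_nat; have [p p0 rp] := L_alg t.
  by exists (size p), p.
exists p; split.
  rewrite ltnNge; apply/negP => /size1_polyC pE.
  move: rp p0; rewrite pE map_polyC rootC polyC_eq0 fmorph_eq0.
  by move/eqP->; rewrite eqxx.
move=> G; apply/idP/idP => [rG|/dvdpP[q ->]]; last by rewrite rmorphM rootM rp orbT.
rewrite /dvdp; apply/negPn/negP => ne0.
have : (size p <= size (G %% p)%R)%N.
  apply: n_min; exists (G %% p); split=> //.
  move: rG; rewrite {1}(divp_eq G p) rmorphD rmorphM /root hornerD hornerM.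
  by rewrite (rootP rp) mulr0 add0r.
by rewrite leqNgt ltn_modp p0.
Qed.

Local Notation red t := (map_poly (ev1 iota t)).

Lemma red_eq0 (t : L) (pi : {poly F}) (G : {poly {poly F}}) :
  (forall p, root (map_poly iota p) t = (pi %| p)) ->
  red t G = 0 -> exists G', G = pi%:P * G'.
Proof.
move=> piP h; exists (\poly_(i < size G) (G`_i %/ pi)).
apply/polyP => i; rewrite coefCM coef_poly.
case: ltnP => [_|/(nth_default 0)->]; last by rewrite mulr0.
rewrite mulrC divpK // -piP.
by have /polyP/(_ i) := h; rewrite coef_map coef0 => /eqP.
Qed.

(** Unique factorization in F[T][w], in the form needed for fractions. The denominator [B'] is
    chosen of least degree in w, then with leading coefficient of least degree in T. Pseudo-division
    shows that any other denominator H satisfies c H = E B' with c in F[T] nonzero, and the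
    irreducible factors of c are then cancelled one at a time. *)
Lemma lowest_terms (A B : {poly {poly F}}) : B != 0 ->
  exists A' B' : {poly {poly F}}, [/\ B' != 0, A * B' = A' * B &
    forall G H, A' * H = B' * G -> exists2 E, H = B' * E & G = A' * E].
Proof.
move=> B0.
pose den H := H != 0 /\ exists G, A * H = G * B.
have [r [H1 denH1 sH1] r_min] : exists2 r, (exists2 H, den H & size H = r) &
    forall m, (exists2 H, den H & size H = m) -> (r <= m)%N.
  by apply: ex_min_nat; exists (size B), B => //; split => //; exists A.
have [l [B' denB' [sB' <-]] l_min] : exists2 l,
    (exists2 H, den H & size H = r /\ size (lead_coef H) = l) &
    forall m, (exists2 H, den H & size H = r /\ size (lead_coef H) = m) -> (l <= m)%N.
  by apply: ex_min_nat; exists (size (lead_coef H1)), H1.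
case: denB' => B'0 [A' AB'].
exists A', B'; split=> // G H A'H.
have AH : A * H = B * G.
  apply: (mulfI B'0); transitivity (A' * H * B); last by rewrite A'H; ring.
  by rewrite mulrA [B' * A]mulrC AB'; ring.
(* The pseudo-remainder of [H] by [B'] is again a denominator of the same fraction, of smaller
   degree in w, hence zero. *)
have [c c0 [E cH]] : exists2 c : {poly F}, c != 0 & exists E, c%:P * H = E * B'.
  exists (lead_coef B' ^+ scalp H B'); first by rewrite expf_neq0 ?lead_coef_eq0.
  have e := Pdiv.Idomain.divp_eq H B'.
  exists (H %/ B'); rewrite mul_polyC e.
  case: (eqVneq (H %% B') 0) => [->|R0]; first by rewrite addr0.
  have : (r <= size (H %% B')%R)%N.
    apply: r_min; exists (H %% B') => //; split=> //.
    exists (lead_coef B' ^+ scalp H B' *: G - (H %/ B') * A').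
    have -> : H %% B' = lead_coef B' ^+ scalp H B' *: H - (H %/ B') * B'.
      by rewrite e addrC addKr.
    rewrite -!mul_polyC; move: (_%:P) (H %/ B') => k D.
    transitivity (k * (A * H) - D * (A * B')); first by ring.
    by rewrite AH AB'; ring.
  by rewrite leqNgt -sB' ltn_modp B'0.
move: {2}(size c) (leqnn (size c)) => n; elim: n c c0 E cH => [|n IH] c c0 E cH sc.
  by move: sc; rewrite leqn0 size_poly_eq0 (negPf c0).
have cG : c%:P * G = E * A'.
  apply: (mulfI B'0); transitivity (c%:P * (B' * G)); first by ring.
  by rewrite -A'H mulrCA cH; ring.
case: (leqP (size c) 1) => [sc1|sc1].
  have cE := size1_polyC sc1; set k := c`_0 in cE.
  have k0 : k != 0 by move: c0; rewrite cE polyC_eq0.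
  exists (k^-1%:P%:P * E).
    by rewrite mulrCA [B' * E]mulrC -cH cE mulrA -!rmorphM mulVf // !rmorph1 mul1r.
  by rewrite mulrCA [A' * E]mulrC -cG cE mulrA -!rmorphM mulVf // !rmorph1 mul1r.
have /closed_rootP[t rt] : size (map_poly iota c) != 1 by rewrite size_map_poly gtn_eqF.
have [pi [pi1 piP]] := min_poly_exists t.
move: (rt); rewrite piP => /dvdpP[c1 cE].
have pi0 : pi != 0 by rewrite -size_poly_gt0 (ltn_trans _ pi1).
have piC0 : pi%:P != 0 by rewrite polyC_eq0.
have redc : red t c%:P = 0.
  by rewrite map_polyC /=; have -> : ev1 iota t c = 0 by apply/eqP.
(* Gauss's lemma. Reduction at a root t of c kills E B' and E A'. As L[w] is a domain, either E is
   divisible by the minimal polynomial of t, or [A'] and [B'] both are, which contradicts the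
   minimality of the leading coefficient of [B']. *)
have [E1 E1E] : exists E', E = pi%:P * E'.
  apply: (red_eq0 piP); apply/eqP; case: (boolP (red t E == 0)) => // redE.
  have hB : red t B' = 0.
    by apply: (mulfI redE); rewrite mulr0 -rmorphM -cH rmorphM /= redc mul0r.
  have hA : red t A' = 0.
    by apply: (mulfI redE); rewrite mulr0 -rmorphM -cG rmorphM /= redc mul0r.
  have [B1 B1E] := red_eq0 piP hB; have [A1 A1E] := red_eq0 piP hA.
  have B10 : B1 != 0 by apply: contraNneq B'0 => B10; rewrite B1E B10 mulr0.
  have : (size (lead_coef B') <= size (lead_coef B1))%N.
    apply: l_min; exists B1; last first.
      by split=> //; rewrite -sB' B1E size_Cmul.
    split=> //; exists A1; apply: (mulfI piC0).
    by rewrite mulrCA -B1E AB' A1E mulrA.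
  rewrite B1E lead_coefM lead_coefC size_mul ?lead_coef_eq0 // leqNgt.
  have : (0 < size (lead_coef B1))%N by rewrite size_poly_gt0 lead_coef_eq0.
  by move: pi1; set a := size pi; set b := size _; clearbody a b; lia.
have c10 : c1 != 0 by apply: contraNneq c0 => c10; rewrite cE c10 mul0r.
apply: (IH c1 c10 E1); last first.
  rewrite -ltnS (leq_trans _ sc) // cE size_mul //.
  by move: pi1; set a := size pi; set b := size _; clearbody a b; lia.
apply: (mulfI piC0).
by rewrite [RHS]mulrA -E1E -cH cE rmorphM /= mulrA [_ * pi%:P]mulrC.
Qed.

End LowestTerms.

(** * A weight on F[T][w], and the change to the chart at infinity *)

Section Weight.
Variable F : fieldType.
Implicit Types A E H : {poly {poly F}}.

(** Since [size] is the degree plus one and subtraction is truncated, the value a + 1 means that the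
    largest i - 2 m over the monomials T^i w^m is a, and the value 0 means that no monomial has i -
    2 m >= 0. *)
Definition weight A := (\max_(m < size A) (size (A`_m)%R - 2 * m))%N.

Lemma weight_geq A m : (size (A`_m)%R <= weight A + 2 * m)%N.
Proof.
case: (ltnP m (size A)) => h; last by rewrite nth_default // size_poly0.
by rewrite addnC -leq_subLR /weight (bigmax_sup (Ordinal h)).
Qed.

Lemma coef_mul_top (p r : {poly F}) a b : (size p <= a.+1)%N -> (size r <= b.+1)%N ->
  (p * r)`_(a + b) = p`_a * r`_b.
Proof.
move=> sp sr; rewrite coefM (bigD1 (inord a)) //= inordK ?ltnS ?leq_addr //.
rewrite addKn big1 ?addr0 // => i ne.
case: (ltngtP i a) => hi.
- by rewrite [r`__]nth_default ?mulr0 // (leq_trans sr) //; lia.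
- by rewrite [p`__]nth_default ?mul0r // (leq_trans sp).
- by case/eqP: ne; apply: val_inj; rewrite /= inordK ?ltnS ?leq_addr.
Qed.

(** The part of weight exactly a, with T set to 1. *)
Definition top_part a A : {poly F} := \poly_(m < size A) A`_m`_(a + 2 * m).

Lemma coef_top_part a A m : (top_part a A)`_m = A`_m`_(a + 2 * m).
Proof.
by rewrite coef_poly; case: ltnP => // h; rewrite [A`_m]nth_default // coef0.
Qed.

Lemma top_part_neq0 a A : weight A = a.+1 -> top_part a A != 0.
Proof.
move=> wA; have [n n_sz] : {n | (n < size A)%N}.
  case: (posnP (size A)) => [s0|]; last by exists 0%N.
  by move: wA; rewrite /weight s0 big_ord0.
have [|i wi] := @eq_bigmax 'I_(size A) (fun m => size (A`_m)%R - 2 * m)%N.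
  by rewrite card_ord (leq_ltn_trans _ n_sz).
have sz : size (A`_i)%R = (a + 2 * i).+1 by move: wA; rewrite /weight wi; lia.
apply: contraTneq isT => h.
have : lead_coef A`_i = 0 by rewrite lead_coefE sz -coef_top_part h coef0.
by move/eqP; rewrite lead_coef_eq0 -size_poly_eq0 sz.
Qed.

(* The weight [i - 2 m] of [T ^ i w ^ m] is a valuation: top parts multiply. *)
Lemma weight_factor J A E : (J < size (E`_0)%R)%N ->
  (forall m, size ((A * E)`_m)%R <= J + 2 * m + 1)%N -> forall m, (size (A`_m)%R <= 2 * m + 1)%N.
Proof.
move=> sE hAE m; rewrite leqNgt; apply/negP => hm.
have := weight_geq A m; case wA: (weight A) => [|a] hA; first by lia.
have := weight_geq E 0; case wE: (weight E) => [|e] hE; first by lia.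
have ne : top_part a A * top_part e E != 0 by rewrite mulf_neq0 ?top_part_neq0.
have [k hk] : exists k, (top_part a A * top_part e E)`_k != 0.
  by exists (size (top_part a A * top_part e E)).-1; rewrite -lead_coefE lead_coef_eq0.
have kE : (A * E)`_k`_(a + e + 2 * k) = (top_part a A * top_part e E)`_k.
  rewrite !coefM coef_sum; apply: eq_bigr => i _.
  have -> : (a + e + 2 * k = (a + 2 * i) + (e + 2 * (k - i)))%N by have := ltn_ord i; lia.
  rewrite coef_mul_top ?coef_top_part //.
    by have := weight_geq A i; rewrite wA addSn.
  by have := weight_geq E (k - i); rewrite wE addSn.
have : (a + e + 2 * k < size ((A * E)`_k)%R)%N.
  by rewrite ltnNge; apply: contra hk => h; rewrite -kE nth_default.
have := hAE k; lia.
Qed.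

(** The polynomial T^J H(1/T, w C(T)/T): it rewrites a polynomial in the coordinates (1/T, Z/T) of
    the chart at infinity in terms of T and w, where Z = w C(T). It is used with C = 1, so that w is
    Z, and with C = N. *)
Definition flip J (C : {poly F}) H : {poly {poly F}} :=
  \poly_(m < size H) (C ^+ m * \sum_(i < size (H`_m)%R) H`_m`_i *: 'X^(J - i - m)).

(** From this value of J on, none of the exponents J - i - m in [flip] is truncated. *)
Definition flip_deg H := (size H + \max_(m < size H) size (H`_m)%R)%N.

Lemma flip_deg_geq H m i : (m < size H)%N -> (i < size (H`_m)%R)%N -> (i + m <= flip_deg H)%N.
Proof.
move=> hm hi; rewrite addnC; apply: leq_add; first exact: ltnW.
by rewrite (leq_trans (ltnW hi)) // (bigmax_sup (Ordinal hm)).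
Qed.

Lemma ev2_flip (K : fieldType) (phi : {rmorphism F -> K}) J C H (u v : K) :
  u != 0 -> (flip_deg H <= J)%N ->
  ev2 phi u v (flip J C H) = u ^+ J * ev2 phi u^-1 (v * ev1 phi u C / u) H.
Proof.
move=> u0 hJ; rewrite !ev2E mulr_sumr.
transitivity (\sum_(m < size H) ev1 phi u (flip J C H)`_m * v ^+ m).
  rewrite !(big_ord_widen_cond (size H + size (flip J C H)) predT (fun i => ev1 phi u (flip J C H)`_i * v ^+ i)) ?leq_addl ?leq_addr //.
  rewrite big_mkcond [RHS]big_mkcond; apply: eq_bigr => i _ /=.
  case: ltnP => h1; case: ltnP => h2 //.
    by rewrite coef_poly ltnNge h2 rmorph0 mul0r.
  by rewrite nth_default // rmorph0 mul0r.
apply: eq_bigr => m _; rewrite coef_poly ltn_ord rmorphM rmorphXn rmorph_sum.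
rewrite [ev1 _ u^-1 _]ev1E !mulr_suml !mulr_sumr mulr_suml; apply: eq_bigr => i _.
have hi := flip_deg_geq (ltn_ord m) (ltn_ord i).
rewrite -mul_polyC rmorphM rmorphXn /= ev1C ev1X.
have -> : u ^+ J = u ^+ (J - i - m) * u ^+ i * u ^+ m by rewrite -!exprD; congr (_ ^+ _); lia.
rewrite !exprMn !exprVn; set P := phi _; set x := u ^+ (_ - _); set y := u ^+ i.
set z := u ^+ m; set c := _ ^+ _; set w := v ^+ _.
by field; rewrite /y /z !expf_neq0.
Qed.

(** Taking s = 0 (C = 1) gives the bound on the total degree of a plane curve; taking s = 3 (C = N)
    gives degree at most J + 2 m, which is the bound J on the weight. *)
Lemma size_flip J (C : {poly F}) H m s : (flip_deg H <= J)%N -> (size C <= s.+1)%N ->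
  (flip J C H)`_m != 0 -> (size ((flip J C H)`_m)%R + m <= J + s * m + 1)%N.
Proof.
move=> hJ sC; rewrite coef_poly; case: ltnP => hm; last by rewrite eqxx.
move=> _.
have sCm : (size (C ^+ m) <= s * m + 1)%N.
  rewrite (leq_trans (size_poly_exp_leq _ _)) // addn1 ltnS leq_mul2r.
  by apply/orP; right; lia.
have : (size (\sum_(i < size (H`_m)%R) H`_m`_i *: 'X^(J - i - m) : {poly F})%R <= J - m + 1)%N.
  apply: (leq_trans (size_sum _ _ _)); apply/bigmax_leqP => i _.
  by rewrite (leq_trans (size_scale_leq _ _)) // size_polyXn; lia.
set Q := \sum_(_ < _) _ => sQ.
have := size_polyMleq (C ^+ m) Q.
have : (m <= J)%N by rewrite (leq_trans _ hJ) // /flip_deg; lia.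
by move: sCm sQ; lia.
Qed.

(** The constant term of H becomes the coefficient of T^J, and nothing of higher degree occurs. *)
Lemma size_flip0 J (C : {poly F}) H : (flip_deg H <= J)%N -> H`_0`_0 != 0 -> size ((flip J C H)`_0)%R = J.+1.
Proof.
move=> hJ h0; have s0 : (0 < size (H`_0)%R)%N.
  by rewrite lt0n size_poly_eq0; apply: contraNneq h0 => ->; rewrite coef0.
have sH : (0 < size H)%N.
  by rewrite lt0n size_poly_eq0; apply: contraTneq s0 => ->; rewrite coef0 size_poly0.
rewrite coef_poly sH expr0 mul1r.
have -> : \sum_(i < size (H`_0)%R) H`_0`_i *: 'X^(J - i - 0)
   = \poly_(j < J.+1) (if (J - j < size (H`_0)%R)%N then H`_0`_(J - j) else 0).
  apply/polyP => j; rewrite coef_sum coef_poly.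
  under eq_bigr => i _ do rewrite coefZ coefXn subn0.
  have bnd (i : 'I_(size (H`_0)%R)) : (i <= J)%N.
    by have := flip_deg_geq sH (ltn_ord i); rewrite addn0 => /leq_trans->.
  case: ltnP => hj; last first.
    rewrite big1 // => i _; case: eqP => [e|_]; last by rewrite mulr0.
    by move: hj; rewrite e ltnNge leq_subr.
  case: ltnP => hi.
    rewrite (bigD1 (Ordinal hi)) //= big1 ?addr0 => [|i ne].
      by rewrite subKn ?eqxx ?mulr1.
    case: eqP => [e|_]; last by rewrite mulr0.
    by case/eqP: ne; apply: val_inj; rewrite /= e subKn ?bnd.
  rewrite big1 // => i _; case: eqP => [e|_]; last by rewrite mulr0.
  by move: hi; rewrite e subKn ?bnd // leqNgt ltn_ord.
by apply: size_poly_eq; rewrite subnn s0.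
Qed.

End Weight.

(** * Local rings of the function field *)

Lemma mmap_sum (n : nat) (R : nzRingType) (S : nzRingType) (phi : R -> S)
    (h : 'I_n -> S) (G : {mpoly R[n]}) :
  mmap phi h G = \sum_(m <- msupp G) phi G@_m * \prod_(i < n) h i ^+ m i.
Proof. by []. Qed.

Lemma rmorph_mmap (n : nat) (R : nzRingType) (S S' : comNzRingType) (phi : R -> S)
    (f : {rmorphism S -> S'}) (h : 'I_n -> S) (G : {mpoly R[n]}) :
  f (mmap phi h G) = mmap (f \o phi) (f \o h) G.
Proof.
rewrite /mmap rmorph_sum; apply: eq_bigr => m _; rewrite rmorphM; congr (_ * _).
by rewrite /mmap1 rmorph_prod; apply: eq_bigr => i _; rewrite rmorphXn.
Qed.

Lemma eq_mmap (n : nat) (R : nzRingType) (S : comNzRingType) (phi psi : R -> S)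
    (h k : 'I_n -> S) (G : {mpoly R[n]}) :
  phi =1 psi -> h =1 k -> mmap phi h G = mmap psi k G.
Proof.
move=> e1 e2; rewrite /mmap; apply: eq_bigr => m _; rewrite e1; congr (_ * _).
by apply: eq_bigr => i _; rewrite e2.
Qed.

Lemma mmap_scale (n : nat) (R : nzRingType) (S : comNzRingType)
    (phi : {rmorphism R -> S}) (h : 'I_n -> S) (d : nat) (G : {mpoly R[n]}) c :
  G \is d.-homog -> mmap phi (fun i => h i * c) G = mmap phi h G * c ^+ d.
Proof.
move=> /dhomogP hG; rewrite /mmap mulr_suml big_seq [RHS]big_seq.
apply: eq_bigr => m /hG <-; rewrite -mulrA; congr (_ * _).
rewrite /mmap1 /= mdegE -prodrXr -big_split /=.
by apply: eq_bigr => i _; rewrite exprMn.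
Qed.

Lemma neq0_mull (R : idomainType) (a b : R) : a * b != 0 -> a != 0.
Proof. by rewrite mulf_eq0 negb_or => /andP[]. Qed.

Lemma neq0_mulr (R : idomainType) (a b : R) : a * b != 0 -> b != 0.
Proof. by rewrite mulf_eq0 negb_or => /andP[]. Qed.

Lemma cross_mul (R : fieldType) (a b c d : R) : b != 0 -> d != 0 ->
  a / b = c / d <-> a * d - b * c = 0.
Proof.
move=> b0 d0; split=> [/eqP|/eqP].
  by rewrite eqr_div // => /eqP ->; rewrite [b * c]mulrC subrr.
by rewrite subr_eq0 [b * c]mulrC -eqr_div // => /eqP.
Qed.

Lemma add_fracs (R : fieldType) (a b c d : R) : b != 0 -> d != 0 ->
  a / b + c / d = (a * d + b * c) / (b * d).
Proof. by move=> b0 d0; rewrite addf_div // [b * c]mulrC. Qed.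

Lemma poly_all_roots (L : closedFieldType) (p : {poly L}) (r : {poly L}) : r != 0 ->
  (forall a, r.[a] != 0 -> p.[a] = 0) -> p = 0.
Proof.
move=> r0 h; apply: (mulfI r0); rewrite mulr0; apply/eqP.
apply: contraT => /closed_nonrootP[a]; rewrite rootM negb_or => /andP[ra].
by rewrite /root h ?eqxx.
Qed.

(** Two representatives n/d = m/e of a fraction give the same derivative; the second hypothesis is
    the derivative of the first. *)
Lemma quotient_rule (R : comNzRingType) (n d m e n' d' m' e' : R) :
  n * e = m * d -> n' * e + n * e' = m' * d + m * d' ->
  (n' * d - n * d') * e ^+ 2 = (m' * e - m * e') * d ^+ 2.
Proof.
move=> h1 h2.
transitivity (d * e * (n' * e + n * e') - d * e' * (n * e) - e * d' * (n * e)); first by ring.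
by rewrite h2 h1; ring.
Qed.

(** * Derivations of the function field *)

Section RationalFunctions.
Variable F : finFieldType.
Local Notation K := (ratfun F).
Local Notation kc := (@ratfun_const F).
Local Notation pK := (@tofrac {mpoly F[2]}).
Local Open Scope quotient_scope.
Implicit Types (f g h u v : K).

HB.instance Definition _ := GRing.RMorphism.copy kc
  (@FracField.tofrac {mpoly F[2]} \o @mpolyC 2 F).

Lemma ratfun_repr f : f * tofrac \d_(repr f) = tofrac \n_(repr f).
Proof.
rewrite -{1}[f]reprK; unlock FracField.tofrac.
set r := repr f; transitivity (\pi_(FracField.type {mpoly F[2]}) (FracField.mulf r (Ratio \d_r 1))).
  by rewrite FracField.pi_mul.
apply/eqmodP; rewrite /= FracField.equivfE /FracField.mulf.
by rewrite !numden_Ratio ?(oner_neq0, mulf_neq0, denom_ratioP) // !mulr1 mulrC.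
Qed.

Lemma ratfun_reprE f : f = tofrac \n_(repr f) / tofrac \d_(repr f).
Proof. by rewrite -ratfun_repr mulfK // tofrac_eq0 denom_ratioP. Qed.

Lemma ratfun_ind (Q : K -> Prop) :
  (forall c, Q (kc c)) -> (forall i, Q (ratfun_var F i)) ->
  (forall f g, Q f -> Q g -> Q (f + g)) -> (forall f g, Q f -> Q g -> Q (f * g)) ->
  (forall f, f != 0 -> Q f -> Q f^-1) -> forall f, Q f.
Proof.
move=> Qc Qv QD QM QV.
have Q1 : Q 1 by have := Qc 1; rewrite rmorph1.
have Qp (p : {mpoly F[2]}) : Q (tofrac p).
  rewrite [p]mpolyE rmorph_sum /=; apply: big_ind => [||m _]; [|exact: QD|].
    by have := Qc 0; rewrite rmorph0.
  rewrite -mul_mpolyC rmorphM; apply: (QM _ _); first exact: (Qc).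
  rewrite mpolyXE_id rmorph_prod /=; apply: big_ind => [||i _]; [exact: Q1|exact: QM|].
  rewrite rmorphXn; elim: (m i) => [|n IH]; first by rewrite expr0.
  by rewrite exprS; apply: (QM _ _) => //; apply: (Qv _).
move=> f; rewrite [f]ratfun_reprE; apply: (QM _ _) => //; apply: (QV _) => //.
by rewrite tofrac_eq0 denom_ratioP.
Qed.

Lemma ratfun_deriv_frac i (n d : {mpoly F[2]}) : d != 0 ->
  ratfun_deriv i (pK n / pK d) = pK (n^`M(i) * d - n * d^`M(i)) / pK (d ^+ 2).
Proof.
move=> d0; rewrite /ratfun_deriv; set f := pK n / pK d.
have := ratfun_reprE f; set m := \n_(repr f); set e := \d_(repr f) => fE.
have e0 : e != 0 by exact: denom_ratioP.
have h : n * e = m * d.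
  apply/eqP; rewrite -tofrac_eq !tofracM -eqr_div ?tofrac_eq0 //; apply/eqP.
  exact: fE.
apply/eqP; rewrite eqr_div ?tofrac_eq0 ?expf_neq0 // -!tofracM tofrac_eq; apply/eqP.
apply/esym/quotient_rule; first exact: h.
by rewrite -!mderivM h.
Qed.

Lemma ratfun_fracP f : exists n d : {mpoly F[2]}, d != 0 /\ f = pK n / pK d.
Proof. by exists \n_(repr f), \d_(repr f); rewrite denom_ratioP -ratfun_reprE. Qed.

Record derivation (D : K -> K) : Prop := Derivation {
  der_add : forall f g, D (f + g) = D f + D g;
  der_mul : forall f g, D (f * g) = D f * g + f * D g;
  der_const : forall c, D (kc c) = 0 }.

Lemma ratfun_deriv_derivation i : derivation (ratfun_deriv i).
Proof.
split.
- move=> f g; have [n [d [d0 ->]]] := ratfun_fracP f; have [m [e [e0 ->]]] := ratfun_fracP g.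
  rewrite addf_div ?tofrac_eq0 // -!tofracM -tofracD.
  rewrite !ratfun_deriv_frac ?mulf_neq0 // addf_div ?tofrac_eq0 ?expf_neq0 //.
  rewrite -!tofracM -!tofracD exprMn; congr (pK _ / _).
  by rewrite !mderivD !mderivM; ring.
- move=> f g; have [n [d [d0 ->]]] := ratfun_fracP f; have [m [e [e0 ->]]] := ratfun_fracP g.
  rewrite mulf_div -!tofracM.
  rewrite !ratfun_deriv_frac ?mulf_neq0 // !mulf_div -!tofracM addf_div ?tofrac_eq0 ?mulf_neq0 ?expf_neq0 //.
  rewrite -!tofracM -!tofracD; apply/eqP.
  rewrite eqr_div ?tofrac_eq0 ?mulf_neq0 ?expf_neq0 ?mulf_neq0 // -!tofracM tofrac_eq; apply/eqP.
  by rewrite !mderivM; ring.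
- move=> c.
  have -> : kc c = pK c%:MP / pK 1 by rewrite tofrac1 divr1.
  rewrite ratfun_deriv_frac ?oner_neq0 // mderivC mul0r -[1]/(1%:MP : {mpoly F[2]}) mderivC mulr0 subr0.
  by rewrite tofrac0 mul0r.
Qed.

Lemma ratfun_deriv_var i j : ratfun_deriv i (ratfun_var F j) = (i == j)%:R.
Proof.
have -> : ratfun_var F j = pK 'X_j / pK 1 by rewrite tofrac1 divr1.
rewrite ratfun_deriv_frac ?oner_neq0 // -[1]/(1%:MP : {mpoly F[2]}) mderivC mulr0 subr0.
rewrite mulr1 expr1n tofrac1 divr1 mderivX mnm1E eq_sym.
case: eqP => [->|_]; last by rewrite scale0r tofrac0.
rewrite scale1r; have -> : (U_(j) - U_(j) = 0 :> 'X_{1..2})%MM.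
  by apply/mnmP => k; rewrite mnmBE subnn mnm0E.
by rewrite mpolyX0 tofrac1.
Qed.

End RationalFunctions.

(* Unfolded, these constants make conversion problems in [ratfun F] intractable. *)
Opaque ratfun ratfun_const mmap ev1 ev2 ratfun_deriv ratfun_var.

(** * Local subrings with evaluation, and extension over finitely many points *)

Section Germs.
Variables (F : finFieldType) (L : closedFieldType) (iota : {rmorphism F -> L}).
Local Notation K := (ratfun F).
Local Notation kc := (@ratfun_const F).
Implicit Types (f g h : K) (x y : germ F L) (a b : L).

(** The graph of a homomorphism from a subring of K to L over [iota], where [lg_inv] makes every
    element of nonzero value a unit. Points of the plane, of the blow-up and of the model are all
    handled through this interface. *)
Record local_germ x : Prop := LocalGerm {
  lg_fun : forall f a b, x f a -> x f b -> a = b;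
  lg_const : forall c, x (kc c) (iota c);
  lg_add : forall f g a b, x f a -> x g b -> x (f + g) (a + b);
  lg_mul : forall f g a b, x f a -> x g b -> x (f * g) (a * b);
  lg_inv : forall f a, x f a -> a != 0 -> x f^-1 a^-1 }.

Section LocalGermTheory.
Variables (x : germ F L) (lx : local_germ x).

Lemma lg0 : x 0 0. Proof. by have := lg_const lx 0; rewrite !rmorph0. Qed.
Lemma lg1 : x 1 1. Proof. by have := lg_const lx 1; rewrite !rmorph1. Qed.

Lemma lg_opp f a : x f a -> x (- f) (- a).
Proof.
move=> h; rewrite -mulN1r -[- a]mulN1r; apply: (lg_mul lx) => //.
by have := lg_const lx (-1); rewrite !rmorphN1.
Qed.

Lemma lg_sub f g a b : x f a -> x g b -> x (f - g) (a - b).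
Proof. by move=> ? ?; apply: (lg_add lx) => //; apply: lg_opp. Qed.

Lemma lg_exp f a n : x f a -> x (f ^+ n) (a ^+ n).
Proof.
move=> h; elim: n => [|n IH]; first by rewrite !expr0; apply: lg1.
by rewrite !exprS; apply: (lg_mul lx).
Qed.

Lemma lg_div f g a b : x f a -> x g b -> b != 0 -> x (f / g) (a / b).
Proof. by move=> ? ? ?; apply: (lg_mul lx) => //; apply: (lg_inv lx). Qed.

Lemma lg_sum (I : Type) (r : seq I) (P : pred I) (f_ : I -> K) (a_ : I -> L) :
  (forall i, P i -> x (f_ i) (a_ i)) -> x (\sum_(i <- r | P i) f_ i) (\sum_(i <- r | P i) a_ i).
Proof. by move=> h; apply: (big_rec2 x); [exact: lg0 | move=> *; apply: (lg_add lx); auto]. Qed.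

Lemma lg_neq0 f a : x f a -> a != 0 -> f != 0.
Proof. by move=> h; apply: contraNneq => f0; apply/eqP/(lg_fun lx h); rewrite f0; apply: lg0. Qed.

Lemma lg_ev1 u (a : L) (p : {poly F}) : x u a -> x (ev1 kc u p) (ev1 iota a p).
Proof.
move=> xu; rewrite !ev1E; apply: lg_sum => i _.
by apply: (lg_mul lx); [apply: (lg_const lx) | apply: lg_exp].
Qed.

Lemma lg_ev2 u v (a b : L) (G : {poly {poly F}}) :
  x u a -> x v b -> x (ev2 kc u v G) (ev2 iota a b G).
Proof.
move=> xu xv; rewrite !ev2E; apply: lg_sum => i _.
by apply: (lg_mul lx); [apply: lg_ev1 | apply: lg_exp].
Qed.

Lemma lg_mmap n (s : 'I_n -> K) (Q : 'I_n -> L) (G : {mpoly F[n]}) :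
  (forall i, x (s i) (Q i)) -> x (mmap kc s G) (mmap iota Q G).
Proof.
move=> h; rewrite !mmap_sum; apply: lg_sum => m _; apply: (lg_mul lx); first exact: (lg_const lx).
apply: (big_rec2 x); first exact: lg1.
by move=> *; apply: (lg_mul lx) => //; apply: lg_exp.
Qed.

(** Multiplying all components by f, or all coordinates by a constant, multiplies forms of degree d
    by a d-th power, which cancels in the quotients defining [proj_germ]. *)
Lemma proj_germ_sub n (s : 'I_n -> K) (P Q : 'I_n -> L) f : proportional Q P ->
  (forall i, x (s i * f) (Q i)) -> forall h a, proj_germ iota s P h a -> x h a.
Proof.
move=> [c c0 PE] hQ h a [d [G [H [hG hH H0 -> ->]]]].
have E (W : {mpoly F[n]}) : W \is d.-homog -> mmap iota P W = mmap iota Q W * c ^+ d.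
  by move=> hW; rewrite -(mmap_scale iota _ _ hW); apply: eq_mmap => // i; rewrite PE mulrC.
have EK (W : {mpoly F[n]}) : W \is d.-homog ->
     mmap kc (fun i => s i * f) W = mmap kc s W * f ^+ d.
  by move=> hW; rewrite (mmap_scale kc _ _ hW).
have xG := lg_mmap G hQ; have xH := lg_mmap H hQ.
move: H0; rewrite !E // => H0c; have H0 := neq0_mull H0c; have cd0 := neq0_mulr H0c.
have := lg_neq0 xH H0; rewrite EK // => H0'; have fd0 := neq0_mulr H0'.
have := lg_div xG xH H0; rewrite !EK //.
have -> : mmap kc s G * f ^+ d / (mmap kc s H * f ^+ d) = mmap kc s G / mmap kc s H.
  by rewrite -mulf_div divff // mulr1.
by rewrite -mulf_div divff // mulr1.
Qed.

Lemma proj_germ_den n (s : 'I_n -> K) (P Q : 'I_n -> L) f : proportional Q P ->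
  (forall i, x (s i * f) (Q i)) ->
  forall d (H : {mpoly F[n]}), H \is d.-homog -> mmap iota P H != 0 -> mmap kc s H != 0.
Proof.
move=> [c c0 PE] hQ d H hH.
have -> : mmap iota P H = mmap iota Q H * c ^+ d.
  by rewrite -(mmap_scale iota _ _ hH); apply: eq_mmap => // i; rewrite PE mulrC.
move=> /neq0_mull H0.
have := lg_neq0 (lg_mmap H hQ) H0; rewrite (mmap_scale kc _ _ hH).
exact: neq0_mull.
Qed.

End LocalGermTheory.

Lemma proj_germ_local n (s : 'I_n -> K) (P : 'I_n -> L) :
  (forall d (H : {mpoly F[n]}), H \is d.-homog -> mmap iota P H != 0 -> mmap kc s H != 0) ->
  (forall d (H : {mpoly F[n]}), H \is d.-homog -> mmap kc s H = 0 -> mmap iota P H = 0) ->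
  local_germ (proj_germ iota s P).
Proof.
move=> nz fn; split.
- move=> f a b [d [G [H [hG hH H0 -> ->]]]] [d' [G' [H' [hG' hH' H'0 e ->]]]].
  have k0 := nz _ _ hH H0; have k'0 := nz _ _ hH' H'0.
  have := fn (d + d')%N (G * H' - H * G').
  rewrite !rmorphB !rmorphM => h.
  apply: (proj2 (cross_mul _ _ H0 H'0)); apply: h.
    by apply: rpredB; apply: dhomogM.
  exact: (proj1 (cross_mul _ _ k0 k'0)).
- move=> c; exists 0%N, c%:MP, 1; rewrite (rmorph1 (mmap kc s)) (rmorph1 (mmap iota P)) !mmapC !divr1.
  by rewrite oner_neq0 dhomog1 -[c%:MP]mulr1 mul_mpolyC dhomogZ ?dhomog1.
- move=> f g a b [d [G [H [hG hH H0 -> ->]]]] [d' [G' [H' [hG' hH' H'0 -> ->]]]].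
  have k0 := nz _ _ hH H0; have k'0 := nz _ _ hH' H'0.
  exists (d + d')%N, (G * H' + H * G'), (H * H'); rewrite !rmorphD !rmorphM; split.
  - by apply: rpredD; apply: dhomogM.
  - exact: dhomogM.
  - exact: (mulf_neq0 H0 H'0).
  - by rewrite (add_fracs _ _ k0 k'0).
  - by rewrite (add_fracs _ _ H0 H'0).
- move=> f g a b [d [G [H [hG hH H0 -> ->]]]] [d' [G' [H' [hG' hH' H'0 -> ->]]]].
  exists (d + d')%N, (G * G'), (H * H'); rewrite !rmorphM; split.
  - exact: dhomogM.
  - exact: dhomogM.
  - exact: (mulf_neq0 H0 H'0).
  - by rewrite mulf_div.
  - by rewrite mulf_div.
- move=> f a [d [G [H [hG hH H0 -> ->]]]] G0; exists d, H, G; rewrite !invf_div.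
  by split; first [exact: (neq0_mull G0) | exact: erefl | assumption].
Qed.

Lemma proj_germ_linear n (s : 'I_n -> K) (P : 'I_n -> L) (c e : 'I_n -> F) :
  \sum_i iota (e i) * P i != 0 ->
  proj_germ iota s P ((\sum_i kc (c i) * s i) / (\sum_i kc (e i) * s i))
                     ((\sum_i iota (c i) * P i) / (\sum_i iota (e i) * P i)).
Proof.
move=> e0; pose lin (c : 'I_n -> F) : {mpoly F[n]} := \sum_i c i *: 'X_i.
have hlin c' : lin c' \is 1.-homog.
  by apply: rpred_sum => i _; apply: dhomogZ; rewrite dhomogX /= mdeg1.
have E (S : comNzRingType) (phi : {rmorphism F -> S}) c' (h : 'I_n -> S) :
    mmap phi h (lin c') = \sum_i phi (c' i) * h i.
  rewrite /lin raddf_sum; apply: eq_bigr => i _.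
  by rewrite /= mmapZ mmapX mmap1U.
exists 1%N, (lin c), (lin e); rewrite !(E L iota) !(E _ kc).
by split; first [exact: hlin | exact: e0 | reflexivity].
Qed.

Lemma local_germ_ext x y : (forall f a, x f a <-> y f a) -> x = y.
Proof.
move=> h; apply: functional_extensionality => f; apply: functional_extensionality => a.
exact: propositional_extensionality.
Qed.

Section Affine.
Variables u v : K.

Definition aff_germ (al be : L) : germ F L := fun f a => exists G H : {poly {poly F}},
  [/\ ev2 iota al be H != 0, f = ev2 kc u v G / ev2 kc u v H
    & a = ev2 iota al be G / ev2 iota al be H].

Definition alg_indep := forall G, ev2 kc u v G = 0 -> G = 0.

Lemma aff_germ_sub x al be : local_germ x -> x u al -> x v be ->
  forall f a, aff_germ al be f a -> x f a.
Proof.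
move=> lx xu xv f a [G [H [H0 -> ->]]].
by apply: lg_div => //; apply: lg_ev2.
Qed.

Hypothesis uv_indep : alg_indep.

Lemma aff_germ_local al be : local_germ (aff_germ al be).
Proof.
have nz H : ev2 iota al be H != 0 -> ev2 kc u v H != 0.
  by apply: contraNneq => /uv_indep->; rewrite rmorph0.
split.
- move=> f a b [G [H [H0 -> ->]]] [G' [H' [H'0 e ->]]].
  have k0 := nz _ H0; have k'0 := nz _ H'0.
  apply: (proj2 (cross_mul _ _ H0 H'0)); rewrite -!rmorphM -rmorphB.
  rewrite (uv_indep (G := G * H' - H * G')) ?rmorph0 //.
  by rewrite rmorphB !rmorphM; apply: (proj1 (cross_mul _ _ k0 k'0)).
- move=> c; exists (c%:P)%:P, 1; rewrite (rmorph1 (ev2 iota al be)) (rmorph1 (ev2 kc u v)) !divr1 !ev2C !ev1C.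
  by split; rewrite ?oner_neq0.
- move=> f g a b [G [H [H0 -> ->]]] [G' [H' [H'0 -> ->]]].
  have k0 := nz _ H0; have k'0 := nz _ H'0.
  exists (G * H' + H * G'), (H * H'); rewrite !rmorphD !rmorphM; split.
  - exact: (mulf_neq0 H0 H'0).
  - by rewrite (add_fracs _ _ k0 k'0).
  - by rewrite (add_fracs _ _ H0 H'0).
- move=> f g a b [G [H [H0 -> ->]]] [G' [H' [H'0 -> ->]]].
  exists (G * G'), (H * H'); rewrite !rmorphM; split.
  - exact: (mulf_neq0 H0 H'0).
  - by rewrite mulf_div.
  - by rewrite mulf_div.
- move=> f a [G [H [H0 -> ->]]] G0; exists H, G; rewrite !invf_div.
  by split; first [exact: (neq0_mull G0) | exact: erefl].
Qed.

Lemma aff_germ_ev2 al be G : aff_germ al be (ev2 kc u v G) (ev2 iota al be G).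
Proof. by exists G, 1; rewrite !rmorph1 !divr1 oner_neq0. Qed.

Lemma aff_germ_u al be : aff_germ al be u al.
Proof. by have := aff_germ_ev2 al be 'X%:P; rewrite !ev2C !ev1X. Qed.

Lemma aff_germ_v al be : aff_germ al be v be.
Proof. by have := aff_germ_ev2 al be 'X; rewrite !ev2X. Qed.

Hypothesis L_alg : forall a : L, algebraicOver iota a.
Hypothesis uv_gen : forall f, exists G H, ev2 kc u v H != 0 /\ f = ev2 kc u v G / ev2 kc u v H.

Lemma lowest_terms_ratfun f : exists A B : {poly {poly F}},
  [/\ B != 0, f = ev2 kc u v A / ev2 kc u v B &
   forall G H, H != 0 -> f = ev2 kc u v G / ev2 kc u v H ->
     exists2 E, H = B * E & G = A * E].
Proof.
have [A0 [B0 [B00 ->]]] := uv_gen f.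
have nz : B0 != 0 by apply: contraNneq B00 => ->; rewrite rmorph0.
have nz' G : G != 0 -> ev2 kc u v G != 0 by apply: contraNneq => /uv_indep->.
have [A [B [B_neq0 AB h]]] := lowest_terms L_alg A0 nz.
have e : ev2 kc u v A0 / ev2 kc u v B0 = ev2 kc u v A / ev2 kc u v B.
  apply: (proj2 (cross_mul _ _ B00 (nz' _ B_neq0))).
  by rewrite -!rmorphM -rmorphB AB [A * _]mulrC subrr rmorph0.
exists A, B; split=> // G H H0; rewrite e => /(proj1 (cross_mul _ _ (nz' _ B_neq0) (nz' _ H0))).
rewrite -!rmorphM -rmorphB => /uv_indep/eqP.
by rewrite subr_eq0 => /eqP AH; apply: h.
Qed.

(** One fraction serves all points at once: a denominator that is nonzero at a point is a multiple
    of the reduced denominator [B]. *)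
Lemma lowest_terms_regular f : exists A B : {poly {poly F}},
  [/\ B != 0, f = ev2 kc u v A / ev2 kc u v B &
   forall al be, regular (aff_germ al be) f -> ev2 iota al be B != 0].
Proof.
have [A [B [B0 fE h]]] := lowest_terms_ratfun f; exists A, B; split=> // al be.
case=> a [G [H [H0 fE' _]]]; have [|E HE _] := h G H _ fE'.
  by apply: contraNneq H0 => ->; rewrite rmorph0.
by move: H0; rewrite HE rmorphM => /neq0_mull.
Qed.

(** A rational function regular outside finitely many points, all on v = 0, is a polynomial. If its
    reduced denominator involved the second variable, it would vanish at some point whose first
    coordinate avoids [s]. If it were a nonconstant polynomial in the first variable alone, it would
    vanish at some point with second coordinate 1. *)
Lemma poly_of_regular (s : seq L) f :
  (forall al be, ~~ ((al \in s) && (be == 0)) -> regular (aff_germ al be) f) ->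
  exists A, f = ev2 kc u v A.
Proof.
move=> freg; have [A [B [B0 fE h]]] := lowest_terms_regular f.
have {}h al be : ~~ ((al \in s) && (be == 0)) -> ev2 iota al be B != 0.
  by move/freg/h.
have sB : (size B <= 1)%N.
  rewrite leqNgt; apply/negP => sB.
  have lB0 : lead_coef B != 0 by rewrite lead_coef_eq0.
  have : map_poly iota (lead_coef B) * \prod_(t <- s) ('X - t%:P) != 0.
    rewrite mulf_neq0 ?map_poly_eq0 // prodf_seq_neq0.
    by apply/allP => t _; rewrite polyXsubC_eq0.
  case/closed_nonrootP=> al; rewrite rootM negb_or root_prod_XsubC => /andP[lal als].
  have : size (map_poly (ev1 iota al) B) != 1.
    by rewrite size_map_poly_id0 ?gtn_eqF.
  case/closed_rootP=> be; rewrite /root => /eqP hbe.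
  by have := h al be; rewrite (negPf als) => /(_ isT); rewrite ev2_horner hbe eqxx.
have BE := size1_polyC sB; set b := B`_0 in BE.
have b0 : b != 0 by move: B0; rewrite BE polyC_eq0.
have sb : (size b <= 1)%N.
  rewrite leqNgt; apply/negP => sb.
  have /closed_rootP[al] : size (map_poly iota b) != 1 by rewrite size_map_poly gtn_eqF.
  rewrite /root => /eqP hal.
  by have := h al 1; rewrite oner_eq0 andbF => /(_ isT); rewrite BE ev2C ev1_horner hal eqxx.
have bE := size1_polyC sb; set k := b`_0 in bE.
exists (A * k^-1%:P%:P); rewrite rmorphM fE BE bE /= !ev2C !ev1C.
by rewrite (fmorphV kc).
Qed.

End Affine.

(** A relation would vanish at every pair (al, be) with r(al) != 0, which forces all its
    coefficients to be zero. The exceptional set [r] is needed for the coordinates T and w, where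
    the roots of [N] must be avoided. *)
Lemma alg_indep_of_points u v (r : {poly L}) : r != 0 ->
  (forall al be, r.[al] != 0 -> exists2 x, local_germ x & x u al /\ x v be) ->
  alg_indep u v.
Proof.
move=> r0 pts G G0.
have h al : r.[al] != 0 -> map_poly (ev1 iota al) G = 0.
  move=> ral; apply: (@poly_all_roots _ _ 1) => [|be _]; first exact: oner_neq0.
  have [x lx [xu xv]] := pts al be ral.
  have := lg_ev2 lx G xu xv; rewrite G0 => xG.
  exact: (lg_fun lx xG (lg0 lx)).
apply/polyP => m; rewrite coef0; apply: (map_poly_inj iota); rewrite rmorph0.
apply: (poly_all_roots r0) => al /h/polyP/(_ m).
by rewrite coef_map coef0.
Qed.

Lemma mmap_plane_eq0 d (D : {mpoly F[3]}) (P : 'I_3 -> L) : D \is d.-homog ->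
  mmap kc (@plane_generic F) D = 0 -> mmap iota P D = 0.
Proof.
move=> hD D0.
pose gm (i : 'I_3) : {mpoly F[2]} := nth 0 [:: 'X_ord0; 'X_ord_max; 1] i.
have e0 : mmap (@mpolyC 2 F) gm D = 0.
  apply/eqP; rewrite -tofrac_eq0 rmorph_mmap -D0; apply/eqP/eq_mmap => // i.
  by rewrite /plane_generic /gm /=; case: i => [[|[|[|?]]] ?] //=; rewrite tofrac1.
have e1 (al be : L) : mmap iota (fun i : 'I_3 => nth 0 [:: al; be; 1] i) D = 0.
  have := congr1 (mmap iota (fun i : 'I_2 => nth 0 [:: al; be] i)) e0.
  rewrite rmorph0 rmorph_mmap => <-; apply: eq_mmap => i /=; first by rewrite mmapC.
  case: i => [[|[|[|?]]] ?] //=; rewrite /gm /= ?rmorph1 //.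
    by rewrite mmapX mmap1U.
  by rewrite mmapX mmap1U.
have e2 (Q : 'I_3 -> L) : Q ord_max != 0 -> mmap iota Q D = 0.
  move=> Q0; have := mmap_scale iota (fun i : 'I_3 => nth 0 [:: Q ord0 / Q ord_max; Q (inord 1) / Q ord_max; 1] i) (Q ord_max) hD.
  rewrite e1 mul0r => <-; apply: eq_mmap => // i.
  case: i => [[|[|[|?]]] lti] //=; rewrite ?mul1r ?divfK //; congr Q; apply: val_inj => //=.
  by rewrite inordK.
(* Points with last coordinate 0 are reached by making that coordinate a variable: the resulting
   polynomial vanishes at every a != 0, hence identically. *)
have e3 : mmap (@polyC L \o iota) (fun i : 'I_3 => nth 0 [:: (P ord0)%:P; (P (inord 1))%:P; 'X] i) D = 0.
  apply: (@poly_all_roots _ _ 'X) => [|a]; first by rewrite polyX_eq0.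
  rewrite hornerX => a0.
  rewrite -/(horner_eval a _) rmorph_mmap.
  rewrite -(e2 (fun i : 'I_3 => nth 0 [:: P ord0; P (inord 1); a] i)) //.
  apply: eq_mmap => i /=; first by rewrite /horner_eval hornerC.
  by case: i => [[|[|[|?]]] lti] //=; rewrite /horner_eval ?hornerC ?hornerX.
have := congr1 (horner_eval (P ord_max)) e3; rewrite rmorph0 => <-.
rewrite rmorph_mmap; apply: eq_mmap => i /=; first by rewrite /horner_eval hornerC.
case: i => [[|[|[|?]]] lti] //=; rewrite /horner_eval ?hornerC ?hornerX //; congr P; apply: val_inj => //=.
by rewrite inordK.
Qed.

Lemma plane_germ_local (P : 'I_3 -> L) : local_germ (plane_germ iota P).
Proof.
apply: proj_germ_local => d H hH; last exact: (mmap_plane_eq0 P hH).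
by apply: contraNneq => /(mmap_plane_eq0 P hH) ->.
Qed.

End Germs.

Lemma frac_der_id (R : fieldType) (g h a a' b b' x y : R) : h != 0 ->
  (a * x + b * y - g / h * (a' * x + b' * y)) / h
  = (a * h - g * a') / (h * h) * x + (b * h - g * b') / (h * h) * y.
Proof. by move=> h0; field. Qed.

Lemma frac_jac_id (R : fieldType) (h h' a a' b b' x : R) : h != 0 -> h' != 0 ->
  a / (h * h) * (a' / (h' * h') * 0 + b' / (h' * h') * x)
  + b / (h * h) * (a' / (h' * h') * - x + b' / (h' * h') * 0)
  = (a * b' - b * a') / (h * h * (h' * h')) * x.
Proof. by move=> h0 h'0; field; rewrite h0 h'0. Qed.

(** * The Jacobian as a biderivation *)

Section Jacobian.
Variable F : finFieldType.
Local Notation K := (ratfun F).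
Local Notation kc := (@ratfun_const F).
Implicit Types (f g h u v : K).

Lemma jacobian_derl v : derivation (fun u => jacobian u v).
Proof.
have [a0 m0 c0] := @ratfun_deriv_derivation F ord0.
have [a1 m1 c1] := @ratfun_deriv_derivation F ord_max.
split=> [f g|f g|c]; rewrite /jacobian ?a0 ?a1 ?m0 ?m1 ?c0 ?c1; ring.
Qed.

Lemma jacobian_anti u v : jacobian v u = - jacobian u v.
Proof. by rewrite /jacobian; ring. Qed.

Lemma jacobian_derr u : derivation (jacobian u).
Proof.
have [a0 m0 c0] := @ratfun_deriv_derivation F ord0.
have [a1 m1 c1] := @ratfun_deriv_derivation F ord_max.
split=> [f g|f g|c]; rewrite /jacobian ?a0 ?a1 ?m0 ?m1 ?c0 ?c1; ring.
Qed.

Lemma jacobianxx u : jacobian u u = 0.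
Proof. by rewrite /jacobian mulrC subrr. Qed.

Lemma jacobian_var : jacobian (ratfun_var F ord0) (ratfun_var F ord_max) = 1.
Proof. by rewrite /jacobian !ratfun_deriv_var /= mul0r subr0 mulr1. Qed.

Lemma der0 (D : K -> K) : derivation D -> D 0 = 0.
Proof. by case=> _ _ c; have := c 0; rewrite (rmorph0 kc). Qed.

Lemma der_div (D : K -> K) f g : derivation D -> g != 0 ->
  D (f / g) = (D f - f / g * D g) / g.
Proof.
move=> dD g0; have := der_mul dD (f / g) g; rewrite mulfVK // => ->.
by rewrite addrK mulfK.
Qed.

Lemma der_ev1 (p : {poly F}) : exists q : {poly F}, forall u (D : K -> K), derivation D ->
  D (ev1 kc u p) = ev1 kc u q * D u.
Proof.
exists p^`() => u D dD; elim/poly_ind: p => [|p c IH].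
  by rewrite deriv0 !ev1_zero mul0r der0.
rewrite derivD derivM derivX derivC addr0 mulr1 !ev1D !ev1M ev1X ev1C.
by rewrite (der_add dD) (der_mul dD) IH (der_const dD) addr0; ring.
Qed.

Lemma der_ev2 (G : {poly {poly F}}) : exists A B : {poly {poly F}},
  forall u v (D : K -> K), derivation D ->
  D (ev2 kc u v G) = ev2 kc u v A * D u + ev2 kc u v B * D v.
Proof.
elim/poly_ind: G => [|G c [A [B IH]]].
  by exists 0, 0 => u v D dD; rewrite !ev2_zero !mul0r addr0 der0.
have [q qE] := der_ev1 c.
exists (A * 'X + q%:P), (B * 'X + G) => u v D dD; rewrite !ev2D !ev2M ev2X !ev2C.
by rewrite (der_add dD) (der_mul dD) IH // qE //; ring.
Qed.

Lemma der_frac (u v : K) (G H : {poly {poly F}}) : ev2 kc u v H != 0 ->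
  exists A B : {poly {poly F}}, forall D : K -> K, derivation D ->
  D (ev2 kc u v G / ev2 kc u v H)
  = ev2 kc u v A / ev2 kc u v (H * H) * D u + ev2 kc u v B / ev2 kc u v (H * H) * D v.
Proof.
move=> H0; have [A [B hG]] := der_ev2 G; have [A' [B' hH]] := der_ev2 H.
exists (A * H - G * A'), (B * H - G * B') => D dD.
rewrite (der_div _ dD H0).
rewrite (hG _ _ _ dD).
rewrite (hH _ _ _ dD).
rewrite !ev2B !ev2M.
exact: (frac_der_id _ _ _ _ _ _ _ H0).
Qed.

(** Change of variables for 2-forms. Only powers of the two given denominators are introduced, so
    the coefficient stays regular wherever they do not vanish. *)
Lemma jacobian_frac (u v : K) (G H G' H' : {poly {poly F}}) :
  ev2 kc u v H != 0 -> ev2 kc u v H' != 0 ->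
  exists A : {poly {poly F}},
  jacobian (ev2 kc u v G / ev2 kc u v H) (ev2 kc u v G' / ev2 kc u v H')
  = ev2 kc u v A / ev2 kc u v (H * H * (H' * H')) * jacobian u v.
Proof.
move=> H0 H'0; have [A [B hD]] := der_frac G H0; have [A' [B' hD']] := der_frac G' H'0.
set f' := _ / ev2 kc u v H'.
exists (A * B' - B * A'); rewrite (hD (fun f => jacobian f f') (jacobian_derl f')).
rewrite /f' !(hD' _ (jacobian_derr _)) !jacobianxx [jacobian v u]jacobian_anti.
rewrite ev2B !ev2M.
exact: (frac_jac_id _ _ _ _ _ H0 H'0).
Qed.

End Jacobian.

(** * Affine charts *)

Definition o1 : 'I_3 := @Ordinal 3 1 isT.

Lemma ord3P (Q : 'I_3 -> Prop) : Q ord0 -> Q o1 -> Q ord_max -> forall i, Q i.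
Proof.
move=> q0 q1 q2 [[|[|[|//]]] lti].
- by have -> : Ordinal lti = ord0 by apply: val_inj.
- by have -> : Ordinal lti = o1 by apply: val_inj.
- by have -> : Ordinal lti = ord_max by apply: val_inj.
Qed.

Lemma big_ord3 (V : nmodType) (f : 'I_3 -> V) : \sum_i f i = f ord0 + f o1 + f ord_max.
Proof.
rewrite !big_ord_recl big_ord0 addr0 addrA.
by congr (_ + f _ + f _); apply: val_inj.
Qed.

Lemma field_div_div (R : fieldType) (a b c : R) : c != 0 -> (a / c) / (b / c) = a / b.
Proof. by move=> c0; rewrite invf_div mulrA divfK. Qed.

Section Linear.
Variables (F : fieldType) (S : comNzRingType) (phi : {rmorphism F -> S}).

Definition lin n (A : 'M[F]_n) (s : 'I_n -> S) (i : 'I_n) : S := \sum_j phi (A i j) * s j.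

Lemma lin_mul n (A B : 'M[F]_n) s i : lin A (lin B s) i = lin (A *m B) s i.
Proof.
rewrite /lin; under eq_bigr => j _ do rewrite mulr_sumr.
rewrite exchange_big /=; apply: eq_bigr => j _.
rewrite mxE rmorph_sum mulr_suml; apply: eq_bigr => k _.
by rewrite rmorphM mulrA.
Qed.

Lemma lin_1 n s (i : 'I_n) : lin 1%:M s i = s i.
Proof.
rewrite /lin (bigD1 i) //= mxE eqxx rmorph1 mul1r big1 ?addr0 // => j ne.
by rewrite mxE eq_sym (negPf ne) rmorph0 mul0r.
Qed.

End Linear.

Lemma jac_quot_id (R : fieldType) (a b c Jab Jcb Jac : R) : c != 0 ->
  ((Jab - b / c * Jac) / c - a / c * ((Jcb - b / c * 0) / c)) / c
  = (c * Jab - a * Jcb - b * Jac) / c ^+ 3.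
Proof. by move=> c0; field. Qed.

Lemma jac_det_id (R : comNzRingType) (x y i0 i1 i2 j0 j1 j2 k0 k1 k2 : R) :
  (k0 * x + k1 * y + k2) * (i0 * j1 - i1 * j0) - (i0 * x + i1 * y + i2) * (k0 * j1 - k1 * j0)
  - (j0 * x + j1 * y + j2) * (i0 * k1 - i1 * k0)
  = k2 * (i0 * j1 - i1 * j0) - i2 * (k0 * j1 - k1 * j0) - j2 * (i0 * k1 - i1 * k0).
Proof. ring. Qed.

Section Charts.
Variables (F : finFieldType) (L : closedFieldType) (iota : {rmorphism F -> L}).
Local Notation K := (ratfun F).
Local Notation kc := (@ratfun_const F).
Implicit Types (f g h u v : K) (x y : germ F L).

(** Two generators of the same stalk divide each other, so the quotient has a nonzero value. This
    makes the choice of a local equation harmless. *)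
Lemma anticanonical_unit x f f' : local_germ iota x -> anticanonical_eq x f ->
  anticanonical_eq x f' -> f != 0 -> exists a a0, [/\ x a a0, a0 != 0 & f' = a * f].
Proof.
move=> lx [cf hf] [cf' hf'] f0.
have [a [a0 xa] f'E] := hf _ cf'; have [b [b0 xb] fE] := hf' _ cf.
exists a, a0; split=> //.
have e : b * a = 1 by apply: (mulIf f0); rewrite mul1r -mulrA -f'E -fE.
have := lg_fun lx (lg_mul lx xb xa); rewrite e => /(_ 1 (lg1 lx)).
by move=> h; apply: contraTneq (oner_neq0 L) => a00; rewrite -h a00 mulr0 eqxx.
Qed.

Section AffineCanonical.
Variables (u v : K) (al be : L).
Hypothesis uv_indep : alg_indep u v.
Local Notation x := (aff_germ iota u v al be).

Lemma aff_den_neq0 H : ev2 iota al be H != 0 -> ev2 kc u v H != 0.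
Proof. by apply: contraNneq => /uv_indep->; rewrite ev2_zero. Qed.

Lemma aff_regular_frac (G H : {poly {poly F}}) : ev2 iota al be H != 0 ->
  regular x (ev2 kc u v G / ev2 kc u v H).
Proof. by move=> H0; exists (ev2 iota al be G / ev2 iota al be H), G, H. Qed.

Lemma jacobian_regular f g : regular x f -> regular x g ->
  exists2 c, regular x c & jacobian f g = c * jacobian u v.
Proof.
move=> [_ [G [H [H0 -> _]]]] [_ [G' [H' [H'0 -> _]]]].
have [A ->] := jacobian_frac G G' (aff_den_neq0 H0) (aff_den_neq0 H'0).
exists (ev2 kc u v A / ev2 kc u v (H * H * (H' * H'))) => //.
by apply: aff_regular_frac; rewrite !ev2M !mulf_neq0.
Qed.

Lemma anticanonical_aff : anticanonical_eq x (jacobian u v).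
Proof.
have lx := aff_germ_local iota uv_indep al be.
split.
  rewrite -[jacobian u v]mul1r -[1 * _]addr0; apply: CanonicalD; last exact: Canonical0.
  - by exists 1; apply: lg1 lx.
  - by exists al; apply: aff_germ_u.
  - by exists be; apply: aff_germ_v.
move=> w; elim=> [|a f g {}w [a0 xa] xf xg _ [b [b0 xb] ->]].
  by exists 0; [exists 0; apply: lg0 lx | rewrite mul0r].
have [c [c0 xc] ->] := jacobian_regular xf xg.
exists (a * c + b); last by rewrite mulrDl mulrA.
by exists (a0 * c0 + b0); apply: (lg_add lx) => //; apply: (lg_mul lx).
Qed.

End AffineCanonical.

Variables (M Mi : 'M[F]_3).
Hypotheses (MiM : Mi *m M = 1%:M) (MMi : M *m Mi = 1%:M).
(** Linear coordinates adapted to the three points: [gp] is the generic point and [tr P] the point P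
    in these coordinates. The last one will cut out the line through the points. *)
Definition gp : 'I_3 -> K := lin kc M (@plane_generic F).
Definition tr (P : 'I_3 -> L) : 'I_3 -> L := lin iota M P.

Lemma gpE i : gp i = kc (M i ord0) * ratfun_var F ord0 + kc (M i o1) * ratfun_var F ord_max
   + kc (M i ord_max).
Proof. by rewrite /gp /lin big_ord3 /plane_generic /= mulr1. Qed.

Lemma generic_gp j : plane_generic F j = \sum_i kc (Mi j i) * gp i.
Proof. by rewrite -[LHS](lin_1 kc) -MiM -lin_mul. Qed.

Lemma tr_inv P j : P j = \sum_i iota (Mi j i) * tr P i.
Proof. by rewrite -[LHS](lin_1 iota) -MiM -lin_mul. Qed.

Lemma tr_surj Q : exists P, forall i, tr P i = Q i.
Proof. by exists (lin iota Mi Q) => i; rewrite /tr lin_mul MMi lin_1. Qed.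

Lemma tr_scale c P Q : (forall i, Q i = c * P i) -> forall i, tr Q i = c * tr P i.
Proof.
move=> h i; rewrite /tr /lin mulr_sumr; apply: eq_bigr => j _.
by rewrite h mulrCA.
Qed.

Lemma tr_nonzero P : nonzero P <-> nonzero (tr P).
Proof.
split=> -[i Pi].
  case: (boolP [exists k, tr P k != 0]) => [/existsP[k]|]; first by exists k.
  rewrite negb_exists => /forallP h; case/eqP: Pi.
  by rewrite tr_inv big1 // => k _; move: (h k); rewrite negbK => /eqP->; rewrite mulr0.
case: (boolP [exists k, P k != 0]) => [/existsP[k]|]; first by exists k.
rewrite negb_exists => /forallP h; case/eqP: Pi.
by rewrite /tr /lin big1 // => k _; move: (h k); rewrite negbK => /eqP->; rewrite mulr0.
Qed.

Lemma proportional_tr P Q : proportional P Q <-> proportional (tr P) (tr Q).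
Proof.
split=> -[c c0 h]; exists c => //; first exact: tr_scale.
by move=> i; rewrite !tr_inv mulr_sumr; apply: eq_bigr => j _; rewrite h mulrCA.
Qed.

Lemma gp_ratio P i k : tr P k != 0 -> plane_germ iota P (gp i / gp k) (tr P i / tr P k).
Proof. exact: proj_germ_linear. Qed.

Lemma gp_neq0 k : gp k != 0.
Proof.
have [P hP] := tr_surj (fun=> 1).
have := gp_ratio k (P := P) (k := k); rewrite hP oner_neq0 divr1 => /(_ isT) h.
have := lg_neq0 (plane_germ_local iota P) h; rewrite oner_neq0 => /(_ isT).
exact: neq0_mull.
Qed.

Lemma plane_sub_chart x P k : local_germ iota x -> tr P k != 0 ->
  (forall i, x (gp i / gp k) (tr P i / tr P k)) -> forall f a, plane_germ iota P f a -> x f a.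
Proof.
move=> lx Pk h; apply: (proj_germ_sub lx (Q := fun j => P j / tr P k) (f := (gp k)^-1)).
  by exists (tr P k) => // i; rewrite mulrC divfK.
move=> j; rewrite generic_gp [P j]tr_inv !mulr_suml; apply: (lg_sum lx) => i _.
by rewrite -!mulrA; apply: (lg_mul lx); [apply: (lg_const lx) | apply: h].
Qed.

Section Chart.
Variables i j k : 'I_3.
Hypothesis ijk : [/\ i != j, i != k & j != k].
Let u := gp i / gp k.
Let v := gp j / gp k.

Lemma ord3_cases l : [\/ l = i, l = j | l = k].
Proof.
case: ijk => ij ik jk.
case: (eqVneq l i) => [|li]; first by constructor.
case: (eqVneq l j) => [|lj]; first by constructor.
case: (eqVneq l k) => [|lk]; first by constructor.
have : (#|[set i; j; k; l]| <= #|'I_3|)%N by apply: max_card.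
have e : [set i; j; k; l] = l |: (k |: (j |: [set i])).
  by apply/setP => z; rewrite !inE; case: (z == i); case: (z == j); case: (z == k); rewrite ?orbT ?orbF.
by rewrite card_ord e !cardsU1 cards1 !inE (negPf li) (negPf lj) (negPf lk) ![k == _]eq_sym
  (negPf ik) (negPf jk) [j == i]eq_sym (negPf ij).
Qed.

Lemma chart_point_exists al be : exists2 P, tr P k = 1 & tr P i = al /\ tr P j = be.
Proof.
case: ijk => ij ik jk.
have [P hP] := tr_surj (fun l => if l == i then al else if l == j then be else 1).
by exists P; rewrite !hP ?eqxx 1?[k == _]eq_sym ?(negPf ik) ?[k == j]eq_sym ?(negPf jk) // [j == i]eq_sym (negPf ij).
Qed.

Lemma chart_indep : alg_indep u v.
Proof.
apply: (@alg_indep_of_points F L iota u v 1 (oner_neq0 _)) => al be _.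
have [P Pk [Pi Pj]] := chart_point_exists al be.
exists (plane_germ iota P); first exact: plane_germ_local.
have k0 : tr P k != 0 by rewrite Pk oner_neq0.
have := gp_ratio i k0; have := gp_ratio j k0.
by rewrite Pk Pi Pj !divr1.
Qed.

Lemma chart_germ_eq P : tr P k != 0 ->
  plane_germ iota P = aff_germ iota u v (tr P i / tr P k) (tr P j / tr P k).
Proof.
move=> k0; have lx := aff_germ_local iota chart_indep (tr P i / tr P k) (tr P j / tr P k).
apply: local_germ_ext => f a; split; last first.
  by apply: (aff_germ_sub (plane_germ_local iota P)); apply: gp_ratio.
apply: (plane_sub_chart lx k0) => l; case: (ord3_cases l) => ->.
- exact: aff_germ_u.
- exact: aff_germ_v.
- by rewrite !divff ?gp_neq0 //; apply: lg1 lx.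
Qed.

Lemma chart_lin (r : 'I_3 -> F) : exists G, ev2 kc u v G = (\sum_l kc (r l) * gp l) / gp k.
Proof.
have hl l : exists G, ev2 kc u v G = gp l / gp k.
  case: (ord3_cases l) => ->.
  - by exists 'X%:P; rewrite ev2C ev1X.
  - by exists 'X; rewrite ev2X.
  - by exists 1; rewrite ev2_one divff ?gp_neq0.
have [G0 E0] := hl ord0; have [G1 E1] := hl o1; have [G2 E2] := hl ord_max.
exists ((r ord0)%:P%:P * G0 + (r o1)%:P%:P * G1 + (r ord_max)%:P%:P * G2).
by rewrite !ev2D !ev2M !ev2C !ev1C E0 E1 E2 big_ord3 !mulrDl !mulrA.
Qed.

Definition is_frac (a b : K) f := exists G H, ev2 kc a b H != 0 /\ f = ev2 kc a b G / ev2 kc a b H.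

Lemma is_frac_all (a b : K) : (forall l, is_frac a b (ratfun_var F l)) -> forall f, is_frac a b f.
Proof.
move=> hv; apply: ratfun_ind => //.
- move=> c; exists c%:P%:P, 1; rewrite ev2_one oner_neq0 divr1 ev2C ev1C.
  by split.
- move=> f g [G [H [H0 ->]]] [G' [H' [H'0 ->]]]; exists (G * H' + H * G'), (H * H').
  rewrite ev2D !ev2M; split; first exact: (mulf_neq0 H0 H'0).
  by rewrite (add_fracs _ _ H0 H'0).
- move=> f g [G [H [H0 ->]]] [G' [H' [H'0 ->]]]; exists (G * G'), (H * H').
  rewrite ev2M ev2M; split; first exact: (mulf_neq0 H0 H'0).
  exact: mulf_div.
- move=> f f0 [G [H [H0 fE]]]; exists H, G; rewrite fE invf_div; split; last reflexivity.
  by apply: contraNneq f0 => G0; rewrite fE G0 mul0r.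
Qed.

Lemma chart_gen f : is_frac u v f.
Proof.
have [G2 E2] := chart_lin (Mi ord_max).
have g2 : (\sum_l kc (Mi ord_max l) * gp l) = 1 by rewrite -generic_gp.
apply: is_frac_all => l.
have [l' hl] : exists l', ratfun_var F l = plane_generic F l'.
  case: l => [[|[|//]] lti].
    by exists ord0; congr ratfun_var; apply: val_inj.
  by exists o1; congr ratfun_var; apply: val_inj.
have [G E] := chart_lin (Mi l').
exists G, G2; rewrite E E2 g2 -generic_gp field_div_div ?gp_neq0 // divr1 hl.
by rewrite mul1r invr_eq0 gp_neq0.
Qed.

Lemma jacobian_gp a b : jacobian (gp a) (gp b) =
  kc (M a ord0) * kc (M b o1) - kc (M a o1) * kc (M b ord0).
Proof.
have d i' a' : ratfun_deriv i' (gp a') = kc (M a' ord0) * (i' == ord0)%:R + kc (M a' o1) * (i' == ord_max)%:R.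
  have dd := @ratfun_deriv_derivation F i'.
  rewrite gpE !(der_add dd) !(der_mul dd) !(der_const dd) !ratfun_deriv_var.
  by rewrite !mul0r !add0r addr0.
by rewrite /jacobian !d /= !mulr0 !mulr1 !addr0 !add0r.
Qed.

(** The form dx /\ dy has a triple pole along a line at infinity; [dl] is, up to sign, the
    determinant of M. *)
Lemma jacobian_chart : exists2 dl : F, dl != 0 & jacobian u v = kc dl / gp k ^+ 3.
Proof.
pose dl := M k ord_max * (M i ord0 * M j o1 - M i o1 * M j ord0)
  - M i ord_max * (M k ord0 * M j o1 - M k o1 * M j ord0)
  - M j ord_max * (M i ord0 * M k o1 - M i o1 * M k ord0).
have k0 := gp_neq0 k.
have JE : jacobian u v = kc dl / gp k ^+ 3.
  rewrite /u (der_div _ (jacobian_derl v) k0) /v.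
  rewrite (der_div _ (jacobian_derr (gp i)) k0) (der_div _ (jacobian_derr (gp k)) k0).
  rewrite jacobianxx jac_quot_id // !jacobian_gp; congr (_ / _).
  rewrite (gpE i) (gpE j) (gpE k) jac_det_id.
  by rewrite /dl !(rmorphB kc) !(rmorphM kc) !(rmorphB kc) !(rmorphM kc).
(* The variables x and y are fractions in u and v, so their Jacobian, which is 1, is a multiple of
   that of u and v. *)
exists dl => //; apply/eqP => dl0.
have [G [H [H0 xE]]] := chart_gen (ratfun_var F ord0).
have [G' [H' [H'0 yE]]] := chart_gen (ratfun_var F ord_max).
have [A] := jacobian_frac G G' H0 H'0.
rewrite -xE -yE jacobian_var JE dl0 (rmorph0 kc) mul0r mulr0.
by apply/eqP/oner_neq0.
Qed.

End Chart.
End Charts.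

(** * Germs of the blow-up *)

Section BlowupGerms.
Variables (F : finFieldType) (L : closedFieldType) (iota : {rmorphism F -> L}).
Variables (m : nat) (p : 'I_m -> 'I_3 -> L).
Local Notation K := (ratfun F).
Local Notation kc := (@ratfun_const F).
Implicit Types (f g h t : K) (x y v : germ F L).

Section Chart.
Variables (v : germ F L) (lv : local_germ iota v) (I : K -> Prop) (t : K).
Local Notation B := (blowup_chart v I t).

Lemma chart0 : B 0. Proof. by apply: Chart_base; exists 0; apply: lg0 lv. Qed.
Lemma chart1 : B 1. Proof. by apply: Chart_base; exists 1; apply: lg1 lv. Qed.

Lemma chart_add f g : B f -> B g -> B (f + g).
Proof.
move=> hf hg; rewrite -[g]opprK -[- g]sub0r; apply: Chart_sub => //.
by apply: Chart_sub => //; apply: chart0.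
Qed.

Lemma chart_ev2 u w (G : {poly {poly F}}) : B u -> B w -> B (ev2 kc u w G).
Proof.
move=> hu hw; elim/poly_ind: G => [|G c IH]; first by rewrite ev2_zero; apply: chart0.
rewrite ev2D ev2M ev2X ev2C; apply: chart_add; first exact: Chart_mul.
elim/poly_ind: c => [|c d IHc]; first by rewrite ev1_zero; apply: chart0.
rewrite ev1D ev1M ev1X ev1C; apply: chart_add; first exact: Chart_mul.
by apply: Chart_base; exists (iota d); apply: (lg_const lv).
Qed.

Lemma chart_regular y : local_germ iota y -> (forall f a, v f a -> y f a) ->
  (forall a, I a -> regular y (a / t)) -> forall f, B f -> regular y f.
Proof.
move=> ly vy Iy f; elim=> {f}[f [a va]|a|f g _ [a ya] _ [b yb]|f g _ [a ya] _ [b yb]].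
- by exists a; apply: vy.
- exact: Iy.
- by exists (a - b); apply: (lg_sub ly).
- by exists (a * b); apply: (lg_mul ly).
Qed.

Variable e : K -> L.
Hypothesis ev_e : chart_point v B e.

Lemma chart_e_neq0 h : B h -> e h != 0 -> h != 0.
Proof.
case: ev_e => ve _ _ Bh; apply: contraNneq => ->.
by rewrite (ve _ _ (lg0 lv)).
Qed.

Lemma chart_germ_base f : B f -> chart_germ B e f (e f).
Proof.
case: ev_e => ve _ _ Bf; exists f, 1; rewrite (ve _ _ (lg1 lv)) !divr1.
by split; [|exact: chart1|exact: oner_neq0|reflexivity|reflexivity].
Qed.

Lemma chart_germ_local : local_germ iota (chart_germ B e).
Proof.
have [ve eD eM] := ev_e.
have base f a : v f a -> chart_germ B e f a.
  move=> va; rewrite -(ve _ _ va); apply: chart_germ_base.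
  by apply: Chart_base; exists a.
split.
- move=> f a b [g [h [Bg Bh h0 -> ->]]] [g' [h' [Bg' Bh' h'0 E ->]]].
  apply: (proj2 (cross_mul _ _ h0 h'0)).
  have := proj1 (cross_mul _ _ (chart_e_neq0 Bh h0) (chart_e_neq0 Bh' h'0)) E.
  move/eqP; rewrite subr_eq0 => /eqP/(congr1 e); rewrite !eM // => ->.
  by rewrite subrr.
- by move=> c; apply: base; apply: (lg_const lv).
- move=> f f' a b [g [h [Bg Bh h0 -> ->]]] [g' [h' [Bg' Bh' h'0 -> ->]]].
  exists (g * h' + h * g'), (h * h').
  have B1 : B (g * h') by exact: Chart_mul.
  have B2 : B (h * g') by exact: Chart_mul.
  rewrite (eD _ _ B1 B2) !eM //; split.
  + exact: chart_add.
  + exact: Chart_mul.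
  + exact: (mulf_neq0 h0 h'0).
  + exact: (add_fracs _ _ (chart_e_neq0 Bh h0) (chart_e_neq0 Bh' h'0)).
  + exact: (add_fracs _ _ h0 h'0).
- move=> f f' a b [g [h [Bg Bh h0 -> ->]]] [g' [h' [Bg' Bh' h'0 -> ->]]].
  exists (g * g'), (h * h'); rewrite !eM //; split.
  + exact: Chart_mul.
  + exact: Chart_mul.
  + exact: (mulf_neq0 h0 h'0).
  + exact: mulf_div.
  + exact: mulf_div.
- move=> f a [g [h [Bg Bh h0 -> ->]]] g0; exists h, g; rewrite !invf_div.
  by split; first [exact: (neq0_mull g0) | reflexivity | assumption].
Qed.

Lemma chart_germ_base_sub f a : v f a -> chart_germ B e f a.
Proof.
case: ev_e => ve _ _ va; rewrite -(ve _ _ va); apply: chart_germ_base.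
by apply: Chart_base; exists a.
Qed.

End Chart.

(** A recognition criterion: a local ring that contains the ring at P compatibly with values, in
    which the ideal of the centre is generated by t, and whose elements are fractions of elements of
    the chart, is the ring of a point of the blow-up. *)
Lemma blowup_of_germ P t y : nonzero P -> center_ideal iota p P t -> t != 0 ->
  local_germ iota y -> (forall f a, plane_germ iota P f a -> y f a) ->
  (forall a, center_ideal iota p P a -> regular y (a / t)) ->
  (forall f b, y f b -> exists g h c d,
     [/\ blowup_chart (plane_germ iota P) (center_ideal iota p P) t g,
         blowup_chart (plane_germ iota P) (center_ideal iota p P) t h,
         y g c, y h d & d != 0 /\ f = g / h]) ->
  blowup iota p y.
Proof.
move=> P0 It t0 ly vy Iy frac.
set v := plane_germ iota P; set I := center_ideal iota p P.
(* The evaluation must be a total function; it is arbitrary where [y] is not regular, and only its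
   values on the chart are constrained. *)
pose e f := epsilon (inhabits (0 : L)) (fun a => y f a).
have eP f a : y f a -> e f = a.
  move=> ya; apply: (lg_fun ly _ ya).
  by apply: epsilon_spec; exists a.
have reg := chart_regular (I := I) (t := t) ly vy Iy.
have ev_e : chart_point v (blowup_chart v I t) e.
  split=> [f a /vy/eP //|f g /reg[a ya] /reg[b yb]|f g /reg[a ya] /reg[b yb]].
    by rewrite (eP _ _ ya) (eP _ _ yb); apply/eP/(lg_add ly).
  by rewrite (eP _ _ ya) (eP _ _ yb); apply/eP/(lg_mul ly).
suff <- : chart_germ (blowup_chart v I t) e = y by exact: Blowup_point.
apply: local_germ_ext => f a; split=> [[g [h [Bg Bh h0 -> ->]]]|].
  have [b yb] := reg _ Bg; have [c yc] := reg _ Bh.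
  rewrite (eP _ _ yb) (eP _ _ yc); apply: (lg_div ly) => //.
  by rewrite -(eP _ _ yc).
move=> ya; have [g [h [c [d [Bg Bh yg yh [d0 fE]]]]]] := frac f a ya.
exists g, h; rewrite (eP _ _ yg) (eP _ _ yh); split=> //.
by apply: (lg_fun ly ya); rewrite fE; apply: (lg_div ly).
Qed.

Definition center (P : 'I_3 -> L) := exists i, proportional (p i) P.

Lemma blowup_plane P : nonzero P -> ~ center P -> blowup iota p (plane_germ iota P).
Proof.
move=> P0 nc; have lv := plane_germ_local iota P.
have I1 : center_ideal iota p P 1 by exists 1; [exact: lg1 lv | move/nc].
apply: (blowup_of_germ (t := 1) P0 I1 (oner_neq0 _) lv) => // [a [b vb _]|f b vb].
  by exists b; rewrite divr1.
exists f, 1, b, 1; split; first by apply: Chart_base; exists b.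
- by apply: Chart_base; exists 1; apply: lg1 lv.
- exact: vb.
- exact: lg1 lv.
- by rewrite oner_neq0 divr1.
Qed.

(** Off the centre the ideal contains 1, so 1/t belongs to the chart, t is a unit and the local ring
    of the plane is unchanged. Only points over the centre keep a genuine chart. *)
Lemma blowupP x : blowup iota p x -> exists P, [/\ nonzero P, local_germ iota x,
  forall f a, plane_germ iota P f a -> x f a &
  (~ center P /\ x = plane_germ iota P) \/
  exists t e, [/\ center P, center_ideal iota p P t, t != 0,
    chart_point (plane_germ iota P)
      (blowup_chart (plane_germ iota P) (center_ideal iota p P) t) e &
    x = chart_germ (blowup_chart (plane_germ iota P) (center_ideal iota p P) t) e]].
Proof.
case=> P t e B P0 It t0 ev_e; have lv := plane_germ_local iota P.
exists P; split=> //; first exact: chart_germ_local.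
  exact: chart_germ_base_sub.
case: (classic (center P)) => [cP|nc]; first by right; exists t, e.
left; split=> //; have [ve eD eM] := ev_e.
have [t1 vt _] := It.
have I1 : center_ideal iota p P 1 by exists 1; [exact: lg1 lv | move/nc].
have B1t : B (1 / t) by exact: Chart_quot.
have Bt : B t by apply: Chart_base; exists t1.
have t10 : t1 != 0.
  have := eM _ _ Bt B1t; rewrite mul1r mulfV // (ve _ _ (lg1 lv)) (ve _ _ vt).
  by move=> h; apply: contraTneq (oner_neq0 L) => t10; rewrite h t10 mul0r eqxx.
have reg : forall f, B f -> regular (plane_germ iota P) f.
  apply: (chart_regular (t := t) lv) => // a [b vb _].
  by exists (b / t1); apply: (lg_div lv).
apply: local_germ_ext => f a; split; last exact: chart_germ_base_sub.
case=> g [h [/reg[b vb] /reg[c vc] h0 -> ->]].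
rewrite (ve _ _ vb) (ve _ _ vc); apply: (lg_div lv) => //.
by rewrite -(ve _ _ vc).
Qed.

End BlowupGerms.

(** * The chart of the blow-up around the strict transform of the line *)

Section Surface.
Variables (F : finFieldType) (L : closedFieldType) (iota : {rmorphism F -> L}).
Variables (M Mi : 'M[F]_3) (p : 'I_3 -> 'I_3 -> L) (N : {poly F}) (theta : 'I_3 -> L).
Hypotheses (MiM : Mi *m M = 1%:M) (MMi : M *m Mi = 1%:M).
Hypotheses (N_size : size N = 4%N) (N_monic : N`_3 = 1).
Hypothesis N_root : forall t, root (map_poly iota N) t <-> exists i, t = theta i.
Hypothesis N_min : forall (G : {poly F}) i, root (map_poly iota G) (theta i) -> N %| G.
Hypothesis p_tr : forall i, [/\ tr iota M (p i) ord_max = 0, tr iota M (p i) o1 != 0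
  & tr iota M (p i) ord0 = theta i * tr iota M (p i) o1].
Local Notation K := (ratfun F).
Local Notation kc := (@ratfun_const F).
Local Notation gp := (gp M).
Local Notation tr := (tr iota M).
Implicit Types (f g h : K) (x y : germ F L).

(** On the chart gp o1 != 0 the centre is given by Z = N(T) = 0. Its blow-up has a chart with
    coordinates T and w = Z / N(T), on which w = 0 is the strict transform of the line Z = 0. *)
Definition TT : K := gp ord0 / gp o1.
Definition ZZ : K := gp ord_max / gp o1.
Definition NT : K := ev1 kc TT N.
Definition ww : K := ZZ / NT.

Lemma theta_irr i c : theta i != iota c.
Proof.
apply/eqP => e; have /dvdp_leq : N %| 'X - c%:P.
  by apply: (N_min (i := i)); rewrite rmorphB /= map_polyX map_polyC /= root_XsubC e.
by rewrite size_XsubC polyXsubC_eq0 N_size => /(_ isT).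
Qed.

Lemma N_noroot c : N.[c] != 0.
Proof.
apply/eqP => Nc; have : root (map_poly iota N) (iota c) by rewrite /root horner_map Nc rmorph0.
by case/N_root => i /esym/eqP; rewrite (negPf (theta_irr i c)).
Qed.

Lemma centerP P : nonzero P -> center p P <->
  [/\ tr P o1 != 0, tr P ord_max = 0 & exists i, tr P ord0 / tr P o1 = theta i].
Proof.
move=> P0; split=> [[i /(proportional_tr iota MiM) [c c0 h]]|[P1 P2 [i Pi]]].
  have [p2 p1 p0] := p_tr i; rewrite !h p2 mulr0 mulf_neq0 //; split=> //.
  by exists i; rewrite p0 mulrCA mulfK ?mulf_neq0.
exists i; apply/(proportional_tr iota MiM); have [p2 p1 p0] := p_tr i.
exists (tr P o1 / tr (p i) o1); first by rewrite mulf_neq0 ?invr_neq0.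
apply: ord3P; rewrite ?p2 ?P2 ?mulr0 ?divfK // p0 -Pi.
by rewrite mulrCA divfK // divfK.
Qed.

Lemma c021 : [/\ ord0 != ord_max :> 'I_3, ord0 != o1 & ord_max != o1].
Proof. by split. Qed.
Lemma c120 : [/\ o1 != ord_max :> 'I_3, o1 != ord0 & ord_max != ord0 :> 'I_3].
Proof. by split. Qed.
Lemma c012 : [/\ ord0 != o1 :> 'I_3, ord0 != ord_max :> 'I_3 & o1 != ord_max].
Proof. by split. Qed.

Lemma TZ_indep : alg_indep TT ZZ.
Proof. exact: (chart_indep iota MMi c021). Qed.

Lemma NT_neq0 : NT != 0.
Proof.
apply/eqP => h; have := TZ_indep (G := N%:P); rewrite ev2C => /(_ h)/eqP.
by rewrite polyC_eq0 -size_poly_eq0 N_size.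
Qed.

Lemma Nev t : ev1 iota t N = 0 <-> exists i, t = theta i.
Proof. by rewrite -N_root ev1_horner; split=> [/eqP|/eqP]. Qed.

Lemma Tw_indep : alg_indep TT ww.
Proof.
apply: (@alg_indep_of_points F L iota _ _ (map_poly iota N)).
  by rewrite map_poly_eq0 -size_poly_eq0 N_size.
move=> al be; rewrite -ev1_horner => Nal.
have [P P1 [P0 P2]] := chart_point_exists iota MMi c021 al (be * ev1 iota al N).
exists (plane_germ iota P); first exact: plane_germ_local.
have lP := plane_germ_local iota P.
have k0 : tr P o1 != 0 by rewrite P1 oner_neq0.
have := gp_ratio ord0 k0; have := gp_ratio ord_max k0.
rewrite P1 P0 P2 !divr1 -/TT -/ZZ => hZ hT; split=> //.
by have := lg_div lP hZ (lg_ev1 lP N hT) Nal; rewrite mulfK.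
Qed.

Lemma ZwE : ZZ = ww * NT.
Proof. by rewrite /ww divfK // NT_neq0. Qed.

Lemma TZ_to_Tw (G : {poly {poly F}}) : exists G', ev2 kc TT ZZ G = ev2 kc TT ww G' /\
  forall al be, ev2 iota al (be * ev1 iota al N) G = ev2 iota al be G'.
Proof.
elim/poly_ind: G => [|G c [G' [h1 h2]]]; first by exists 0; rewrite !ev2_zero; split=> // *; rewrite !ev2_zero.
exists (G' * ('X * N%:P) + c%:P); split=> [|al be].
  by rewrite !ev2D !ev2M !ev2X !ev2C h1 ZwE.
by rewrite !ev2D !ev2M !ev2X !ev2C h2.
Qed.

Lemma Tw_gen f : is_frac TT ww f.
Proof.
have [G [H [H0 ->]]] := chart_gen iota MiM MMi c021 f.
have [G' [-> _]] := TZ_to_Tw G; have [H' [E _]] := TZ_to_Tw H.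
by exists G', H'; rewrite -E.
Qed.

(** The point where the exceptional curve over the i-th centre meets the strict transform of the
    line. *)
Definition Egerm i := aff_germ iota TT ww (theta i) 0.

Lemma Egerm_local i : local_germ iota (Egerm i).
Proof. exact: (aff_germ_local iota Tw_indep). Qed.

Lemma center_germ P : nonzero P -> center p P -> exists i,
  tr P o1 != 0 /\ plane_germ iota P = aff_germ iota TT ZZ (theta i) 0.
Proof.
move=> P0 /(centerP P0)[P1 P2 [i Pi]]; exists i; split=> //.
by rewrite (chart_germ_eq MiM MMi c021 P1) Pi P2 mul0r.
Qed.

Lemma center_exists i : exists P, [/\ nonzero P, center p P, tr P o1 != 0 &
  plane_germ iota P = aff_germ iota TT ZZ (theta i) 0].
Proof.
have [P P1 [P0 P2]] := chart_point_exists iota MMi c021 (theta i) 0.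
have k0 : tr P o1 != 0 by rewrite P1 oner_neq0.
have Pn : nonzero P by apply/(tr_nonzero iota MiM); exists o1.
exists P; split=> //.
  by apply/(centerP Pn); split=> //; exists i; rewrite P0 P1 divr1.
by rewrite (chart_germ_eq MiM MMi c021 k0) P1 P0 P2 !divr1.
Qed.

(** The numerator is Z times a polynomial plus c(T) with c(theta_i) = 0, and [N] divides c because
    it is the minimal polynomial of theta_i. *)
Lemma TZ_gen_ideal i f : aff_germ iota TT ZZ (theta i) 0 f 0 -> exists a b,
  [/\ regular (aff_germ iota TT ZZ (theta i) 0) a, regular (aff_germ iota TT ZZ (theta i) 0) b
    & f = a * ZZ + b * NT].
Proof.
case=> G [H [H0 fE /esym/eqP]]; rewrite mulf_eq0 invr_eq0 (negPf H0) orbF.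
elim/poly_ind: G fE => [|G c _] fE.
  move=> _; exists 0, 0; rewrite fE ev2_zero !mul0r addr0; split=> //; exists 0;
  exact: (lg0 (aff_germ_local iota TZ_indep _ _)).
rewrite ev2D ev2M ev2X mulr0 add0r ev2C ev1_horner => /N_min/dvdpP[q cE].
exists (ev2 kc TT ZZ G / ev2 kc TT ZZ H), (ev2 kc TT ZZ q%:P / ev2 kc TT ZZ H).
split; [exact: aff_regular_frac|exact: aff_regular_frac|].
rewrite fE ev2D ev2M ev2X !ev2C cE ev1M -/NT mulrDl.
by congr (_ + _); rewrite mulrAC.
Qed.

Lemma aff_TZ_sub_Egerm i f a : aff_germ iota TT ZZ (theta i) 0 f a -> Egerm i f a.
Proof.
have lE := Egerm_local i; apply: (aff_germ_sub lE); first exact: aff_germ_u.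
rewrite ZwE; have e : 0 = 0 * ev1 iota (theta i) N :> L by rewrite mul0r.
rewrite [X in Egerm _ _ X]e; apply: (lg_mul lE); first exact: aff_germ_v.
by rewrite /NT; apply: (lg_ev1 lE); apply: aff_germ_u.
Qed.

Lemma Egerm_NT i : Egerm i NT 0.
Proof.
have lE := Egerm_local i.
have <- : ev1 iota (theta i) N = 0 by apply/Nev; exists i.
by rewrite /NT; apply: (lg_ev1 lE); apply: aff_germ_u.
Qed.

Lemma aff_NT i : aff_germ iota TT ZZ (theta i) 0 NT 0.
Proof.
have lE := aff_germ_local iota TZ_indep (theta i) 0.
have := lg_ev1 lE N (aff_germ_u iota TT ZZ (theta i) 0).
by have -> : ev1 iota (theta i) N = 0 by apply/Nev; exists i.
Qed.

(** The chart is the one with t = N(T): there Z/t is w, and the centre ideal, generated by Z and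
    N(T), becomes principal. *)
Lemma Egerm_blowup i : blowup iota p (Egerm i).
Proof.
have [P [P0 cP P1 PE]] := center_exists i; have lE := Egerm_local i.
have lv := plane_germ_local iota P.
have It : center_ideal iota p P NT by exists 0 => //; rewrite PE; apply: aff_NT.
apply: (blowup_of_germ P0 It NT_neq0 lE) => [f a|a [b vb hb]|f b].
- by rewrite PE; apply: aff_TZ_sub_Egerm.
- move: vb; rewrite (hb cP) PE => /TZ_gen_ideal[c [d [[c0 hc] [d0 hd] ->]]].
  exists (c0 * 0 + d0); rewrite mulrDl mulfK ?NT_neq0 // -mulrA.
  apply: (lg_add lE); last exact: aff_TZ_sub_Egerm.
  by apply: (lg_mul lE); [exact: aff_TZ_sub_Egerm | exact: aff_germ_v].
case=> G [H [H0 fE _]].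
have BT : blowup_chart (plane_germ iota P) (center_ideal iota p P) NT TT.
  by apply: Chart_base; exists (theta i); rewrite PE; apply: aff_germ_u.
have Bw : blowup_chart (plane_germ iota P) (center_ideal iota p P) NT ww.
  by apply: Chart_quot; exists 0 => //; rewrite PE; apply: aff_germ_v.
exists (ev2 kc TT ww G), (ev2 kc TT ww H), (ev2 iota (theta i) 0 G), (ev2 iota (theta i) 0 H).
split; [exact: (chart_ev2 lv)|exact: (chart_ev2 lv)|exact: aff_germ_ev2|exact: aff_germ_ev2|].
by split.
Qed.

End Surface.

(** * The cubics through the three points *)

Lemma quot_der_id (R : comNzRingType) (s a b c i : R) :
  s * ((a - b * c) * i) = (s * a - b * (s * c)) * i.
Proof. by ring. Qed.

(** The terms in J cancel because t = al xi + be eta. What remains is quadratic in xi and eta with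
    Jacobian factors, so each of the three powers of t can be absorbed by an element of the centre
    ideal once s times a Jacobian lies in that ideal. *)
Lemma jac_gen_id (R : fieldType) (al be xi eta t J Jaeta Jbeta Jxia Jxib s : R) :
  t = al * xi + be * eta -> t != 0 ->
  s * ((t * J - xi * (al * J + xi * Jaeta + eta * Jbeta)
     - eta * (xi * Jxia + (be * J + eta * Jxib))) / t ^+ 3)
  = - ((xi / t) ^+ 2 * (s * Jaeta / t) + (xi / t) * (eta / t) * (s * Jbeta / t)
     + (xi / t) * (eta / t) * (s * Jxia / t) + (eta / t) ^+ 2 * (s * Jxib / t)).
Proof.
move=> tE t0.
have -> : t * J - xi * (al * J + xi * Jaeta + eta * Jbeta)
     - eta * (xi * Jxia + (be * J + eta * Jxib))
   = - (xi ^+ 2 * Jaeta + xi * eta * Jbeta + xi * eta * Jxia + eta ^+ 2 * Jxib).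
  by rewrite {1}tE; ring.
by field.
Qed.

Section BasisForm.
Variables (F : nzRingType) (N : {poly F}).

Definition binary_form (S : nzRingType) (phi : F -> S) (x y : S) : S :=
  x ^+ 3 + phi N`_2 * x ^+ 2 * y + phi N`_1 * x * y ^+ 2 + phi N`_0 * y ^+ 3.

(** The cubic forms vanishing at the three points: on z = 0 such a form is a multiple of [N], and
    the other six basis elements are z times the quadratic monomials. *)
Definition cubic_basis (S : nzRingType) (phi : F -> S) (s : 'I_3 -> S) (i : 'I_7) : S :=
  let x := s ord0 in let y := s o1 in let z := s ord_max in
  nth 0 [:: binary_form phi x y; z * x ^+ 2; z * (x * y); z * y ^+ 2; z ^+ 2 * x; z ^+ 2 * y; z ^+ 3] i.

End BasisForm.

Lemma ord7P (Q : 'I_7 -> Prop) : (forall k, (k < 7)%N -> Q (inord k)) -> forall i, Q i.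
Proof. by move=> h i; rewrite -[i]inord_val; apply: h. Qed.

Lemma big_ord7 (V : nmodType) (f : 'I_7 -> V) : \sum_i f i = f (inord 0) + f (inord 1)
  + f (inord 2) + f (inord 3) + f (inord 4) + f (inord 5) + f (inord 6).
Proof.
rewrite !big_ord_recl big_ord0 addr0 !addrA.
by do !congr (_ + _); congr f; apply: val_inj; rewrite /= ?inordK.
Qed.

Section BasisFormTheory.
Variables (F : nzRingType) (S : comNzRingType) (phi : F -> S) (N : {poly F}).

Lemma cubic_basis_scale s c i :
  cubic_basis N phi (fun j => s j * c) i = cubic_basis N phi s i * c ^+ 3.
Proof.
elim/ord7P: i => k lk; rewrite /cubic_basis inordK //.
by move: k lk; do 7?[case; first by move=> _ /=; rewrite /binary_form; ring].
Qed.

Lemma cubic_basis0 s : s ord_max = 0 -> forall i, i != inord 0 -> cubic_basis N phi s i = 0.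
Proof.
move=> z0 i; elim/ord7P: i => k lk; rewrite /cubic_basis inordK // z0.
by move: k lk; case; [rewrite eqxx|do 6?[case; first by move=> _ _ /=; rewrite ?expr0n ?mul0r]].
Qed.

End BasisFormTheory.

Lemma binary_form1 (F : nzRingType) (S : comNzRingType) (phi : {rmorphism F -> S})
  (N : {poly F}) u : size N = 4%N -> N`_3 = 1 -> binary_form N phi u 1 = ev1 phi u N.
Proof.
move=> sN N3; rewrite ev1E sN !big_ord_recr big_ord0 /= N3 rmorph1 /binary_form.
by rewrite !expr1n !mulr1; ring.
Qed.

Section LocalRegular.
Variables (F : finFieldType) (L : closedFieldType) (iota : {rmorphism F -> L}).
Variables (x : germ F L) (lx : local_germ iota x).
Local Notation kc := (@ratfun_const F).

Lemma reg_add f g : regular x f -> regular x g -> regular x (f + g).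
Proof. by case=> a xa [b xb]; exists (a + b); apply: (lg_add lx). Qed.
Lemma reg_sub f g : regular x f -> regular x g -> regular x (f - g).
Proof. by case=> a xa [b xb]; exists (a - b); apply: (lg_sub lx). Qed.
Lemma reg_mul f g : regular x f -> regular x g -> regular x (f * g).
Proof. by case=> a xa [b xb]; exists (a * b); apply: (lg_mul lx). Qed.
Lemma reg_opp f : regular x f -> regular x (- f).
Proof. by case=> a xa; exists (- a); apply: (lg_opp lx). Qed.
Lemma reg_exp f n : regular x f -> regular x (f ^+ n).
Proof. by case=> a xa; exists (a ^+ n); apply: (lg_exp lx). Qed.
Lemma reg_const c : regular x (kc c).
Proof. by exists (iota c); apply: (lg_const lx). Qed.
Lemma reg0 : regular x 0. Proof. by exists 0; apply: (lg0 lx). Qed.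
Lemma reg1 : regular x 1. Proof. by exists 1; apply: (lg1 lx). Qed.
Lemma reg_sum (I : Type) (r : seq I) (P : pred I) (f_ : I -> ratfun F) :
  (forall i, P i -> regular x (f_ i)) -> regular x (\sum_(i <- r | P i) f_ i).
Proof. by move=> h; apply: big_ind => //; [exact: reg0 | exact: reg_add]. Qed.

Lemma lg_cubic_basis (N : {poly F}) s Q : (forall i, x (s i) (Q i)) ->
  forall l, x (cubic_basis N kc s l) (cubic_basis N iota Q l).
Proof.
move=> h l; elim/ord7P: l => k lk; rewrite /cubic_basis inordK //.
by move: k lk; do 7?[case; first by move=> _ /=; rewrite /binary_form;
   repeat first [apply: (lg_add lx) | apply: (lg_mul lx) | apply: (lg_exp lx)
     | apply: (lg_const lx) | apply: h]].
Qed.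

End LocalRegular.

(** * Cubics through the points are sections of -K *)

Section Sections.
Variables (F : finFieldType) (L : closedFieldType) (iota : {rmorphism F -> L}).
Hypothesis L_alg : forall a : L, algebraicOver iota a.
Variables (M Mi : 'M[F]_3) (p : 'I_3 -> 'I_3 -> L) (N : {poly F}) (theta : 'I_3 -> L).
Hypotheses (MiM : Mi *m M = 1%:M) (MMi : M *m Mi = 1%:M).
Hypotheses (N_size : size N = 4%N) (N_monic : N`_3 = 1).
Hypothesis N_root : forall t, root (map_poly iota N) t <-> exists i, t = theta i.
Hypothesis N_min : forall (G : {poly F}) i, root (map_poly iota G) (theta i) -> N %| G.
Hypothesis p_tr : forall i, [/\ tr iota M (p i) ord_max = 0, tr iota M (p i) o1 != 0
  & tr iota M (p i) ord0 = theta i * tr iota M (p i) o1].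
Local Notation K := (ratfun F).
Local Notation kc := (@ratfun_const F).
Local Notation gp := (gp M).
Local Notation tr := (tr iota M).
Local Notation TT := (TT M).
Local Notation ZZ := (ZZ M).
Local Notation NT := (NT M N).
Local Notation X := (blowup iota p).
Implicit Types (f g h s : K) (x y : germ F L).

Let TZ_ind : alg_indep TT ZZ := TZ_indep iota MMi.

Definition bV : 'I_7 -> K := cubic_basis N kc gp.
Definition cubic_space s := exists c : 'I_7 -> F, s = \sum_i kc (c i) * bV i.

Lemma cubic_ratio (c : 'I_7 -> F) k x Q : local_germ iota x ->
  (forall i, x (gp i / gp k) (Q i)) ->
  x ((\sum_i kc (c i) * bV i) / gp k ^+ 3) (\sum_i iota (c i) * cubic_basis N iota Q i).
Proof.
move=> lx hQ; rewrite mulr_suml; apply: (lg_sum lx) => i _.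
rewrite -mulrA; apply: (lg_mul lx); first exact: (lg_const lx).
by rewrite /bV -exprVn -cubic_basis_scale; apply: (lg_cubic_basis lx).
Qed.

Lemma cubic_regular_plane s P k : cubic_space s -> tr P k != 0 ->
  regular (plane_germ iota P) (s / gp k ^+ 3).
Proof.
move=> [c ->] k0; have lP := plane_germ_local iota P.
exists (\sum_i iota (c i) * cubic_basis N iota (fun j => tr P j / tr P k) i).
by apply: (cubic_ratio _ lP) => i; apply: gp_ratio.
Qed.

Lemma theta_form i : binary_form N iota (theta i) 1 = 0.
Proof. by rewrite binary_form1 //; apply/(Nev N_root); exists i. Qed.

Lemma aff_gp_ratio u v al be : u = TT -> v = ZZ -> forall i,
  aff_germ iota u v al be (gp i / gp o1) (nth 0 [:: al; 1; be] i).
Proof.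
move=> -> ->; apply: ord3P => /=.
- exact: aff_germ_u.
- by rewrite divff ?(gp_neq0 iota MMi) //; apply: (lg1 (aff_germ_local iota TZ_ind _ _)).
- exact: aff_germ_v.
Qed.

Lemma cubic_center s i : cubic_space s ->
  aff_germ iota TT ZZ (theta i) 0 (s / gp o1 ^+ 3) 0.
Proof.
move=> [c ->]; have lx := aff_germ_local iota TZ_ind (theta i) 0.
have := cubic_ratio c lx (aff_gp_ratio (theta i) 0 (erefl TT) (erefl ZZ)).
rewrite [X in aff_germ _ _ _ _ _ _ X]big1 // => l _; case: (eqVneq l (inord 0)) => [->|l0].
  by rewrite /cubic_basis inordK //= theta_form mulr0.
by rewrite cubic_basis0 // mulr0.
Qed.

Section OverCenter.
Variables (P : 'I_3 -> L) (t : K) (e : K -> L) (s : K).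
Local Notation v := (plane_germ iota P).
Local Notation I := (center_ideal iota p P).
Local Notation B := (blowup_chart v I t).
Hypotheses (P0 : nonzero P) (cP : center p P) (It : I t) (t0 : t != 0).
Hypothesis ev_e : chart_point v B e.
Hypothesis sV : cubic_space s.
Local Notation x := (chart_germ B e).
Let lv := plane_germ_local iota P.
Let lx : local_germ iota x := chart_germ_local lv ev_e.

Lemma base_regular f : regular v f -> regular x f.
Proof. by case=> a va; exists a; apply: (chart_germ_base_sub lv ev_e). Qed.

Lemma quot_regular a : I a -> regular x (a / t).
Proof. by move=> Ia; exists (e (a / t)); apply: (chart_germ_base lv ev_e); apply: Chart_quot. Qed.

(** The Leibniz and quotient rules carry regularity of s D from the generators of the chart to its
    localization. *)
Lemma der_regular (D : K -> K) : derivation D ->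
  (forall g, regular v g -> regular x (s * D g)) ->
  (forall a, I a -> regular x (s * D (a / t))) ->
  forall f, regular x f -> regular x (s * D f).
Proof.
move=> dD hv hI.
have hB f : B f -> regular x f /\ regular x (s * D f).
  elim=> {f}[f vf|a Ia|f g _ [rf hf] _ [rg hg]|f g _ [rf hf] _ [rg hg]].
  - by split; [exact: base_regular | exact: hv].
  - by split; [exact: quot_regular | exact: hI].
  - split; first exact: (reg_sub lx).
    have -> : D (f - g) = D f - D g.
      rewrite (der_add dD); congr (_ + _); apply/eqP; rewrite -addr_eq0 -(der_add dD).
      by rewrite addNr (der0 dD).
    by rewrite mulrBr; apply: (reg_sub lx).
  split; first exact: (reg_mul lx).
  rewrite (der_mul dD) mulrDr mulrA [s * (f * _)]mulrCA.
  by apply: (reg_add lx); apply: (reg_mul lx).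
move=> _ [_ [g [h [Bg Bh h0 -> _]]]]; have [rg hg] := hB _ Bg; have [rh hh] := hB _ Bh.
have h0' := chart_e_neq0 lv ev_e Bh h0.
have rV : regular x h^-1.
  by exists (e h)^-1; apply: (lg_inv lx) => //; apply: (chart_germ_base lv ev_e).
rewrite (der_div _ dD h0') quot_der_id; apply: (reg_mul lx) => //.
by apply: (reg_sub lx) => //; apply: (reg_mul lx) => //; apply: (reg_mul lx).
Qed.

(** The triple pole of the Jacobian turns s into s / gp o1 ^+ 3, which vanishes at the centre
    because the cubic passes through it. *)
Lemma base_jacobian g h : regular v g -> regular v h -> I (s * jacobian g h).
Proof.
have [i [P1 vE]] := center_germ MiM MMi p_tr P0 cP.
rewrite /center_ideal vE => rg rh.
have [c [c0 hc] ->] := jacobian_regular TZ_ind rg rh.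
have [dl _ JE] := jacobian_chart iota MiM MMi c021.
rewrite -/TT -/ZZ in JE; rewrite JE; exists 0 => //.
have lE := aff_germ_local iota TZ_ind (theta i) 0.
have := lg_mul lE (lg_mul lE hc (lg_const lE dl)) (cubic_center i sV); rewrite mulr0.
have -> // : s * (c * (kc dl / gp o1 ^+ 3)) = c * kc dl * (s / gp o1 ^+ 3).
by move: (gp o1 ^+ 3)^-1 => r; ring.
Qed.

(** The forms du /\ dv generate the stalk and the Jacobian is a biderivation, so it suffices to
    bound s times the Jacobian on generators of the local ring: functions regular on the plane, and
    the quotients of Z and N(T) by t. Working with generators treats every chart t at once. *)
Lemma anticanonical_stalk_center w : canonical_stalk x w -> regular x (s * w).
Proof.
elim=> [|a u u' {}w ra ru ru' _ IH]; first by rewrite mulr0; apply: (reg0 lx).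
rewrite mulrDr mulrCA; apply: (reg_add lx) => //; apply: (reg_mul lx) => //.
have [i [P1 vE]] := center_germ MiM MMi p_tr P0 cP.
have I_gen a' : I a' -> exists al be, [/\ regular v al, regular v be & a' = al * ZZ + be * NT].
  by move=> [b vb /(_ cP) b0]; rewrite b0 in vb; rewrite vE; apply: (TZ_gen_ideal MMi N_min); rewrite -vE.
have IZ : I ZZ by exists 0 => //; rewrite vE; apply: aff_germ_v.
have IN : I NT by exists 0 => //; rewrite vE; apply: (aff_NT MMi N_root).
have Ireg a' : I a' -> regular v a' by case=> b vb _; exists b.
have rI a' : I a' -> regular x a' by move=> /Ireg/base_regular.
have vZ := Ireg _ IZ; have vN := Ireg _ IN; have vt := Ireg _ It.
have [al [be [ral rbe tE]]] := I_gen _ It.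
pose A := ZZ / t; pose C := NT / t.
have rA : regular x A by exact: quot_regular.
have rC : regular x C by exact: quot_regular.
have anti f g : regular x (s * jacobian f g) -> regular x (s * jacobian g f).
  by move=> h; rewrite jacobian_anti mulrN; apply: (reg_opp lx).
(* One argument at a time: the elements a/t with a in the centre ideal are combinations of [A] and
   [C] with coefficients regular on the plane. *)
have gens h : (forall g, regular v g -> regular x (s * jacobian g h)) ->
   regular x (s * jacobian A h) -> regular x (s * jacobian C h) ->
   forall f, regular x f -> regular x (s * jacobian f h).
  move=> hv hA hC; apply: (der_regular (jacobian_derl h)) => // a' /I_gen[c [d [rc rd ->]]].
  have -> : (c * ZZ + d * NT) / t = c * A + d * C by rewrite /A /C mulrDl !mulrA.
  have dJ := jacobian_derl h; rewrite (der_add dJ) (der_mul dJ c A) (der_mul dJ d C).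
  have E4 : s * (jacobian c h * A + c * jacobian A h + (jacobian d h * C + d * jacobian C h))
     = (s * jacobian c h) * A + c * (s * jacobian A h) + ((s * jacobian d h) * C + d * (s * jacobian C h)).
    by ring.
  rewrite E4; have [xc xd] := (base_regular rc, base_regular rd).
  have [hc hd] := (hv _ rc, hv _ rd).
  by apply: (reg_add lx); apply: (reg_add lx); apply: (reg_mul lx).
have vv g h : regular v g -> regular v h -> regular x (s * jacobian g h).
  by move=> rg rh; apply: rI; apply: base_jacobian.
have vq g xi : regular v g -> I xi -> regular x (s * jacobian g (xi / t)).
  move=> rg Ixi; have rxi := Ireg _ Ixi; rewrite (der_div _ (jacobian_derr g) t0) quot_der_id.
  have q1 := quot_regular (base_jacobian rg rxi).
  have q2 := quot_regular (base_jacobian rg vt).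
  rewrite mulrBl -[_ * _ * t^-1 in X in _ - X]mulrA; apply: (reg_sub lx) q1 _.
  exact: (reg_mul lx (quot_regular Ixi) q2).
(* The only case with denominator t^3. Substituting t = al ZZ + be NT into the Jacobians of t leaves
   terms of order three in the centre ideal. *)
have AC : regular x (s * jacobian A C).
  rewrite /A /C (der_div _ (jacobian_derl _) t0).
  rewrite (der_div _ (jacobian_derr ZZ) t0) (der_div _ (jacobian_derr t) t0).
  rewrite jacobianxx jac_quot_id //.
  have J1 : jacobian t NT = al * jacobian ZZ NT + ZZ * jacobian al NT + NT * jacobian be NT.
    have dJ := jacobian_derl NT; rewrite {1}tE (der_add dJ) (der_mul dJ al ZZ) (der_mul dJ be NT) jacobianxx.
    by ring.
  have J2 : jacobian ZZ t = ZZ * jacobian ZZ al + (be * jacobian ZZ NT + NT * jacobian ZZ be).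
    have dJ := jacobian_derr ZZ; rewrite {1}tE (der_add dJ) (der_mul dJ al ZZ) (der_mul dJ be NT) jacobianxx.
    by ring.
  rewrite J1 J2 (jac_gen_id _ _ _ _ _ _ tE t0).
  have Q g h : regular v g -> regular v h -> regular x (s * jacobian g h / t).
    by move=> rg rh; apply: quot_regular; apply: base_jacobian.
  apply: (reg_opp lx); repeat apply: (reg_add lx); apply: (reg_mul lx); try exact: Q.
  - exact: (reg_exp lx).
  - exact: (reg_mul lx).
  - exact: (reg_mul lx).
  - exact: (reg_exp lx).
have gA g : regular v g -> regular x (s * jacobian g A) by move=> rg; apply: vq.
have gC g : regular v g -> regular x (s * jacobian g C) by move=> rg; apply: vq.
have zero h : regular x (s * jacobian h h) by rewrite jacobianxx mulr0; apply: (reg0 lx).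
have xA f : regular x f -> regular x (s * jacobian f A).
  by apply: gens => //; apply: anti.
have xC f : regular x f -> regular x (s * jacobian f C).
  by apply: gens.
have xv g f : regular v g -> regular x f -> regular x (s * jacobian f g).
  move=> rg; apply: gens => [h rh||].
  - exact: vv.
  - by apply: anti; apply: gA.
  - by apply: anti; apply: gC.
apply: (gens u' _ _ _ _ ru) => [g rg||].
- by apply: anti; apply: xv.
- by apply: anti; apply: xA.
- by apply: anti; apply: xC.
Qed.

End OverCenter.

Lemma other_index (k : 'I_3) : exists i j, [/\ i != j, i != k & j != k :> 'I_3].
Proof.
by elim/ord3P: k; [exists o1, ord_max | exists ord0, ord_max | exists ord0, o1].
Qed.

Lemma plane_anticanonical P k : tr P k != 0 ->
  anticanonical_eq (plane_germ iota P) (gp k ^+ 3)^-1.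
Proof.
move=> k0; have [i [j ijk]] := other_index k; have lP := plane_germ_local iota P.
have [dl dl0 JE] := jacobian_chart iota MiM MMi ijk.
have := anticanonical_aff iota (tr P i / tr P k) (tr P j / tr P k) (chart_indep iota MMi ijk).
rewrite -(chart_germ_eq MiM MMi ijk k0) JE => -[cs gen].
have e : (gp k ^+ 3)^-1 = kc dl^-1 * (kc dl / gp k ^+ 3).
  by rewrite mulrA -(rmorphM kc) mulVf // (rmorph1 kc) mul1r.
split.
  have rc : regular (plane_germ iota P) (kc dl^-1) by exact: (reg_const lP).
  rewrite e; elim: cs => [|a u v w ra ru rv _ IH]; first by rewrite mulr0; apply: Canonical0.
  rewrite mulrDr mulrA; apply: CanonicalD => //.
  exact: (reg_mul lP).
move=> w /gen[a ra ->]; exists (a * kc dl); last by rewrite mulrA.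
by apply: (reg_mul lP) => //; apply: (reg_const lP).
Qed.

Lemma nonzero_tr P : nonzero P -> exists k, tr P k != 0.
Proof. by move/(tr_nonzero iota MiM). Qed.

Lemma cubic_sections s : cubic_space s -> sections X (@anticanonical_eq F L) s.
Proof.
move=> sV x f Xx [cf _].
have [P [P0 lx _ [[nc xE]|[t [e [cP It t0 ev_e xE]]]]]] := blowupP Xx; last first.
  rewrite xE in cf *; exact: (anticanonical_stalk_center P0 cP It t0 ev_e sV).
have [k k0] := nonzero_tr P0.
have [_ gen] := plane_anticanonical k0; rewrite xE in cf lx *.
have [a ra ->] := gen _ cf.
rewrite mulrCA; apply: (reg_mul lx) => //; exact: cubic_regular_plane.
Qed.

End Sections.

Lemma ev1_small (F : nzRingType) (R : comNzRingType) (phi : {rmorphism F -> R}) u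
  (p : {poly F}) n : (size p <= n)%N -> ev1 phi u p = \sum_(i < n) phi p`_i * u ^+ i.
Proof.
move=> sp; rewrite ev1E (big_ord_widen _ (fun i => phi p`_i * u ^+ i) sp).
rewrite big_mkcond; apply: eq_bigr => i _; case: ltnP => // h.
by rewrite nth_default // rmorph0 mul0r.
Qed.

Lemma ev2_small (F : nzRingType) (R : comNzRingType) (phi : {rmorphism F -> R}) u v
  (G : {poly {poly F}}) n : (size G <= n)%N ->
  ev2 phi u v G = \sum_(i < n) ev1 phi u G`_i * v ^+ i.
Proof.
move=> sp; rewrite ev2E (big_ord_widen _ (fun i => ev1 phi u G`_i * v ^+ i) sp).
rewrite big_mkcond; apply: eq_bigr => i _; case: ltnP => // h.
by rewrite nth_default // rmorph0 mul0r.
Qed.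

Lemma dehomog_id (R : fieldType) (x y z c n a2 a1 a0 b1 b0 d s : R) : y != 0 ->
  s / y ^+ 3 = c * n + (a0 + a1 * (x / y) + a2 * (x / y) ^+ 2) * (z / y)
     + (b0 + b1 * (x / y)) * (z / y) ^+ 2 + d * (z / y) ^+ 3 ->
  s = c * (n * y ^+ 3) + a2 * (z * x ^+ 2) + a1 * (z * (x * y)) + a0 * (z * y ^+ 2)
    + b1 * (z ^+ 2 * x) + b0 * (z ^+ 2 * y) + d * z ^+ 3.
Proof.
move=> y0 /(congr1 (fun r => r * y ^+ 3)); rewrite divfK ?expf_neq0 // => ->.
by field.
Qed.

Lemma dehomog_sum_id (R : fieldType) (c0 c1 c2 c3 c4 c5 c6 n a d b : R) : b != 0 ->
  c0 * n + (c3 * 1 + c2 * (a / b) + c1 * (a / b * (a / b))) * (d / b)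
  + (c5 * 1 + c4 * (a / b)) * (d / b * (d / b)) + c6 * (d / b * (d / b * (d / b)))
  = (c0 * (n * b ^+ 3) + c1 * (d * a ^+ 2) + c2 * (d * (a * b)) + c3 * (d * b ^+ 2)
     + c4 * (d ^+ 2 * a) + c5 * (d ^+ 2 * b) + c6 * d ^+ 3) / b ^+ 3.
Proof. by move=> b0; field. Qed.

Lemma chart_change_id (R : fieldType) (a b s c : R) : a != 0 -> b != 0 ->
  c * (s / b ^+ 3) = (a / b) ^+ 3 * (c * (s / a ^+ 3)).
Proof. by move=> a0 b0; field; rewrite a0 b0. Qed.

(** * Sections of -K are cubics through the points *)

Section SectionsAreCubics.
Variables (F : finFieldType) (L : closedFieldType) (iota : {rmorphism F -> L}).
Hypothesis L_alg : forall a : L, algebraicOver iota a.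
Variables (M Mi : 'M[F]_3) (p : 'I_3 -> 'I_3 -> L) (N : {poly F}) (theta : 'I_3 -> L).
Hypotheses (MiM : Mi *m M = 1%:M) (MMi : M *m Mi = 1%:M).
Hypotheses (N_size : size N = 4%N) (N_monic : N`_3 = 1).
Hypothesis N_root : forall t, root (map_poly iota N) t <-> exists i, t = theta i.
Hypothesis N_min : forall (G : {poly F}) i, root (map_poly iota G) (theta i) -> N %| G.
Hypothesis p_tr : forall i, [/\ tr iota M (p i) ord_max = 0, tr iota M (p i) o1 != 0
  & tr iota M (p i) ord0 = theta i * tr iota M (p i) o1].
Local Notation K := (ratfun F).
Local Notation kc := (@ratfun_const F).
Local Notation gp := (gp M).
Local Notation tr := (tr iota M).
Local Notation TT := (TT M).
Local Notation ZZ := (ZZ M).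
Local Notation NT := (NT M N).
Local Notation ww := (ww M N).
Local Notation Egerm := (Egerm iota M N theta).
Local Notation X := (blowup iota p).
Local Notation cubic_space := (cubic_space M N).
Implicit Types (f g h s : K) (x y : germ F L).

Let TZ_ind : alg_indep TT ZZ := TZ_indep iota MMi.

Lemma bV_eq0 : bV M N (inord 0) = NT * gp o1 ^+ 3.
Proof.
have g1 := gp_neq0 iota MMi o1.
have := cubic_basis_scale kc N gp (gp o1)^-1 (inord 0).
rewrite /bV /cubic_basis inordK //= exprVn (divff g1) (binary_form1 kc _ N_size N_monic).
by rewrite -/TT -/NT => ->; rewrite divfK ?expf_neq0.
Qed.

Lemma cubic_of_coefs s (c a2 a1 a0 b1 b0 d : F) :
  s / gp o1 ^+ 3 = kc c * NT + (kc a0 + kc a1 * TT + kc a2 * TT ^+ 2) * ZZ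
     + (kc b0 + kc b1 * TT) * ZZ ^+ 2 + kc d * ZZ ^+ 3 -> cubic_space s.
Proof.
move=> /(dehomog_id (gp_neq0 iota MMi o1)) ->.
exists (fun i : 'I_7 => nth 0 [:: c; a2; a1; a0; b1; b0; d] i).
by rewrite big_ord7 bV_eq0 /bV /cubic_basis !inordK.
Qed.

Lemma poly_chart1 s :
  (forall P k, nonzero P -> ~ center p P -> tr P k != 0 ->
     regular (plane_germ iota P) (s / gp k ^+ 3)) ->
  exists A, s / gp o1 ^+ 3 = ev2 kc TT ZZ A.
Proof.
move=> hs; apply: (poly_of_regular TZ_ind L_alg (chart_gen iota MiM MMi c021)
  (s := [seq theta i | i <- enum 'I_3])) => al be ne.
have [P P1 [P0 P2]] := chart_point_exists iota MMi c021 al be.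
have k0 : tr P o1 != 0 by rewrite P1 oner_neq0.
have Pn : nonzero P by apply/(tr_nonzero iota MiM); exists o1.
have := hs P o1 Pn _ k0; rewrite (chart_germ_eq MiM MMi c021 k0) P1 P0 P2 !divr1; apply.
move/(centerP MiM p_tr Pn); rewrite P0 P1 P2 divr1 => -[_ be0 [i ai]].
case/negP: ne; rewrite be0 eqxx andbT ai; apply/mapP; exists i => //.
by rewrite mem_enum.
Qed.

Lemma poly_chart0 s :
  (forall P k, nonzero P -> ~ center p P -> tr P k != 0 ->
     regular (plane_germ iota P) (s / gp k ^+ 3)) ->
  exists A, s / gp ord0 ^+ 3 = ev2 kc (gp o1 / gp ord0) (gp ord_max / gp ord0) A.
Proof.
move=> hs; apply: (poly_of_regular (chart_indep iota MMi c120) L_alg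
  (chart_gen iota MiM MMi c120) (s := [seq (theta i)^-1 | i <- enum 'I_3])) => al be ne.
have [P P1 [P0 P2]] := chart_point_exists iota MMi c120 al be.
have k0 : tr P ord0 != 0 by rewrite P1 oner_neq0.
have Pn : nonzero P by apply/(tr_nonzero iota MiM); exists ord0.
have := hs P ord0 Pn _ k0; rewrite (chart_germ_eq MiM MMi c120 k0) P1 P0 P2 !divr1; apply.
move/(centerP MiM p_tr Pn); rewrite P0 P1 P2 div1r => -[_ be0 [i ai]].
case/negP: ne; rewrite be0 eqxx andbT; apply/mapP; exists i; first by rewrite mem_enum.
by rewrite -ai invrK.
Qed.

(** In two charts the section is a polynomial. Comparing them gives T^J A = T^3 [flip J 1 A'], which
    bounds the total degree by 3. Regularity at one point [Egerm i] makes the restriction to Z = 0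
    vanish at theta_i, hence be a multiple of [N]; by conjugacy one index is enough. The hypotheses
    mention only these points so that the lemma also applies to sections on the model. *)
Lemma cubic_of_regular s :
  (forall P k, nonzero P -> ~ center p P -> tr P k != 0 ->
     regular (plane_germ iota P) (s / gp k ^+ 3)) ->
  (exists i, regular (Egerm i) (s / gp o1 ^+ 3 / NT)) -> cubic_space s.
Proof.
move=> hs [i [r hr]].
have g0 := gp_neq0 iota MMi ord0; have g1 := gp_neq0 iota MMi o1.
have [A sA] := poly_chart1 hs; have [A' sA'] := poly_chart0 hs.
have T0 : TT != 0 by exact: (mulf_neq0 g0 (invr_neq0 g1)).
pose J := flip_deg A'.
have e : ev2 kc TT ZZ (('X^J)%:P * A) = ev2 kc TT ZZ ('X^3%:P * flip J 1 A').
  rewrite !ev2M !ev2C !ev1Xn !ev1X (ev2_flip kc _ _ T0 (leqnn _)) rmorph1 mulr1.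
  have -> : ZZ / TT = gp ord_max / gp ord0 by rewrite /TT /ZZ field_div_div.
  have -> : TT^-1 = gp o1 / gp ord0 by rewrite /TT invf_div.
  rewrite -sA -sA'; exact: (chart_change_id _ _ g0 g1).
have {e} coefE m : 'X^J * A`_m = 'X^3 * (flip J 1 A')`_m.
  have : ('X^J)%:P * A = 'X^3%:P * flip J 1 A'.
    apply/eqP; rewrite -subr_eq0; apply/eqP/TZ_ind.
    by rewrite ev2B e subrr.
  by move/(congr1 (fun Q : {poly {poly F}} => Q`_m)); rewrite !coefCM.
have sz m : A`_m != 0 -> (size (A`_m)%R + m <= 4)%N.
  move=> Am0; have := congr1 (fun r : {poly F} => size r) (coefE m) => /=.
  have fm0 : (flip J 1 A')`_m != 0.
    apply: contraNneq Am0 => f0; move: (coefE m); rewrite f0 mulr0 => /eqP.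
    by rewrite mulf_eq0 -size_poly_eq0 size_polyXn.
  rewrite ![_ * _`_m]mulrC (size_mulXn _ Am0) (size_mulXn _ fm0).
  have := size_flip (s := 0) (leqnn J) (eq_leq (size_poly1 F)) fm0.
  by move: (size _) (size _) => ? ?; lia.
have sA4 : (size A <= 4)%N.
  rewrite leqNgt; apply/negP => h.
  have l0 : A`_(size A).-1 != 0 by rewrite -lead_coefE lead_coef_eq0 -size_poly_gt0 (leq_trans _ h).
  have := sz _ l0; rewrite -size_poly_gt0 in l0; move: l0 h; move: (size _) (size _) => ? ?; lia.
have sz' m n : (n + m = 4)%N -> (size (A`_m)%R <= n)%N.
  move=> mn; case: (eqVneq A`_m 0) => [->|/sz]; first by rewrite size_poly0.
  by move: (size _) => ?; lia.
have [q A0E] : exists q, A`_0 = q * N.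
  apply/dvdpP; apply: (N_min (i := i)); rewrite /root -ev1_horner -(ev2_0 iota); apply/eqP.
  have lE := Egerm_local iota theta MMi N_size i.
  have h1 : Egerm i (s / gp o1 ^+ 3) (ev2 iota (theta i) 0 A).
    rewrite sA; apply: (aff_TZ_sub_Egerm MMi N_size); exact: aff_germ_ev2.
  have h2 := lg_mul lE hr (Egerm_NT MMi N_size N_root i).
  by move: h2; rewrite divfK ?(NT_neq0 iota MMi N_size) // mulr0; apply: (lg_fun lE h1).
have sq : (size q <= 1)%N.
  case: (eqVneq q 0) => [->|q0]; first by rewrite size_poly0.
  have := sz' 0%N 4%N erefl; rewrite A0E size_mul -?size_poly_eq0 ?N_size //; last by rewrite size_poly_eq0.
  by move: (size _) => ?; lia.
apply: (cubic_of_coefs (c := q`_0) (a2 := A`_1`_2) (a1 := A`_1`_1) (a0 := A`_1`_0)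
  (b1 := A`_2`_1) (b0 := A`_2`_0) (d := A`_3`_0)).
rewrite sA (ev2_small kc TT ZZ sA4) !big_ord_recr big_ord0 /=.
rewrite A0E ev1M -/NT (size1_polyC sq) ev1C coefC /=.
rewrite (ev1_small kc TT (sz' 1%N 3%N erefl)) (ev1_small kc TT (sz' 2%N 2%N erefl)).
rewrite (ev1_small kc TT (sz' 3%N 1%N erefl)) !big_ord_recr !big_ord0 /=.
by rewrite !expr0 !expr1 !mulr1 !add0r.
Qed.

Lemma jacobian_Tw : jacobian TT ww = jacobian TT ZZ / NT.
Proof.
have n0 := NT_neq0 iota MMi N_size.
rewrite /ww (der_div _ (jacobian_derr TT) n0).
have [q qE] := der_ev1 N.
by rewrite {2}/NT (qE _ _ (jacobian_derr TT)) jacobianxx !mulr0 subr0.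
Qed.

(** Since dT /\ dw = (dT /\ dZ) / N(T), the local equation gains the factor 1/N(T) on the
    exceptional curve: K_X is the pullback of the plane canonical divisor plus the exceptional
    curves. *)
Lemma Egerm_anticanonical i : anticanonical_eq (Egerm i) ((gp o1 ^+ 3)^-1 / NT).
Proof.
have lE := Egerm_local iota theta MMi N_size i.
have [dl dl0 JE] := jacobian_chart iota MiM MMi c021.
have := anticanonical_aff iota (theta i) 0 (Tw_indep iota MMi N_size).
rewrite jacobian_Tw -/(TT) -/(ZZ) JE => -[cs gen].
have e : (gp o1 ^+ 3)^-1 / NT = kc dl^-1 * (kc dl / gp o1 ^+ 3 / NT).
  by rewrite !mulrA -(rmorphM kc) mulVf // (rmorph1 kc) mul1r.
split.
  have rc : regular (Egerm i) (kc dl^-1) by exact: (reg_const lE).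
  rewrite e; elim: cs => [|a u v w ra ru rv _ IH]; first by rewrite mulr0; apply: Canonical0.
  rewrite mulrDr mulrA; apply: CanonicalD => //.
  exact: (reg_mul lE).
move=> w /gen[a ra ->]; exists (a * kc dl); last by rewrite !mulrA.
by apply: (reg_mul lE) => //; apply: (reg_const lE).
Qed.

Lemma sections_cubic s : sections X (@anticanonical_eq F L) s -> cubic_space s.
Proof.
move=> hs; apply: cubic_of_regular => [P k P0 nc k0|].
  exact: (hs _ _ (blowup_plane iota P0 nc) (plane_anticanonical MiM MMi k0)).
exists ord0; rewrite -mulrA.
exact: (hs _ _ (Egerm_blowup MiM MMi N_size N_root N_min p_tr ord0) (Egerm_anticanonical ord0)).
Qed.

Lemma sectionsP s : sections X (@anticanonical_eq F L) s <-> cubic_space s.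
Proof.
by split; [exact: sections_cubic | exact: (cubic_sections MiM MMi N_size N_monic N_root N_min p_tr)].
Qed.

Lemma bV_free (c : 'I_7 -> F) : \sum_i kc (c i) * bV M N i = 0 -> forall i, c i = 0.
Proof.
move=> c0; pose G : {poly {poly F}} := (c (inord 0) *: N)%:P
  + (c (inord 3) *: 1 + c (inord 2) *: 'X + c (inord 1) *: 'X^2)%:P * 'X
  + (c (inord 5) *: 1 + c (inord 4) *: 'X)%:P * 'X^2 + (c (inord 6))%:P%:P * 'X^3.
have g1 := gp_neq0 iota MMi o1.
have evG : ev2 kc TT ZZ G = (\sum_i kc (c i) * bV M N i) / gp o1 ^+ 3.
  rewrite big_ord7 bV_eq0 /bV /cubic_basis !inordK //=.
  rewrite /G -!mul_polyC !ev2D !ev2M ?ev2Xn !ev2X !ev2C !ev1D !ev1M !ev1C ?ev1Xn !ev1X.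
  rewrite -/(NT) ?(rmorph1 kc).
  exact: (dehomog_sum_id _ _ _ _ _ _ _ _ _ _ g1).
have G0 : G = 0 by apply: TZ_ind; rewrite evG c0 mul0r.
have h m j : G`_m`_j = 0 by rewrite G0 !coef0.
have := h 0%N 3%N; have := h 1%N 0%N; have := h 1%N 1%N; have := h 1%N 2%N.
have := h 2%N 0%N; have := h 2%N 1%N; have := h 3%N 0%N.
rewrite /G !coefD !coefCM !coefC !coefX !coefXn /= !mulr0 !mulr1 ?addr0 ?add0r.
rewrite !coefD !coefZ !coefX !coefXn !coef1 !coefC /= N_monic ?coef0 ?mulr0 ?mulr1 ?addr0 ?add0r.
move=> h6 h4 h5 h1 h2 h3 h0; elim/ord7P => k lk.
by move: k lk; do 7?[case; first by []].
Qed.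

End SectionsAreCubics.

(** * Points of the anticanonical model *)

Lemma inverse_pair_id (R : fieldType) (c d : R) : c != 0 -> d != 0 ->
  d * c * (c^-1 / d) = 1.
Proof. by move=> c0 d0; field; rewrite c0 d0. Qed.

Lemma inverse_pair_quot_id (R : fieldType) (c d z u : R) : c != 0 -> d != 0 ->
  c * z * u * (c^-1 / d) = z / d * u.
Proof. by move=> c0 d0; field; rewrite c0 d0. Qed.

Section Model.
Variables (F : finFieldType) (L : closedFieldType) (iota : {rmorphism F -> L}).
Hypothesis L_alg : forall a : L, algebraicOver iota a.
Variables (M Mi : 'M[F]_3) (p : 'I_3 -> 'I_3 -> L) (N : {poly F}) (theta : 'I_3 -> L).
Hypotheses (MiM : Mi *m M = 1%:M) (MMi : M *m Mi = 1%:M).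
Hypotheses (N_size : size N = 4%N) (N_monic : N`_3 = 1).
Hypothesis N_root : forall t, root (map_poly iota N) t <-> exists i, t = theta i.
Hypothesis N_min : forall (G : {poly F}) i, root (map_poly iota G) (theta i) -> N %| G.
Hypothesis p_tr : forall i, [/\ tr iota M (p i) ord_max = 0, tr iota M (p i) o1 != 0
  & tr iota M (p i) ord0 = theta i * tr iota M (p i) o1].
Local Notation K := (ratfun F).
Local Notation kc := (@ratfun_const F).
Local Notation gp := (gp M).
Local Notation tr := (tr iota M).
Local Notation TT := (TT M).
Local Notation ZZ := (ZZ M).
Local Notation NT := (NT M N).
Local Notation ww := (ww M N).
Local Notation Egerm := (Egerm iota M N theta).
Local Notation X := (blowup iota p).
Local Notation cubic_space := (cubic_space M N).
Local Notation bV := (bV M N).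
Local Notation cbL := (cubic_basis N iota).
Implicit Types (f g h s : K) (x y : germ F L).

Variables (n : nat) (b : 'I_n -> K) (C : 'I_n -> 'I_7 -> F) (Dm : 'I_7 -> 'I_n -> F).
Hypothesis bE : forall i, b i = \sum_l kc (C i l) * bV l.
Hypothesis bVE : forall l, bV l = \sum_i kc (Dm l i) * b i.

(** The basis [b] is arbitrary. [V] gives the coordinates of the image point with respect to the
    explicit cubics, and the matrices [C] and [Dm] translate between the two. *)
Lemma amap_val x P : local_germ iota x -> anticanonical_map b x P ->
  exists f V c, [/\ anticanonical_eq x f, f != 0, forall l, x (bV l * f) (V l), c != 0 &
    (forall i, P i = c * \sum_l iota (C i l) * V l) /\
    (forall l, \sum_i iota (Dm l i) * P i = c * V l)].
Proof.
move=> lx [[j Pj] [f [Q [ef xQ [c c0 PE]]]]].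
pose V l := \sum_i iota (Dm l i) * Q i.
have xV l : x (bV l * f) (V l).
  rewrite bVE mulr_suml; apply: (lg_sum lx) => i _.
  by rewrite -mulrA; apply: (lg_mul lx) => //; apply: (lg_const lx).
have QE i : Q i = \sum_l iota (C i l) * V l.
  apply: (lg_fun lx (xQ i)); rewrite bE mulr_suml; apply: (lg_sum lx) => l _.
  by rewrite -mulrA; apply: (lg_mul lx) => //; apply: (lg_const lx).
have Qj : Q j != 0 by apply: contraNneq Pj => Q0; rewrite PE Q0 mulr0.
exists f, V, c; split=> //.
- by have := lg_neq0 lx (xQ j) Qj; apply: neq0_mulr.
- by split=> [i|l]; [rewrite PE QE | rewrite /V mulr_sumr; apply: eq_bigr => i _; rewrite PE mulrCA].
Qed.

Lemma amap_intro x f V P : local_germ iota x -> anticanonical_eq x f ->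
  (forall l, x (bV l * f) (V l)) -> nonzero V ->
  (exists2 c, c != 0 & forall i, P i = c * \sum_l iota (C i l) * V l) ->
  anticanonical_map b x P.
Proof.
move=> lx ef xV [l Vl] [c c0 PE].
have xb i : x (b i * f) (\sum_l iota (C i l) * V l).
  rewrite bE mulr_suml; apply: (lg_sum lx) => k _.
  by rewrite -mulrA; apply: (lg_mul lx) => //; apply: (lg_const lx).
have VE : V l = \sum_i iota (Dm l i) * \sum_l iota (C i l) * V l.
  apply: (lg_fun lx (xV l)); rewrite bVE mulr_suml; apply: (lg_sum lx) => k _.
  by rewrite -mulrA; apply: (lg_mul lx) => //; apply: (lg_const lx).
split; last by exists f, (fun i => \sum_l iota (C i l) * V l); split=> //; exists c.
case: (boolP [exists i, P i != 0]) => [/existsP[i Pi]|]; first by exists i.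
rewrite negb_exists => /forallP P0; case/eqP: Vl; rewrite VE big1 // => i _.
have := P0 i; rewrite negbK PE mulf_eq0 (negPf c0) => /= /eqP->.
by rewrite mulr0.
Qed.

Lemma plane_val P k f : tr P k != 0 -> anticanonical_eq (plane_germ iota P) f -> f != 0 ->
  exists2 mu, mu != 0 & forall l,
    plane_germ iota P (bV l * f) (mu * cbL (fun j => tr P j / tr P k) l).
Proof.
move=> k0 ef f0; have lP := plane_germ_local iota P.
have g3 : (gp k ^+ 3)^-1 != 0 by rewrite invr_neq0 ?expf_neq0 ?(gp_neq0 iota MMi).
have [a [mu [xa mu0 fE]]] := anticanonical_unit lP (plane_anticanonical MiM MMi k0) ef g3.
exists mu => // l; rewrite fE mulrCA; apply: (lg_mul lP) => //.
rewrite /bV -exprVn -cubic_basis_scale; apply: (lg_cubic_basis lP) => i.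
exact: gp_ratio.
Qed.

(** The elements bV 1, 2, 4, 5, 6 are bV 3 times T^2, T, ZT, Z, Z^2, and over a centre T has value
    theta_i and Z has value 0. *)
Lemma center_val x P f V : local_germ iota x ->
  (forall f a, plane_germ iota P f a -> x f a) -> nonzero P -> center p P ->
  (forall l, x (bV l * f) (V l)) ->
  exists i, [/\ V (inord 1) = theta i ^+ 2 * V (inord 3), V (inord 2) = theta i * V (inord 3),
     V (inord 4) = 0, V (inord 5) = 0 & V (inord 6) = 0].
Proof.
move=> lx Px P0 cP xV; have [i [P1 PE]] := center_germ MiM MMi p_tr P0 cP.
rewrite PE in Px; have xT := Px _ _ (aff_germ_u iota TT ZZ (theta i) 0).
have xZ := Px _ _ (aff_germ_v iota TT ZZ (theta i) 0).
have g1 := gp_neq0 iota MMi o1.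
exists i; have x3 := xV (inord 3).
have key l (u : K) a : bV l = bV (inord 3) * u -> x u a -> V l = a * V (inord 3).
  move=> lE xu; apply: (lg_fun lx (xV l)); rewrite lE -mulrA mulrCA.
  exact: (lg_mul lx).
have TE : gp ord0 = TT * gp o1 by rewrite /TT divfK.
have ZE : gp ord_max = ZZ * gp o1 by rewrite /ZZ divfK.
have E1 : bV (inord 1) = bV (inord 3) * TT ^+ 2.
  by rewrite /bV /cubic_basis !inordK //= TE; ring.
have E2 : bV (inord 2) = bV (inord 3) * TT.
  by rewrite /bV /cubic_basis !inordK //= TE; ring.
have E4 : bV (inord 4) = bV (inord 3) * (ZZ * TT).
  by rewrite /bV /cubic_basis !inordK //= TE ZE; ring.
have E5 : bV (inord 5) = bV (inord 3) * ZZ.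
  by rewrite /bV /cubic_basis !inordK //= ZE; ring.
have E6 : bV (inord 6) = bV (inord 3) * ZZ ^+ 2.
  by rewrite /bV /cubic_basis !inordK //= ZE; ring.
split.
- exact: (key _ _ _ E1 (lg_exp lx 2 xT)).
- exact: (key _ _ _ E2 xT).
- by rewrite (key _ _ _ E4 (lg_mul lx xZ xT)) !mul0r.
- by rewrite (key _ _ _ E5 xZ) mul0r.
- by rewrite (key _ _ _ E6 (lg_exp lx 2 xZ)) expr0n mul0r.
Qed.

(** No base points off the centres: where z != 0 the form z^3 is nonzero, and on z = 0 the form [N]
    vanishes only at the centres. *)
Lemma cbL_nonzero P k : tr P k != 0 -> nonzero P -> ~ center p P ->
  nonzero (cbL (fun j => tr P j / tr P k)).
Proof.
move=> k0 P0 nc; case: (eqVneq (tr P ord_max) 0) => [z0|z0]; last first.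
  by exists (inord 6); rewrite /cubic_basis inordK //= expf_neq0 // mulf_neq0 ?invr_neq0.
exists (inord 0); rewrite /cubic_basis inordK //=.
case: (eqVneq (tr P o1) 0) => [y0|y0].
  have x0 : tr P ord0 != 0.
    have [j] := nonzero_tr iota MiM P0; apply: contraNneq => x0.
    by apply/eqP; elim/ord3P: j.
  rewrite /binary_form y0 mul0r !expr0n /= !mulr0 !addr0.
  by rewrite expf_neq0 // mulf_neq0 ?invr_neq0.
apply: contra_notN nc => h; apply/(centerP MiM p_tr P0); split=> //.
apply/(Nev N_root); rewrite -(binary_form1 iota _ N_size N_monic).
apply: (mulIf (expf_neq0 3 (mulf_neq0 y0 (invr_neq0 k0)))); rewrite mul0r -(eqP h).
rewrite /binary_form; move: (tr P ord0) (tr P o1) (tr P k) y0 k0 => a c d c0 d0.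
by field; rewrite c0 d0.
Qed.

Lemma plane_amap P k : nonzero P -> ~ center p P -> tr P k != 0 ->
  anticanonical_map b (plane_germ iota P)
    (fun i => \sum_l iota (C i l) * cbL (fun j => tr P j / tr P k) l).
Proof.
move=> P0 nc k0; have lP := plane_germ_local iota P.
apply: (amap_intro lP (plane_anticanonical MiM MMi k0) (V := cbL (fun j => tr P j / tr P k))).
- move=> l; rewrite /bV -exprVn -cubic_basis_scale; apply: (lg_cubic_basis lP) => i.
  exact: gp_ratio.
- exact: cbL_nonzero.
- by exists 1; [exact: oner_neq0 | move=> i; rewrite mul1r].
Qed.

(** The image of the contracted line: on z = 0 all basis cubics except [N] vanish, so only the
    column 0 of [C] remains. *)
Definition sing : 'I_n -> L := fun i => iota (C i (inord 0)).

Lemma sum_only0 i (V : 'I_7 -> L) : (forall l, l != inord 0 -> V l = 0) ->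
  \sum_l iota (C i l) * V l = V (inord 0) * sing i.
Proof.
move=> h; rewrite (bigD1 (inord 0)) //= big1 ?addr0 ?[V _ * _]mulrC // => l l0.
by rewrite h // mulr0.
Qed.

Lemma Egerm_val i l :
  Egerm i (bV l * ((gp o1 ^+ 3)^-1 / NT)) (if l == inord 0 then 1 else 0).
Proof.
have g1 := gp_neq0 iota MMi o1; have n0 := NT_neq0 iota MMi N_size.
have lE := Egerm_local iota theta MMi N_size i.
case: eqP => [->|/eqP l0].
  rewrite (bV_eq0 iota MMi N_size N_monic).
  by rewrite (inverse_pair_id (expf_neq0 3 g1) n0); apply: lg1 lE.
have xT := aff_germ_u iota TT ww (theta i) 0; have xw := aff_germ_v iota TT ww (theta i) 0.
have xZ := aff_TZ_sub_Egerm MMi N_size (aff_germ_v iota TT ZZ (theta i) 0).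
have main (u : K) a : bV l = gp o1 ^+ 3 * ZZ * u -> Egerm i u a ->
   Egerm i (bV l * ((gp o1 ^+ 3)^-1 / NT)) 0.
  move=> -> xu; rewrite (inverse_pair_quot_id _ _ (expf_neq0 3 g1) n0) -/ww.
  by have := lg_mul lE xw xu; rewrite mul0r.
have TE : gp ord0 = TT * gp o1 by rewrite /TT divfK.
have ZE : gp ord_max = ZZ * gp o1 by rewrite /ZZ divfK.
elim/ord7P: l l0 main => k lk l0 main.
move: k lk l0 main; case=> [|k]; first by rewrite eqxx.
case: k => [|k] lk l0 main.
  by apply: main (lg_exp lE 2 xT); rewrite /bV /cubic_basis inordK //= TE ZE; ring.
case: k lk l0 main => [|k] lk l0 main.
  by apply: main xT; rewrite /bV /cubic_basis inordK //= TE ZE; ring.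
case: k lk l0 main => [|k] lk l0 main.
  by apply: main (lg1 lE); rewrite /bV /cubic_basis inordK //= ZE; ring.
case: k lk l0 main => [|k] lk l0 main.
  by apply: main (lg_mul lE xZ xT); rewrite /bV /cubic_basis inordK //= TE ZE; ring.
case: k lk l0 main => [|k] lk l0 main.
  by apply: main xZ; rewrite /bV /cubic_basis inordK //= ZE; ring.
case: k lk l0 main => [|k] lk l0 main //.
by apply: main (lg_exp lE 2 xZ); rewrite /bV /cubic_basis inordK //= ZE; ring.
Qed.

Lemma Egerm_amap i : anticanonical_map b (Egerm i) sing.
Proof.
have lE := Egerm_local iota theta MMi N_size i.
have e := Egerm_anticanonical iota theta MiM MMi N_size i.
apply: (amap_intro lE e
  (V := fun l => if l == inord 0 then 1 else 0) (Egerm_val i)).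
  by exists (inord 0); rewrite eqxx oner_neq0.
exists 1; first exact: oner_neq0.
move=> j; rewrite sum_only0 ?eqxx ?mul1r // => l l0.
by rewrite (negPf l0).
Qed.

Lemma line_amap P k Q : nonzero P -> ~ center p P -> tr P ord_max = 0 -> tr P k != 0 ->
  proportional sing Q -> anticanonical_map b (plane_germ iota P) Q.
Proof.
move=> P0 nc z0 k0 [c c0 QE]; have [l Vl] := cbL_nonzero k0 P0 nc.
have V0 : forall l, l != inord 0 -> cbL (fun j => tr P j / tr P k) l = 0.
  by move=> l' l'0; rewrite cubic_basis0 // z0 mul0r.
have lP := plane_germ_local iota P.
apply: (amap_intro lP (plane_anticanonical MiM MMi k0) (V := cbL (fun j => tr P j / tr P k))).
- move=> l'; rewrite /bV -exprVn -cubic_basis_scale; apply: (lg_cubic_basis lP) => i.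
  exact: gp_ratio.
- by exists l.
have V00 : cbL (fun j => tr P j / tr P k) (inord 0) != 0.
  by case: (eqVneq l (inord 0)) Vl => [->//|l0]; rewrite (V0 _ l0) eqxx.
exists (c / cbL (fun j => tr P j / tr P k) (inord 0)).
  by rewrite mulf_neq0 ?invr_neq0.
by move=> i; rewrite QE (sum_only0 _ V0) mulrA divfK.
Qed.

Definition affine_vec (S : comNzRingType) (a0 a1 : S) : 'I_3 -> S :=
  fun j => nth 0 [:: a0; a1; 1] j.

Definition affine_pt (P : F * F) : 'I_n -> F :=
  fun i => \sum_l C i l * cubic_basis N id (affine_vec P.1 P.2) l.

Definition sing_pt : 'I_n -> F := fun i => C i (inord 0).

Lemma cubic_basis_rat (Q : 'I_3 -> F) l : iota (cubic_basis N id Q l) = cbL (iota \o Q) l.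
Proof.
elim/ord7P: l => k lk; rewrite /cubic_basis inordK //.
by move: k lk; do 7?[case; first by move=> _ /=; rewrite /binary_form ?rmorphD ?rmorphM ?rmorphXn ?rmorphM ?rmorphXn].
Qed.

Lemma affine_model P : anticanonical_model X b (iota \o affine_pt P).
Proof.
have [Q hQ] := tr_surj iota MMi (affine_vec (iota P.1) (iota P.2)).
have Q2 : tr Q ord_max = 1 by rewrite hQ.
have Qz : tr Q ord_max != 0 by rewrite Q2 oner_neq0.
have Q0 : nonzero Q by apply/(tr_nonzero iota MiM); exists ord_max.
have nc : ~ center p Q.
  by move/(centerP MiM p_tr Q0) => [_ z0 _]; rewrite z0 eqxx in Qz.
exists (plane_germ iota Q); first exact: blowup_plane.
have := plane_amap Q0 nc Qz; congr (anticanonical_map b _ _).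
apply: functional_extensionality => i; rewrite /= /affine_pt rmorph_sum.
apply: eq_bigr => l _; rewrite rmorphM cubic_basis_rat; congr (_ * cubic_basis _ _ _ _).
apply: functional_extensionality => j; rewrite Q2 divr1 hQ /affine_vec /=.
by elim/ord3P: j => /=; rewrite ?rmorph1.
Qed.

Lemma sing_model : anticanonical_model X b (iota \o sing_pt).
Proof.
exists (Egerm ord0); first exact: (Egerm_blowup MiM MMi N_size N_root N_min p_tr ord0).
exact: Egerm_amap.
Qed.

(** A rational point of the model may come from a point of X that is not rational, so the argument
    uses ratios of its coordinates. Where z != 0 the ratios 4/6 and 5/6 are the affine coordinates,
    hence in [F]; points on z = 0 off the centres map to the contracted point; over a centre the
    irrationality of theta_i leaves only the contracted point. *)
Lemma model_rational (Q : 'I_n -> F) : anticanonical_model X b (iota \o Q) ->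
  (exists P, proportional (affine_pt P) Q) \/ proportional sing_pt Q.
Proof.
case=> x Xx; have [P [P0 lx Px D]] := blowupP Xx.
move=> am; have [Qn _] := am.
have [f [V [c [ef f0 xV c0 [QE VE]]]]] := amap_val lx am.
pose v l := \sum_i Dm l i * Q i.
have vE l : iota (v l) = c * V l.
  by rewrite -VE rmorph_sum; apply: eq_bigr => i _; rewrite rmorphM.
have QvE i : Q i = \sum_l C i l * v l.
  apply: (fmorph_inj iota); rewrite -[LHS]/((iota \o Q) i) QE mulr_sumr rmorph_sum.
  by apply: eq_bigr => l _; rewrite rmorphM vE mulrCA.
have v_neq0 : exists l, v l != 0.
  case: (boolP [exists l, v l != 0]) => [/existsP[l]|]; first by exists l.
  rewrite negb_exists => /forallP v0; case: Qn => i /=; rewrite QvE big1 ?rmorph0 ?eqxx // => l _.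
  by have := v0 l; rewrite negbK => /eqP->; rewrite mulr0.
have to_sing : (forall l, l != inord 0 -> v l = 0) -> proportional sing_pt Q.
  move=> v0; exists (v (inord 0)).
    by case: v_neq0 => l; case: (eqVneq l (inord 0)) => [->//|/v0->]; rewrite eqxx.
  move=> i; rewrite QvE (bigD1 (inord 0)) //= big1 ?addr0 1?mulrC // => l /v0->.
  by rewrite mulr0.
case: D => [[nc xE]|[t [e [cP _ _ _ _]]]]; last first.
  right; have [i [V1 V2 V4 V5 V6]] := center_val lx Px P0 cP xV.
  (* Otherwise the ratio of the coordinates 2 and 3 would be theta_i and lie in [F]. *)
  have v3 : v (inord 3) = 0.
    apply/eqP/negPn/negP => v3; case/negP: (theta_irr N_size N_min i (v (inord 2) / v (inord 3))).
    apply/eqP; rewrite fmorph_div !vE V2 mulrCA mulfK //.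
    by rewrite -vE fmorph_eq0.
  have V3 : V (inord 3) = 0 by apply: (mulfI c0); rewrite -vE v3 rmorph0 mulr0.
  apply: to_sing => l l0; apply: (fmorph_inj iota); rewrite vE rmorph0.
  apply/eqP; rewrite mulf_eq0 (negPf c0) /=; apply/eqP.
  elim/ord7P: l l0 => k lk; case: k lk => [|k lk _]; first by rewrite eqxx.
  case: k lk => [_|k lk]; first by rewrite V1 V3 mulr0.
  case: k lk => [_|k lk]; first by rewrite V2 V3 mulr0.
  case: k lk => [_|k lk]; first exact: V3.
  case: k lk => [_|k lk]; first exact: V4.
  case: k lk => [_|k lk]; first exact: V5.
  by case: k lk.
have [k k0] : exists k, tr P k != 0 /\ (tr P ord_max != 0 -> k = ord_max).
  case: (eqVneq (tr P ord_max) 0) => [z0|z0]; last by exists ord_max.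
  by have [k k0] := nonzero_tr iota MiM P0; exists k; split.
case: k0 => k0 kE; rewrite xE in ef xV lx.
have [mu mu0 xV'] := plane_val k0 ef f0.
have VmuE l : V l = mu * cbL (fun j => tr P j / tr P k) l by apply: (lg_fun lx (xV l)).
case: (eqVneq (tr P ord_max) 0) => [z0|z0].
  right; apply: to_sing => l l0; apply: (fmorph_inj iota); rewrite vE VmuE rmorph0.
  by rewrite cubic_basis0 ?mulr0 // z0 mul0r.
left; have {}kE := kE z0; rewrite kE in VmuE.
have V6 : V (inord 6) = mu by rewrite VmuE /cubic_basis inordK //= divff // expr1n mulr1.
have V4 : V (inord 4) = mu * (tr P ord0 / tr P ord_max).
  by rewrite VmuE /cubic_basis inordK //= divff // expr1n mul1r.
have V5 : V (inord 5) = mu * (tr P o1 / tr P ord_max).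
  by rewrite VmuE /cubic_basis inordK //= divff // expr1n mul1r.
have v60 : v (inord 6) != 0 by rewrite -(fmorph_eq0 iota) vE V6 mulf_neq0.
pose a0 := v (inord 4) / v (inord 6); pose a1 := v (inord 5) / v (inord 6).
have a0E : iota a0 = tr P ord0 / tr P ord_max.
  by rewrite fmorph_div !vE V6 V4 mulrA -[X in _ / X]mulr1 mulrAC mulr1 mulfV ?mul1r ?mulf_neq0.
have a1E : iota a1 = tr P o1 / tr P ord_max.
  by rewrite fmorph_div !vE V6 V5 mulrA -[X in _ / X]mulr1 mulrAC mulr1 mulfV ?mul1r ?mulf_neq0.
exists (a0, a1), (v (inord 6)) => // i.
rewrite QvE /affine_pt mulr_sumr; apply: eq_bigr => l _; rewrite mulrCA; congr (_ * _).
apply: (fmorph_inj iota); rewrite rmorphM cubic_basis_rat !vE V6 VmuE mulrA; congr (_ * cubic_basis _ _ _ _).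
apply: functional_extensionality => j.
by elim/ord3P: j; rewrite /affine_vec /= ?a0E ?a1E // divff // rmorph1.
Qed.

Variable D : cartier iota b (anticanonical_model X b).
Hypothesis D_anti : is_anticanonical_divisor D.

Lemma cartier_pullback x P g : local_germ iota x -> anticanonical_map b x P ->
  regular (proj_germ iota b P) g -> regular x g.
Proof.
move=> lx [_ [f [Q [_ xQ PQ]]]] [a]; exists a.
exact: (proj_germ_sub lx PQ xQ).
Qed.

(** Sections on the model pull back to X, since the pullback of D is -K_X. Through
    [cubic_of_regular] this gives the easy inclusion [cartier_sections_cubic]. *)
Lemma cartier_section_regular x P f g : X x -> local_germ iota x -> anticanonical_map b x P ->
  anticanonical_eq x f -> cartier_sections D g -> regular x (g * f).
Proof.
move=> Xx lx am ef hg.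
have [i oi] := cartier_cover D (ex_intro2 _ _ x Xx am).
have [a ra ->] : exists2 a, regular x a & f = a * cartier_fun D i.
  have [_ gen] := D_anti Xx am oi; by apply: gen; case: ef.
rewrite mulrCA; apply: (reg_mul lx) => //.
exact: (cartier_pullback lx am (hg _ _ oi)).
Qed.

Lemma cartier_sections_cubic g : cartier_sections D g -> cubic_space g.
Proof.
move=> hg; apply: (cubic_of_regular L_alg MiM MMi N_size N_monic N_root N_min p_tr).
  move=> P k P0 nc k0.
  exact: (cartier_section_regular (blowup_plane iota P0 nc) (plane_germ_local iota P)
    (plane_amap P0 nc k0) (plane_anticanonical MiM MMi k0) hg).
exists ord0; rewrite -mulrA.
exact: (cartier_section_regular (Egerm_blowup MiM MMi N_size N_root N_min p_tr ord0)
  (Egerm_local iota theta MMi N_size ord0) (Egerm_amap ord0)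
  (Egerm_anticanonical iota theta MiM MMi N_size ord0) hg).
Qed.

End Model.

(** * The Cartier divisor at the singular point *)

Section RatioIdentities.
Variable R : fieldType.
Implicit Types a b c n : R.
Lemma ratio_id1 a b c : b != 0 -> c != 0 -> (c * (a * b)) / (c * b ^+ 2) = a / b.
Proof. by move=> b0 c0; field; rewrite b0 c0. Qed.
Lemma ratio_id2 b c : b != 0 -> c != 0 -> (c ^+ 2 * b) / (c * b ^+ 2) = c / b.
Proof. by move=> b0 c0; field; rewrite b0 c0. Qed.
Lemma ratio_id3 a c : c != 0 -> (c ^+ 2 * a) / c ^+ 3 = a / c.
Proof. by move=> c0; field. Qed.
Lemma ratio_id4 b c n : b != 0 -> c != 0 -> (n * b ^+ 3) / (c * b ^+ 2) = n / (c / b).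
Proof. by move=> b0 c0; field; rewrite b0 c0. Qed.
Lemma ratio_id5 b c n : b != 0 -> n != 0 -> (c * b ^+ 2) / (n * b ^+ 3) = c / b / n.
Proof. by move=> b0 c0; field; rewrite b0 c0. Qed.
Lemma ratio_id6 a b c n : b != 0 -> n != 0 ->
  (c * (a * b)) / (n * b ^+ 3) = a / b * (c / b / n).
Proof. by move=> b0 c0; field; rewrite b0 c0. Qed.
Lemma ratio_id7 a b c n : b != 0 -> n != 0 ->
  (c * a ^+ 2) / (n * b ^+ 3) = (a / b) ^+ 2 * (c / b / n).
Proof. by move=> b0 c0; field; rewrite b0 c0. Qed.
Lemma cancel_frac a b c : c != 0 -> (c * a) / (c * b) = a / b.
Proof. by move=> c0; rewrite -mulf_div divff // mul1r. Qed.
End RatioIdentities.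

Section CartierConverse.
Variables (F : finFieldType) (L : closedFieldType) (iota : {rmorphism F -> L}).
Hypothesis L_alg : forall a : L, algebraicOver iota a.
Variables (M Mi : 'M[F]_3) (p : 'I_3 -> 'I_3 -> L) (N : {poly F}) (theta : 'I_3 -> L).
Hypotheses (MiM : Mi *m M = 1%:M) (MMi : M *m Mi = 1%:M).
Hypotheses (N_size : size N = 4%N) (N_monic : N`_3 = 1).
Hypothesis N_root : forall t, root (map_poly iota N) t <-> exists i, t = theta i.
Hypothesis N_min : forall (G : {poly F}) i, root (map_poly iota G) (theta i) -> N %| G.
Hypothesis p_tr : forall i, [/\ tr iota M (p i) ord_max = 0, tr iota M (p i) o1 != 0
  & tr iota M (p i) ord0 = theta i * tr iota M (p i) o1].
Local Notation K := (ratfun F).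
Local Notation kc := (@ratfun_const F).
Local Notation gp := (gp M).
Local Notation tr := (tr iota M).
Local Notation TT := (TT M).
Local Notation ZZ := (ZZ M).
Local Notation NT := (NT M N).
Local Notation ww := (ww M N).
Local Notation X := (blowup iota p).
Local Notation cubic_space := (cubic_space M N).
Local Notation bV := (bV M N).
Local Notation cbL := (cubic_basis N iota).
Implicit Types (f g h s : K) (x y : germ F L).

Variables (n : nat) (b : 'I_n -> K) (C : 'I_n -> 'I_7 -> F) (Dm : 'I_7 -> 'I_n -> F).
Hypothesis bE : forall i, b i = \sum_l kc (C i l) * bV l.
Hypothesis bVE : forall l, bV l = \sum_i kc (Dm l i) * b i.

Local Notation sing := (sing iota C).

Lemma model_germ_local x P : local_germ iota x -> anticanonical_map b x P ->
  local_germ iota (proj_germ iota b P).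
Proof.
move=> lx [_ [f [Q [_ xQ PQ]]]]; apply: proj_germ_local; first exact: (proj_germ_den lx PQ xQ).
move=> d H hH H0; have [c c0 PE] := PQ.
have -> : mmap iota P H = mmap iota Q H * c ^+ d.
  by rewrite -(mmap_scale iota _ _ hH); apply: eq_mmap => // i; rewrite PE mulrC.
have := lg_mmap lx H xQ; rewrite (mmap_scale kc _ _ hH) H0 mul0r => h.
by rewrite (lg_fun lx h (lg0 lx)) mul0r.
Qed.

Lemma model_germ_sub x P : local_germ iota x -> anticanonical_map b x P ->
  forall f a, proj_germ iota b P f a -> x f a.
Proof. by move=> lx [_ [f [Q [_ xQ PQ]]]]; apply: (proj_germ_sub lx PQ xQ). Qed.

Lemma amap_proportional x P Q : anticanonical_map b x P -> proportional P Q ->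
  anticanonical_map b x Q.
Proof.
move=> [[j Pj] [f [R [ef xR [c c0 PE]]]]] [d d0 QE]; split.
  by exists j; rewrite QE mulf_neq0.
exists f, R; split=> //; exists (d * c); first by rewrite mulf_neq0.
by move=> i; rewrite QE PE mulrA.
Qed.

Lemma basis_ratio P V c l l' : c != 0 ->
  (forall l, \sum_i iota (Dm l i) * P i = c * V l) -> V l' != 0 ->
  proj_germ iota b P (bV l / bV l') (V l / V l').
Proof.
move=> c0 VE Vl'.
have h : \sum_i iota (Dm l' i) * P i != 0 by rewrite VE mulf_neq0.
have := proj_germ_linear b (Dm l) h; rewrite -!bVE !VE.
by rewrite -mulf_div divff // mul1r.
Qed.

Lemma basis_V_ratios : [/\ bV (inord 2) / bV (inord 3) = TT, bV (inord 5) / bV (inord 3) = ZZ,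
  bV (inord 4) / bV (inord 6) = gp ord0 / gp ord_max,
  bV (inord 5) / bV (inord 6) = gp o1 / gp ord_max &
  bV (inord 0) / bV (inord 3) = NT / ZZ].
Proof.
have g1 := gp_neq0 iota MMi o1; have g2 := gp_neq0 iota MMi ord_max.
rewrite (bV_eq0 iota MMi N_size N_monic) /bV /cubic_basis !inordK //= /TT /ZZ.
by split; [exact: ratio_id1 | exact: ratio_id2 | exact: ratio_id3 | exact: ratio_id3 | exact: ratio_id4].
Qed.

Lemma basis_V_ratios0 : [/\ bV (inord 3) / bV (inord 0) = ww,
  bV (inord 2) / bV (inord 0) = TT * ww & bV (inord 1) / bV (inord 0) = TT ^+ 2 * ww].
Proof.
have g1 := gp_neq0 iota MMi o1; have n0 := NT_neq0 iota MMi N_size.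
rewrite (bV_eq0 iota MMi N_size N_monic) /bV /cubic_basis !inordK //= /ww /TT /ZZ.
by split; [exact: ratio_id5 | exact: ratio_id6 | exact: ratio_id7].
Qed.

(** The ratios 4/6 and 5/6 of basis cubics are the affine coordinates on z != 0, so these
    coordinates are regular on the model and the plane ring is contained in its local ring. *)
Lemma smooth_plane_germ_sub P Q V c y : local_germ iota y -> c != 0 ->
  (forall l, \sum_i iota (Dm l i) * P i = c * V l) -> y = proj_germ iota b P ->
  (exists2 mu, mu != 0 & forall l, V l = mu * cbL (fun j => tr Q j / tr Q ord_max) l) ->
  tr Q ord_max != 0 ->
  forall f a, plane_germ iota Q f a -> y f a.
Proof.
move=> ly c0 VE yE [mu mu0 Vmu] z0; apply: (plane_sub_chart MiM ly z0).
have [_ _ r4 r5 _] := basis_V_ratios.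
have V6 : V (inord 6) = mu by rewrite Vmu /cubic_basis inordK //= divff // expr1n mulr1.
have V60 : V (inord 6) != 0 by rewrite V6.
have h4 := basis_ratio (inord 4) c0 VE V60; have h5 := basis_ratio (inord 5) c0 VE V60.
rewrite -yE r4 in h4; rewrite -yE r5 in h5.
have E4 : V (inord 4) / V (inord 6) = tr Q ord0 / tr Q ord_max.
  by rewrite V6 Vmu /cubic_basis inordK //= divff // expr1n mul1r mulrC mulKf.
have E5 : V (inord 5) / V (inord 6) = tr Q o1 / tr Q ord_max.
  by rewrite V6 Vmu /cubic_basis inordK //= divff // expr1n mul1r mulrC mulKf.
apply: ord3P; [by rewrite -E4|by rewrite -E5|].
by rewrite (divff (gp_neq0 iota MMi _)) divff //; apply: lg1 ly.
Qed.

(** Over a centre, V 3 != 0 means that the point is off the strict transform of the line. The ratios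
    2/3, 5/3 and 0/3 of basis cubics show that T, Z and N(T)/Z are regular on the model. These
    generate the chart with t = Z, and any other t differs from Z by a unit there. *)
Lemma center_germ_sub P Q x V c t e f : nonzero Q -> center p Q ->
  (forall l, x (bV l * f) (V l)) ->
  center_ideal iota p Q t -> t != 0 ->
  let B := blowup_chart (plane_germ iota Q) (center_ideal iota p Q) t in
  chart_point (plane_germ iota Q) B e -> x = chart_germ B e ->
  anticanonical_map b x P -> c != 0 ->
  (forall l, \sum_i iota (Dm l i) * P i = c * V l) -> V (inord 3) != 0 ->
  forall h r, x h r -> proj_germ iota b P h r.
Proof.
move=> Q0 cQ xV It t0 B ev_e xE am c0 VE V3.
have lv := plane_germ_local iota Q.
have lx : local_germ iota x by rewrite xE; apply: (chart_germ_local lv ev_e).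
have vx : forall f a, plane_germ iota Q f a -> x f a.
  by rewrite xE; apply: (chart_germ_base_sub lv ev_e).
have ly := model_germ_local lx am; have yx := model_germ_sub lx am.
set y := proj_germ iota b P in ly yx *.
have [i [Q1 QE]] := center_germ MiM MMi p_tr Q0 cQ.
have xT := vx TT (theta i); rewrite QE in xT; have {}xT := xT (aff_germ_u _ _ _ _ _).
have xZ := vx ZZ 0; rewrite QE in xZ; have {}xZ := xZ (aff_germ_v _ _ _ _ _).
have [r2 r5 _ _ r0] := basis_V_ratios.
have yT : y TT (theta i).
  have h := basis_ratio (inord 2) c0 VE V3; rewrite r2 in h.
  by rewrite (lg_fun lx xT (yx _ _ h)).
have yZ : y ZZ 0.
  have h := basis_ratio (inord 5) c0 VE V3; rewrite r5 in h.
  by rewrite (lg_fun lx xZ (yx _ _ h)).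
have [nu yN] : exists nu, y (NT / ZZ) nu.
  by exists (V (inord 0) / V (inord 3)); rewrite -r0; apply: (basis_ratio _ c0 VE V3).
have vy : forall f a, plane_germ iota Q f a -> y f a.
  by rewrite QE; apply: (aff_germ_sub ly).
have Z0 : ZZ != 0.
  by rewrite /ZZ mulf_neq0 ?invr_neq0 ?(gp_neq0 iota MMi).
have I_gen a' : center_ideal iota p Q a' -> exists al be al0 be0,
    [/\ plane_germ iota Q al al0, plane_germ iota Q be be0 & a' = al * ZZ + be * NT].
  move=> [u vu /(_ cQ) u0]; rewrite u0 QE in vu.
  have [al [be [[al0 ha] [be0 hb] ->]]] := TZ_gen_ideal MMi N_min vu.
  by exists al, be, al0, be0; rewrite QE.
have quotE a' al be : a' = al * ZZ + be * NT -> a' / ZZ = al + be * (NT / ZZ).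
  by move=> ->; rewrite mulrDl mulfK // mulrA.
have [al [be [al0 [be0 [hal hbe tE]]]]] := I_gen _ It.
have ytZ : y (t / ZZ) (al0 + be0 * nu).
  rewrite (quotE _ _ _ tE); apply: (lg_add ly); first exact: vy.
  by apply: (lg_mul ly) => //; apply: vy.
have IZ : center_ideal iota p Q ZZ by exists 0 => //; rewrite QE; apply: aff_germ_v.
have xZt : x (ZZ / t) (e (ZZ / t)).
  by rewrite xE; apply: (chart_germ_base lv ev_e); apply: Chart_quot.
have tau0 : al0 + be0 * nu != 0.
  have := lg_mul lx (yx _ _ ytZ) xZt; rewrite mulrA divfK // divff // => h.
  have := lg_fun lx h (lg1 lx) => h1.
  by apply: contraTneq (oner_neq0 L) => t00; rewrite -h1 t00 mul0r eqxx.
have reg : forall g, B g -> regular y g.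
  apply: (chart_regular ly vy) => a' /I_gen[al' [be' [al'0 [be'0 [ha' hb' aE]]]]].
  exists ((al'0 + be'0 * nu) / (al0 + be0 * nu)).
  have -> : a' / t = (a' / ZZ) / (t / ZZ) by rewrite field_div_div.
  apply: (lg_div ly) => //; rewrite (quotE _ _ _ aE); apply: (lg_add ly); first exact: vy.
  by apply: (lg_mul ly) => //; apply: vy.
move=> h r; rewrite {1}xE => -[g [k [Bg Bk k0 -> ->]]].
have val g' : B g' -> y g' (e g').
  move=> Bg'; have [u yu] := reg _ Bg'.
  have xg : x g' (e g') by rewrite xE; apply: (chart_germ_base lv ev_e).
  by rewrite (lg_fun lx xg (yx _ _ yu)).
by apply: (lg_div ly) => //; apply: val.
Qed.

Lemma aff_TZ_sub_Tw al f a : aff_germ iota TT ZZ al 0 f a -> aff_germ iota TT ww al 0 f a.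
Proof.
have lE := aff_germ_local iota (Tw_indep iota MMi N_size) al 0.
apply: (aff_germ_sub lE); first exact: aff_germ_u.
have := lg_mul lE (aff_germ_v iota TT ww al 0) (lg_ev1 lE N (aff_germ_u iota TT ww al 0)).
by rewrite mul0r -/NT -(ZwE iota MMi N_size).
Qed.

Lemma monomial_weight y i m : local_germ iota y -> y ww 0 -> y (TT * ww) 0 ->
  y (TT ^+ 2 * ww) 0 -> (i <= 2 * m)%N -> y (TT ^+ i * ww ^+ m) ((m == 0%N)%:R).
Proof.
move=> ly y0 y1 y2; elim: m i => [|m IH] i.
  by rewrite muln0 leqn0 => /eqP->; rewrite !expr0 mulr1; apply: lg1 ly.
case: i => [_|[|i]] /=.
- rewrite expr0 mul1r exprS; have := lg_mul ly y0 (IH 0%N isT).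
  by rewrite expr0 !mul1r mul0r.
- move=> _; rewrite expr1 exprS mulrA; have := lg_mul ly y1 (IH 0%N isT).
  by rewrite expr0 mul1r mul0r.
move=> h; have hi : (i <= 2 * m)%N by lia.
have := lg_mul ly y2 (IH i hi); rewrite mul0r.
have -> // : TT ^+ 2 * ww * (TT ^+ i * ww ^+ m) = TT ^+ i.+2 * ww ^+ m.+1.
by rewrite -[i.+2]/(2 + i)%N exprD [ww ^+ m.+1]exprS; ring.
Qed.

Lemma weight_regular y (A : {poly {poly F}}) : local_germ iota y -> y ww 0 -> y (TT * ww) 0 ->
  y (TT ^+ 2 * ww) 0 -> (forall m, size (A`_m)%R <= 2 * m + 1)%N ->
  y (ev2 kc TT ww A) (iota A`_0`_0).
Proof.
move=> ly y0 y1 y2 sA.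
have -> : iota A`_0`_0 = \sum_(m < (size A).+1) \sum_(i < size (A`_m)%R) iota A`_m`_i * (m == 0%N :> nat)%:R.
  rewrite big_ord_recl /= [X in _ + X]big1 ?addr0 => [|m _]; last first.
    by rewrite big1 // => i _; rewrite mulr0.
  rewrite -[LHS](ev1C iota 1) -(size1_polyC (sA 0%N)) ev1E.
  by apply: eq_bigr => i _; rewrite expr1n.
rewrite (ev2_small kc TT ww (leqnSn (size A))); apply: (lg_sum ly) => m _.
rewrite ev1E mulr_suml; apply: (lg_sum ly) => i _; rewrite -mulrA.
apply: (lg_mul ly); first exact: (lg_const ly).
apply: monomial_weight => //.
by have := sA m; have := ltn_ord i; rewrite addn1 => h1 h2; rewrite -ltnS (leq_trans h1).
Qed.

(* Normality of the model at its singular point: a function h that is a unit along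
   the contracted line is A / B in lowest terms in F[T, w], where A and B are nonzero
   constants along w = 0, and its value at infinity bounds their weights. *)
Lemma singular_regular y h : local_germ iota y -> y ww 0 -> y (TT * ww) 0 ->
  y (TT ^+ 2 * ww) 0 ->
  (forall al, exists2 a, a != 0 & aff_germ iota TT ww al 0 h a) ->
  regular (aff_germ iota (gp o1 / gp ord0) (gp ord_max / gp ord0) 0 0) h ->
  regular y h.
Proof.
move=> ly y0 y1 y2 hline [a0 [G [H [H0 hE _]]]].
have [A [B [B0 hAB low]]] := lowest_terms_ratfun (Tw_indep iota MMi N_size) L_alg
  (Tw_gen iota MiM MMi N_size) h.
have nz al : ev1 iota al A`_0 != 0 /\ ev1 iota al B`_0 != 0.
  have [a a_neq0 [G' [H' [H'0 hE' aE]]]] := hline al.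
  have [|E HE GE] := low G' H' _ hE'.
    by apply: contraNneq H'0 => ->; rewrite ev2_zero.
  rewrite -!(ev2_0 iota); split.
    by move: a_neq0; rewrite aE GE ev2M => /neq0_mull/neq0_mull.
  by move: H'0; rewrite HE ev2M => /neq0_mull.
(* Neither coefficient at w = 0 has a root in L, so both are nonzero constants. *)
have const (q : {poly F}) : (forall al, ev1 iota al q != 0) -> size q = 1%N.
  move=> hq; case: (eqVneq (size q) 1%N) => // s1.
  have /closed_rootP[al] : size (map_poly iota q) != 1 by rewrite size_map_poly.
  by rewrite /root -ev1_horner (negPf (hq al)).
have sA0 : size A`_0 = 1%N by apply: const => al; case: (nz al).
have sB0 : size B`_0 = 1%N by apply: const => al; case: (nz al).
have g0 := gp_neq0 iota MMi ord0; have g1 := gp_neq0 iota MMi o1.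
have T0 : TT != 0 by exact: (mulf_neq0 g0 (invr_neq0 g1)).
(* G/H is the expression of h at the point T = infinity of the line; [flip] with C = N rewrites it
   in T and w with a common factor T^J. *)
pose J := maxn (flip_deg G) (flip_deg H).
have eflip (Q : {poly {poly F}}) : (flip_deg Q <= J)%N -> ev2 kc TT ww (flip J N Q)
    = TT ^+ J * ev2 kc (gp o1 / gp ord0) (gp ord_max / gp ord0) Q.
  move=> hJ; rewrite (ev2_flip kc _ _ T0 hJ) -/NT -(ZwE iota MMi N_size).
  have -> : ZZ / TT = gp ord_max / gp ord0 by rewrite /TT /ZZ field_div_div.
  by have -> : TT^-1 = gp o1 / gp ord0 by rewrite /TT invf_div.
have hG : (flip_deg G <= J)%N by rewrite leq_maxl.
have hH : (flip_deg H <= J)%N by rewrite leq_maxr.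
have H00 : H`_0`_0 != 0.
  apply: contraNneq H0 => h0; rewrite ev2_0 ev1_horner horner_coef0 coef_map /=.
  by rewrite h0 rmorph0.
have sH0 := size_flip0 N hH H00.
have [||E HE GE] := low (flip J N G) (flip J N H).
- by apply: contra_eqN sH0 => /eqP->; rewrite coef0 size_poly0.
- rewrite (eflip _ hG) (eflip _ hH) hE; apply/esym.
  exact: (cancel_frac _ _ (expf_neq0 J T0)).
(* At w = 0 the flipped denominator has degree exactly J and [B] is constant, so the common factor
   [E] already has degree at least J. This leaves no positive weight for [A] and [B]. *)
have sE0 : (J < size (E`_0)%R)%N.
  have e0 : (B * E)`_0 = B`_0 * E`_0 by rewrite coefM big_ord_recl big_ord0 addr0.
  have := size_polyMleq B`_0 E`_0; rewrite -e0 -HE sH0 sB0.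
  by move: (size _) => k; rewrite add1n.
have bound (Q : {poly {poly F}}) m : (flip_deg Q <= J)%N ->
    (size ((flip J N Q)`_m)%R <= J + 2 * m + 1)%N.
  move=> hJ; case: (eqVneq (flip J N Q)`_m 0) => [->|ne]; first by rewrite size_poly0.
  have := size_flip (s := 3) hJ (eq_leq N_size) ne.
  by move: (size _) => k; lia.
have wA : forall m, (size (A`_m)%R <= 2 * m + 1)%N.
  by apply: (weight_factor sE0) => m; rewrite -GE; apply: bound.
have wB : forall m, (size (B`_m)%R <= 2 * m + 1)%N.
  by apply: (weight_factor sE0) => m; rewrite -HE; apply: bound.
have B00 : iota B`_0`_0 != 0.
  rewrite fmorph_eq0; have := lead_coef_eq0 B`_0.
  by rewrite lead_coefE sB0 /= => ->; rewrite -size_poly_eq0 sB0.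
rewrite hAB; exists (iota A`_0`_0 / iota B`_0`_0).
by apply: (lg_div ly) => //; apply: weight_regular.
Qed.
Variable D : cartier iota b (anticanonical_model X b).
Hypothesis D_anti : is_anticanonical_divisor D.

(** Writing g f_i as g / bV l times bV l f_i with V l != 0, the first factor is regular on the model
    as a quotient of linear forms. The second is regular at [x] because D pulls back to -K_X. It
    remains to descend this from X to the model, by equality of local rings off the contracted point
    and by normality at it. *)
Lemma cubic_cartier_sections g : cubic_space g -> cartier_sections D g.
Proof.
move=> gV i P oi; have [x Xx am] := cartier_sub oi.
have [Q [Q0 lx Qx Dx]] := blowupP Xx.
have [f [V [c [ef f0 xV c0 [PE VE]]]]] := amap_val bE bVE lx am.
have ly := model_germ_local lx am; have yx := model_germ_sub lx am.
set y := proj_germ iota b P in ly yx *.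
have ratio l : V l != 0 -> regular y (g / bV l).
  case: gV => ga ->; move=> Vl; rewrite mulr_suml; apply: (reg_sum ly) => l' _.
  rewrite -mulrA; apply: (reg_mul ly); first exact: (reg_const ly).
  by exists (V l' / V l); apply: (basis_ratio _ c0 VE).
have bVn l : V l != 0 -> bV l != 0.
  by move=> Vl; have := lg_neq0 lx (xV l) Vl; apply: neq0_mull.
have fin l : V l != 0 -> regular y (bV l * cartier_fun D i) -> regular y (g * cartier_fun D i).
  move=> Vl h; have -> : g * cartier_fun D i = g / bV l * (bV l * cartier_fun D i).
    by rewrite mulrA divfK ?bVn.
  by apply: (reg_mul ly) => //; apply: ratio.
have xreg l : regular x (bV l * cartier_fun D i).
  have [_ gen] := ef; have := D_anti Xx am oi; case=> /gen[a ra ->] _.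
  by rewrite mulrCA; apply: (reg_mul lx) => //; exists (V l).
(* A nonzero coordinate other than the one of index 0 means that P is not the contracted point; the
   local ring of the model then contains that of [x]. *)
case: (boolP [exists l, (l != inord 0) && (V l != 0)]) => [/existsP[l /andP[l0 Vl]]|].
  apply: (fin l Vl); have [r xr] := xreg l; exists r.
  case: Dx => [[nc xE]|[t [e [cQ It t0 ev_e xE]]]].
    have [k k0] := nonzero_tr iota MiM Q0; rewrite xE in ef xV lx xr.
    have z0 : tr Q ord_max != 0.
      apply: contraNneq Vl => z0; have [mu _ xV'] := plane_val N MiM MMi k0 ef f0.
      by rewrite (lg_fun lx (xV l) (xV' l)) cubic_basis0 ?mulr0 // z0 mul0r.
    have [mu mu0 xV'] := plane_val N MiM MMi z0 ef f0.
    apply: (smooth_plane_germ_sub ly c0 VE erefl _ z0 xr).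
    by exists mu => // l'; apply: (lg_fun lx (xV l')).
  apply: (center_germ_sub Q0 cQ xV It t0 ev_e xE am c0 VE _ xr).
  have [j [V1 V2 V4 V5 V6]] := center_val MiM MMi p_tr lx Qx Q0 cQ xV.
  apply: contraNneq Vl => V3.
  elim/ord7P: l l0 {xr} => k lk; case: k lk => [|k lk _]; first by rewrite eqxx.
  case: k lk => [_|k lk]; first by rewrite V1 V3 mulr0.
  case: k lk => [_|k lk]; first by rewrite V2 V3 mulr0.
  case: k lk => [_|k lk]; first by rewrite V3.
  case: k lk => [_|k lk]; first by rewrite V4.
  case: k lk => [_|k lk]; first by rewrite V5.
  by case: k lk => [_|//]; rewrite V6.
rewrite negb_exists => /forallP hV.
have {}hV l : l != inord 0 -> V l = 0 by move=> l0; have := hV l; rewrite l0 negbK => /eqP.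
have V0 : V (inord 0) != 0.
  have [[j Pj] _] := am; apply: contraNneq Pj => V0.
  by rewrite PE big1 ?mulr0 // => l _; case: (eqVneq l (inord 0)) => [->|/hV->]; rewrite ?V0 mulr0.
have Psing : proportional sing P.
  exists (c * V (inord 0)); first exact: mulf_neq0.
  by move=> j; rewrite PE (sum_only0 iota C j hV) mulrA.
apply: (fin (inord 0) V0).
have [w3 w2 w1] := basis_V_ratios0.
have yl l : l != inord 0 -> y (bV l / bV (inord 0)) 0.
  by move=> l0; have := basis_ratio l c0 VE V0; rewrite (hV _ l0) mul0r.
have ne k : (0 < k < 7)%N -> inord k != inord 0 :> 'I_7.
  by case/andP=> k0 k7; apply/eqP => /(congr1 val); rewrite /= !inordK // => k00; rewrite k00 in k0.
have unit_at x' f' a' : X x' -> local_germ iota x' -> anticanonical_map b x' P ->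
    anticanonical_eq x' f' -> f' != 0 -> x' (bV (inord 0) * f') a' -> a' != 0 ->
    exists2 a, a != 0 & x' (bV (inord 0) * cartier_fun D i) a.
  move=> Xx' lx' am' ef' f'0 xa a0.
  have [a [a1 [xa1 a10 ->]]] := anticanonical_unit lx' ef' (D_anti Xx' am' oi) f'0.
  exists (a1 * a'); first exact: mulf_neq0.
  by rewrite mulrCA; apply: (lg_mul lx').
have line Q' k : nonzero Q' -> ~ center p Q' -> tr Q' ord_max = 0 -> tr Q' k != 0 ->
    exists2 a, a != 0 & plane_germ iota Q' (bV (inord 0) * cartier_fun D i) a.
  move=> Q'0 nc z0 k0; have lQ := plane_germ_local iota Q'.
  have gk : (gp k ^+ 3)^-1 != 0 by rewrite invr_neq0 ?expf_neq0 ?(gp_neq0 iota MMi).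
  have [mu mu0 xV'] := plane_val N MiM MMi k0 (plane_anticanonical MiM MMi k0) gk.
  apply: (unit_at _ _ _ (blowup_plane iota Q'0 nc) lQ _ (plane_anticanonical MiM MMi k0) gk (xV' (inord 0))).
    exact: (line_amap MiM MMi N_size N_monic N_root p_tr bE bVE Q'0 nc z0 k0 Psing).
  rewrite mulf_neq0 //.
  have [l] := cbL_nonzero MiM N_size N_monic N_root p_tr k0 Q'0 nc.
  case: (eqVneq l (inord 0)) => [->//|l0].
  by rewrite cubic_basis0 ?eqxx // z0 mul0r.
(* Every point of the strict transform of the line maps to P, so bV 0 times the local equation is a
   unit at each of them: the points [Egerm j] for T = theta_j, points of the plane for the other
   finite T, and finally the point T = infinity. *)
apply: (singular_regular ly).
- by rewrite -w3; apply: yl; apply: ne.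
- by rewrite -w2; apply: yl; apply: ne.
- by rewrite -w1; apply: yl; apply: ne.
- move=> al; case: (classic (exists j, al = theta j)) => [[j ->]|nal].
    have lE := Egerm_local iota theta MMi N_size j.
    have eE := Egerm_anticanonical iota theta MiM MMi N_size j.
    have gE : (gp o1 ^+ 3)^-1 / NT != 0.
      by apply: mulf_neq0; rewrite invr_neq0 ?expf_neq0 ?(gp_neq0 iota MMi) ?(NT_neq0 iota MMi N_size).
    have vE := Egerm_val iota theta MMi N_size N_monic j (inord 0); rewrite eqxx in vE.
    apply: (unit_at _ _ _ (Egerm_blowup MiM MMi N_size N_root N_min p_tr j) lE _ eE gE vE (oner_neq0 _)).
    apply: (amap_proportional _ Psing).
    exact: (Egerm_amap iota theta MiM MMi N_size N_monic bE bVE).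
  have [Q' Q'1 [Q'0 Q'2]] := chart_point_exists iota MMi c021 al 0.
  have k0 : tr Q' o1 != 0 by rewrite Q'1 oner_neq0.
  have Q'n : nonzero Q' by apply/(tr_nonzero iota MiM); exists o1.
  have nc : ~ center p Q'.
    by move/(centerP MiM p_tr Q'n); rewrite Q'0 Q'1 divr1 => -[_ _].
  have [a a0 ha] := line Q' o1 Q'n nc Q'2 k0; exists a => //.
  by apply: aff_TZ_sub_Tw; move: ha; rewrite (chart_germ_eq MiM MMi c021 k0) Q'0 Q'1 Q'2 !divr1.
have [Q' Q'1 [Q'0 Q'2]] := chart_point_exists iota MMi c120 0 0.
have k0 : tr Q' ord0 != 0 by rewrite Q'1 oner_neq0.
have Q'n : nonzero Q' by apply/(tr_nonzero iota MiM); exists ord0.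
have nc : ~ center p Q'.
  by move/(centerP MiM p_tr Q'n); rewrite Q'0 eqxx => -[].
have [a a0 ha] := line Q' ord0 Q'n nc Q'2 k0; exists a => //.
by move: ha; rewrite (chart_germ_eq MiM MMi c120 k0) Q'0 Q'1 Q'2 !mul0r.
Qed.

End CartierConverse.

(** * Rational points and the evaluation code *)

Lemma mul_div_cancel (R : fieldType) (a b : R) : a != 0 -> a * b / a = b.
Proof. by move=> a0; rewrite mulrAC mulfV // mul1r. Qed.

Section Code.
Variables (F : finFieldType) (L : closedFieldType) (iota : {rmorphism F -> L}).
Hypothesis L_alg : forall a : L, algebraicOver iota a.
Variables (M Mi : 'M[F]_3) (p : 'I_3 -> 'I_3 -> L) (N : {poly F}) (theta : 'I_3 -> L).
Hypotheses (MiM : Mi *m M = 1%:M) (MMi : M *m Mi = 1%:M).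
Hypotheses (N_size : size N = 4%N) (N_monic : N`_3 = 1).
Hypothesis N_root : forall t, root (map_poly iota N) t <-> exists i, t = theta i.
Hypothesis N_min : forall (G : {poly F}) i, root (map_poly iota G) (theta i) -> N %| G.
Hypothesis p_tr : forall i, [/\ tr iota M (p i) ord_max = 0, tr iota M (p i) o1 != 0
  & tr iota M (p i) ord0 = theta i * tr iota M (p i) o1].
Local Notation K := (ratfun F).
Local Notation kc := (@ratfun_const F).
Local Notation gp := (gp M).
Local Notation X := (blowup iota p).
Local Notation bV := (bV M N).
Implicit Types (f g h s : K) (x y : germ F L).

Lemma canonical_stalk_mul x a w : local_germ iota x -> regular x a ->
  canonical_stalk x w -> canonical_stalk x (a * w).
Proof.
move=> lx ra; elim=> [|c u v {}w rc ru rv _ IH]; first by rewrite mulr0; apply: Canonical0.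
by rewrite mulrDr mulrA; apply: CanonicalD => //; apply: (reg_mul lx).
Qed.

Lemma proj_ratfun_local n (b : 'I_n -> K) : (exists i, b i != 0) ->
  (forall l, proj_ratfun b (ratfun_var F l)) -> forall f, proj_ratfun b f.
Proof.
move=> _ hv; apply: ratfun_ind => //.
- move=> c; exists 0%N, c%:MP, 1; rewrite (rmorph1 (mmap kc b)) mmapC divr1.
  by rewrite oner_neq0 dhomog1 -[c%:MP]mulr1 mul_mpolyC dhomogZ ?dhomog1.
- move=> f g [d [G [H [hG hH H0 ->]]]] [d' [G' [H' [hG' hH' H'0 ->]]]].
  exists (d + d')%N, (G * H' + H * G'), (H * H'); rewrite !rmorphD !rmorphM; split.
  + by apply: rpredD; apply: dhomogM.
  + exact: dhomogM.
  + exact: (mulf_neq0 H0 H'0).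
  + exact: (add_fracs _ _ H0 H'0).
- move=> f g [d [G [H [hG hH H0 ->]]]] [d' [G' [H' [hG' hH' H'0 ->]]]].
  exists (d + d')%N, (G * G'), (H * H'); rewrite !rmorphM; split.
  + exact: dhomogM.
  + exact: dhomogM.
  + exact: (mulf_neq0 H0 H'0).
  + exact: mulf_div.
move=> f f0 [d [G [H [hG hH H0 fE]]]]; exists d, H, G; rewrite fE invf_div.
split; [exact: hH | exact: hG | | reflexivity].
by apply: contraNneq f0 => G0; rewrite fE G0 mul0r.
Qed.

Lemma proj_ratfun_linear n (b : 'I_n -> K) (c e : 'I_n -> F) :
  \sum_i kc (e i) * b i != 0 ->
  proj_ratfun b ((\sum_i kc (c i) * b i) / (\sum_i kc (e i) * b i)).
Proof.
move=> e0; pose lin (c : 'I_n -> F) : {mpoly F[n]} := \sum_i c i *: 'X_i.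
have hlin c' : lin c' \is 1.-homog.
  by apply: rpred_sum => i _; apply: dhomogZ; rewrite dhomogX /= mdeg1.
have E c' : mmap kc b (lin c') = \sum_i kc (c' i) * b i.
  rewrite /lin raddf_sum; apply: eq_bigr => i _.
  by rewrite /= mmapZ mmapX mmap1U.
by exists 1%N, (lin c), (lin e); rewrite !E; split.
Qed.

Section BasisDivisor.

Local Notation S := (anticanonical_model X bV).

Lemma bV_neq0 i : bV i != 0.
Proof.
apply/eqP => bi0; have := bV_free iota MMi N_size N_monic (c := fun l => (l == i)%:R).
have -> : \sum_l kc ((l == i)%:R) * bV l = 0.
  rewrite (bigD1 i) //= bi0 mulr0 add0r big1 // => l li.
  by rewrite (negPf li) (rmorph0 kc) mul0r.
by move=> /(_ erefl i)/eqP; rewrite eqxx oner_eq0.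
Qed.

Definition delta (l l' : 'I_7) : F := (l == l')%:R.

Lemma sum_delta (V : 'I_7 -> K) l : V l = \sum_l' kc (delta l l') * V l'.
Proof.
rewrite (bigD1 l) //= /delta eqxx (rmorph1 kc) mul1r big1 ?addr0 // => l' ne.
by rewrite eq_sym (negPf ne) (rmorph0 kc) mul0r.
Qed.

Lemma bV_delta l : bV l = \sum_l' kc (delta l l') * bV l'.
Proof. exact: sum_delta. Qed.

(** The anticanonical map is birational: x and y are quotients of linear forms in the basis
    cubics. *)
Lemma bV_proj_ratfun f : proj_ratfun bV f.
Proof.
apply: proj_ratfun_local => [|l]; first by exists ord0; apply: bV_neq0.
have [l' hl] : exists l', ratfun_var F l = plane_generic F l'.
  case: l => [[|[|//]] lti].
    by exists ord0; congr ratfun_var; apply: val_inj.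
  by exists o1; congr ratfun_var; apply: val_inj.
have g2 := gp_neq0 iota MMi ord_max.
(* The coefficients of z^2 times a linear form with respect to the basis cubics. *)
pose row (r : 'I_3 -> F) : 'I_7 -> F := fun k =>
  nth 0 [:: 0; 0; 0; 0; r ord0; r o1; r ord_max] k.
have rowE r : \sum_k kc (row r k) * bV k = gp ord_max ^+ 2 * \sum_i kc (r i) * gp i.
  rewrite big_ord7 big_ord3 /row /bV /cubic_basis !inordK //= (rmorph0 kc) !mul0r !add0r.
  by move: (gp ord0) (gp o1) (gp ord_max) (kc _) (kc _) (kc _) => a c d e f' g; ring.
have e2 := generic_gp MiM ord_max.
have := proj_ratfun_linear (b := bV) (row (Mi l')) (e := row (Mi ord_max)).
rewrite !rowE -!(generic_gp MiM) /= mulr1 hl => /(_ (expf_neq0 2 g2)).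
by rewrite (mul_div_cancel _ (expf_neq0 2 g2)).
Qed.

Lemma S_coord P : S P -> exists i, P i != 0.
Proof. by case=> x _ []. Qed.

Lemma open_coord i P : S P /\ P i != 0 -> exists (d : nat) (G : {mpoly F[7]}),
  [/\ G \is d.-homog, mmap iota P G != 0 &
      forall Q, S Q -> mmap iota Q G != 0 -> S Q /\ Q i != 0].
Proof.
case=> SP Pi; exists 1%N, 'X_i; rewrite mmapX mmap1U dhomogX /= mdeg1 eqxx.
by split=> // Q SQ; rewrite mmapX mmap1U.
Qed.

Lemma compat_coord i j P : S P /\ P i != 0 -> S P /\ P j != 0 ->
  regular (proj_germ iota bV P) ((bV i)^-1 / (bV j)^-1).
Proof.
move=> [_ Pi] _; exists (P j / P i), 1%N, 'X_j, 'X_i.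
rewrite !mmapX !mmap1U invrK mulrC !dhomogX /= !mdeg1; split=> //.
Qed.

(** The class of hyperplane sections: on the open set where the i-th coordinate is nonzero, the
    local equation is the inverse of the i-th section. *)
Definition basis_divisor : cartier iota bV S := @Cartier F L iota 7 bV S 'I_7
  (fun i P => S P /\ P i != 0) (fun i => (bV i)^-1)
  (fun i P => @proj1 _ _) open_coord
  (fun P SP => let: ex_intro i Pi := S_coord SP in ex_intro _ i (conj SP Pi))
  (fun i => invr_neq0 (bV_neq0 i)) (fun i => bV_proj_ratfun _) compat_coord.

Lemma basis_divisor_anticanonical : is_anticanonical_divisor basis_divisor.
Proof.
move=> x P i Xx am [_ Pi] /=; have [Q [_ lx _ _]] := blowupP Xx.
have [f [V [c [ef f0 xV c0 [PE _]]]]] := amap_val bV_delta bV_delta lx am.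
have Vi : V i != 0.
  apply: contraNneq Pi => Vi0; rewrite PE big1 ?mulr0 // => l _; rewrite /delta.
  by case: eqP => [<-|_]; rewrite ?Vi0 ?rmorph0 ?mulr0 ?mul0r.
have b0 := bV_neq0 i.
have [cf gen] := ef; split.
  have -> : (bV i)^-1 = (bV i * f)^-1 * f by rewrite invfM -mulrA mulVf ?mulr1.
  apply: (canonical_stalk_mul lx _ cf); exists (V i)^-1; exact: (lg_inv lx).
move=> w /gen[a ra ->]; exists (a * (bV i * f)); last by rewrite -mulrA mulrAC mulfV ?mul1r.
by apply: (reg_mul lx) => //; exists (V i).
Qed.

Lemma bV_basis : basis_of_sections (sections X (@anticanonical_eq F L)) bV.
Proof.
have sP := sectionsP L_alg MiM MMi N_size N_monic N_root N_min p_tr.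
split.
- by move=> i; apply/sP; exists (delta i); apply: bV_delta.
- by move=> c; apply: (bV_free iota MMi N_size N_monic).
- by move=> s /sP.
Qed.

End BasisDivisor.

Variables (n : nat) (b : 'I_n -> K) (C : 'I_n -> 'I_7 -> F) (Dm : 'I_7 -> 'I_n -> F).
Hypothesis bE : forall i, b i = \sum_l kc (C i l) * bV l.
Hypothesis bVE : forall l, bV l = \sum_i kc (Dm l i) * b i.

Hypothesis DC : forall l l', \sum_i Dm l i * C i l' = (l == l')%:R.
Hypothesis CD : forall i j, \sum_l C i l * Dm l j = (i == j)%:R.

Local Notation S := (anticanonical_model X b).
Local Notation affine_pt := (affine_pt N C).
Local Notation sing_pt := (sing_pt C).

(** The index [None] is the contracted point, so that the index type has q^2 + 1 elements. *)
Definition model_pt (o : option (F * F)) : 'I_n -> F :=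
  if o is Some P then affine_pt P else sing_pt.

Definition model_vec (o : option (F * F)) (l : 'I_7) : F :=
  if o is Some P then cubic_basis N id (affine_vec P.1 P.2) l else (l == inord 0)%:R.

Lemma model_ptE o i : model_pt o i = \sum_l C i l * model_vec o l.
Proof.
case: o => [P|] //=; rewrite (bigD1 (inord 0)) //= eqxx mulr1 big1 ?addr0 // => l l0.
by rewrite (negPf l0) mulr0.
Qed.

Lemma model_vecE o l : model_vec o l = \sum_i Dm l i * model_pt o i.
Proof.
under eq_bigr => i _ do rewrite model_ptE mulr_sumr.
rewrite exchange_big /= (bigD1 l) //= [X in _ + X]big1 => [|l' ne].
  under eq_bigr => i _ do rewrite mulrA.
  by rewrite -mulr_suml DC eqxx mul1r addr0.
under eq_bigr => i _ do rewrite mulrA.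
by rewrite -mulr_suml DC eq_sym (negPf ne) mul0r.
Qed.

Lemma model_pt_model o : S (iota \o model_pt o).
Proof.
case: o => [P|]; first exact: (affine_model MiM MMi N_size N_monic N_root p_tr bE bVE).
exact: (sing_model MiM MMi N_size N_monic N_root N_min p_tr bE bVE).
Qed.

Lemma model_pt_all Q : S (iota \o Q) -> exists o, proportional (model_pt o) Q.
Proof.
move/(model_rational MiM MMi N_size N_min p_tr bE bVE) => [[P h]|h]; first by exists (Some P).
by exists None.
Qed.

Lemma model_pt_inj o o' : proportional (model_pt o) (model_pt o') -> o = o'.
Proof.
move=> [c c0 h].
have hv l : model_vec o' l = c * model_vec o l.
  by rewrite !model_vecE mulr_sumr; apply: eq_bigr => i _; rewrite h mulrCA.
have ne : (inord 6 == inord 0 :> 'I_7) = false by rewrite -val_eqE /= !inordK.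
case: o o' hv {h} => [[x y]|] [[x' y']|] hv //.
- have := hv (inord 6); have := hv (inord 5); have := hv (inord 4).
  rewrite /= /cubic_basis !inordK //= /affine_vec /= !expr1n !mul1r mulr1 => h4 h5 h6.
  by rewrite h4 h5 -h6 !mul1r.
- have := hv (inord 6); rewrite /= ne /cubic_basis inordK //= expr1n mulr1 => /esym/eqP.
  by rewrite (negPf c0).
- have := hv (inord 6); rewrite /= ne /cubic_basis inordK //= expr1n mulr0 => /eqP.
  by rewrite oner_eq0.
Qed.

Lemma proportional_refl (R : fieldType) m (P : 'I_m -> R) : proportional P P.
Proof. by exists 1; [exact: oner_neq0 | move=> i; rewrite mul1r]. Qed.

Lemma proportional_sym (R : fieldType) m (P Q : 'I_m -> R) : proportional P Q -> proportional Q P.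
Proof.
by move=> [c c0 h]; exists c^-1; [rewrite invr_neq0 | move=> i; rewrite h mulKf].
Qed.

Lemma proportional_trans (R : fieldType) m (P Q U : 'I_m -> R) :
  proportional P Q -> proportional Q U -> proportional P U.
Proof.
move=> [c c0 h] [d d0 h']; exists (d * c); first exact: mulf_neq0.
by move=> i; rewrite h' h mulrA.
Qed.

Definition card_pts := #|{: option (F * F)}|.

Lemma model_pt_enumerates :
  enumerates_rational_points iota S (fun j : 'I_card_pts => model_pt (enum_val j)).
Proof.
split.
- by move=> j; apply: model_pt_model.
- by move=> j k jk /model_pt_inj/enum_val_inj/eqP; rewrite (negPf jk).
- move=> Q /model_pt_all[o h]; exists (enum_rank o).
  by rewrite enum_rankK.
Qed.

Section Enumeration.
Variables (m : nat) (pt : 'I_m -> 'I_n -> F).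
Hypothesis pt_enum : enumerates_rational_points iota S pt.

Lemma enumeration_bijection : exists2 f : option (F * F) -> 'I_m, bijective f &
  forall o, proportional (pt (f o)) (model_pt o).
Proof.
have [ptS pt_inj pt_all] := pt_enum.
have [f hf] : exists f : option (F * F) -> 'I_m, forall o, proportional (pt (f o)) (model_pt o).
  apply: (@fin_all_exists _ (fun=> 'I_m) (fun o j => proportional (pt j) (model_pt o))) => o.
  by apply: pt_all; apply: model_pt_model.
have [g hg] : exists g : 'I_m -> option (F * F), forall j, proportional (model_pt (g j)) (pt j).
  apply: (@fin_all_exists _ (fun=> option (F * F)) (fun j o => proportional (model_pt o) (pt j))) => j.
  by apply: model_pt_all; apply: ptS.
exists f => //; exists g => [o|j].
  by apply: model_pt_inj; apply: (proportional_trans (hg (f o)) (hf o)).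
have h := proportional_trans (hf (g j)) (hg j).
by case: (eqVneq (f (g j)) j) => // /pt_inj/(_ h).
Qed.

Lemma enumeration_card : m = (#|F| ^ 2 + 1)%N.
Proof.
have [f bij_f _] := enumeration_bijection.
have := bij_eq_card bij_f; rewrite card_ord card_option card_prod => <-.
by rewrite expnS expn1 addn1.
Qed.

Lemma coef_neq0 (ga : 'I_n -> F) : (exists i, ga i != 0) ->
  exists l, \sum_i ga i * C i l != 0.
Proof.
case=> i gi; case: (boolP [exists l, \sum_i ga i * C i l != 0]) => [/existsP[l]|].
  by exists l.
rewrite negb_exists => /forallP h; case/eqP: gi.
transitivity (\sum_l (\sum_j ga j * C j l) * Dm l i).
  under eq_bigr => l _ do rewrite mulr_suml.
  rewrite exchange_big /= (bigD1 i) //= [X in _ + X]big1 => [|j ne].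
    under eq_bigr => l _ do rewrite -mulrA.
    by rewrite -mulr_sumr CD eqxx mulr1 addr0.
  under eq_bigr => l _ do rewrite -mulrA.
  by rewrite -mulr_sumr CD (negPf ne) mulr0.
by rewrite big1 // => l _; have := h l; rewrite negbK => /eqP->; rewrite mul0r.
Qed.

Lemma pair_model_pt (ga : 'I_n -> F) o : \sum_i ga i * model_pt o i =
  if o is Some P then cubic N`_0 N`_1 N`_2 (fun l => \sum_i ga i * C i l) P.1 P.2
  else \sum_i ga i * C i (inord 0).
Proof.
case: o => [[x y]|] //=; under eq_bigr => i _ do rewrite /affine_pt mulr_sumr.
rewrite exchange_big /=; under eq_bigr => l _.
  under eq_bigr => i _ do rewrite mulrA.
  rewrite -mulr_suml; over.
rewrite big_ord7 /cubic_basis !inordK //= /cubic /cubic_form /binary_form /affine_vec /=.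
by move: (\sum_i _) (\sum_i _) (\sum_i _) (\sum_i _) (\sum_i _) (\sum_i _) (\sum_i _) => *; ring.
Qed.

Local Notation zeros := (cubic_zeros N`_0 N`_1 N`_2).

Definition weight_zeros (ga : 'I_n -> F) := #|[set j | \sum_i ga i * pt j i == 0]|.

(** The affine points contribute the zeros of the cubic, and the contracted point contributes one
    more exactly when the coefficient of [N] is zero. *)
Lemma weight_zerosE (ga : 'I_n -> F) (c := fun l => \sum_i ga i * C i l) :
  weight_zeros ga = (#|zeros c| + (c (inord 0) == 0%R))%N.
Proof.
have [f bij_f hf] := enumeration_bijection; have f_inj := bij_inj bij_f.
have -> : weight_zeros ga = #|[set o | \sum_i ga i * model_pt o i == 0]|.
  rewrite -(card_imset _ f_inj); congr (#|pred_of_set _|).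
  apply/setP => j; have [g fK gK] := bij_f; rewrite inE -[j]gK mem_imset // inE.
  have [d d0 h] := hf (g j); rewrite [in RHS](eq_bigr (fun i => d * (ga i * pt (f (g j)) i))).
    by rewrite -mulr_sumr mulf_eq0 (negPf d0).
  by move=> i _; rewrite h mulrCA.
have -> : [set o | \sum_i ga i * model_pt o i == 0] =
   [set o | o \in [set Some P | P in zeros c]] :|:
   (if c (inord 0) == 0 then [set None] else set0).
  apply/setP => -[P|]; rewrite !inE pair_model_pt.
    rewrite mem_imset ?inE; last by move=> ? ? [].
    by case: ifP => _; rewrite !inE orbF.
  have -> : (None \in [set Some P | P in zeros c]) = false.
    by apply/negP => /imsetP[].
  by rewrite -/(c (inord 0)); case: ifP => h; rewrite !inE.
rewrite cardsU (_ : _ :&: _ = set0) ?cards0 ?subn0; last first.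
  apply/setP => -[P|]; rewrite !inE.
    by case: ifP; rewrite !inE ?andbF.
  by rewrite (_ : (None \in _) = false) //; apply/negP => /imsetP[].
congr addn; last by case: ifP; rewrite ?cards1 ?cards0.
have -> : [set o | o \in [set Some P | P in zeros c]]
   = [set Some P | P in zeros c] by apply/setP => o; rewrite inE.
by rewrite card_imset // => ? ? [].
Qed.

Lemma N_noroot_expanded (r : F) : r ^+ 3 + N`_2 * r ^+ 2 + N`_1 * r + N`_0 != 0.
Proof.
have := N_noroot N_size N_root N_min r.
by rewrite horner_coef N_size !big_ord_recr big_ord0 /= N_monic; apply: contraNneq => h;
  apply/eqP; rewrite -[RHS]h; ring.
Qed.

Lemma weight_zeros_le ga : (exists i, ga i != 0) -> (weight_zeros ga <= 2 * #|F| + 1)%N.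
Proof.
move/coef_neq0 => c0; rewrite weight_zerosE; case: eqP => [h|/eqP h].
  by rewrite leq_add2r; apply: card_zeros_quadric.
by rewrite addn0; apply: card_zeros_cubic => //; apply: N_noroot_expanded.
Qed.

Lemma weight_zeros_eq : exists2 ga, (exists i, ga i != 0) & weight_zeros ga = (2 * #|F| + 1)%N.
Proof.
have [c [c0 c1 hc]] := quadric_with_2q_zeros N`_0 N`_1 N`_2.
pose ga i := \sum_l c l * Dm l i.
have gaE l : \sum_i ga i * C i l = c l.
  under eq_bigr => i _ do rewrite mulr_suml.
  rewrite exchange_big /= (bigD1 l) //= [X in _ + X]big1 => [|l' ne].
    under eq_bigr => i _ do rewrite -mulrA.
    by rewrite -mulr_sumr DC eqxx mulr1 addr0.
  under eq_bigr => i _ do rewrite -mulrA.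
  by rewrite -mulr_sumr DC (negPf ne) mulr0.
exists ga; last first.
  rewrite weight_zerosE gaE c0 eqxx -hc; congr (#|pred_of_set _| + _)%N.
  by apply/setP => P; rewrite !inE /cubic !gaE.
case: (boolP [exists i, ga i != 0]) => [/existsP[i]|]; first by exists i.
rewrite negb_exists => /forallP h; case/eqP: c1; rewrite -gaE big1 // => i _.
by have := h i; rewrite negbK => /eqP->; rewrite mul0r.
Qed.

End Enumeration.

End Code.

(** * Evaluation at rational points and the parameters of the code *)

Section Evaluation.
Variables (F : finFieldType) (L : closedFieldType) (iota : {rmorphism F -> L}).
Hypothesis L_alg : forall a : L, algebraicOver iota a.
Variables (M Mi : 'M[F]_3) (p : 'I_3 -> 'I_3 -> L) (N : {poly F}) (theta : 'I_3 -> L).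
Hypotheses (MiM : Mi *m M = 1%:M) (MMi : M *m Mi = 1%:M).
Hypotheses (N_size : size N = 4%N) (N_monic : N`_3 = 1).
Hypothesis N_root : forall t, root (map_poly iota N) t <-> exists i, t = theta i.
Hypothesis N_min : forall (G : {poly F}) i, root (map_poly iota G) (theta i) -> N %| G.
Hypothesis p_tr : forall i, [/\ tr iota M (p i) ord_max = 0, tr iota M (p i) o1 != 0
  & tr iota M (p i) ord0 = theta i * tr iota M (p i) o1].
Local Notation K := (ratfun F).
Local Notation kc := (@ratfun_const F).
Local Notation X := (blowup iota p).
Local Notation cubic_space := (cubic_space M N).
Local Notation bV := (bV M N).
Implicit Types (f g h s : K) (x y : germ F L).

Variables (n : nat) (b : 'I_n -> K) (C : 'I_n -> 'I_7 -> F) (Dm : 'I_7 -> 'I_n -> F).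
Hypothesis bE : forall i, b i = \sum_l kc (C i l) * bV l.
Hypothesis bVE : forall l, bV l = \sum_i kc (Dm l i) * b i.

Hypothesis DC : forall l l', \sum_i Dm l i * C i l' = (l == l')%:R.
Hypothesis CD : forall i j, \sum_l C i l * Dm l j = (i == j)%:R.


Variable D : cartier iota b (anticanonical_model X b).
Hypothesis D_anti : is_anticanonical_divisor D.

Lemma proj_germ_rational (s : 'I_n -> K) (Q : 'I_n -> F) f a :
  proj_germ iota s (iota \o Q) f a -> exists c, a = iota c.
Proof.
case=> d [G [H [_ _ _ _ ->]]].
have E (W : {mpoly F[n]}) : mmap iota (iota \o Q) W = iota (mmap idfun Q W).
  by rewrite rmorph_mmap; apply: eq_mmap.
by exists (mmap idfun Q G / mmap idfun Q H); rewrite !E fmorph_div.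
Qed.

(** Pick j with Q j != 0. The section b j times the local equation has a nonzero value at Q, which
    lies in [F] because Q is rational. Any other section is compared with b j through a quotient of
    linear forms, so all values share one factor [u]. *)
Lemma evaluation_at_point i (Q : 'I_n -> F) : cartier_open D i (iota \o Q) ->
  local_germ iota (proj_germ iota b (iota \o Q)) /\
  exists2 u : F, u != 0 & forall ga : 'I_n -> F,
  proj_germ iota b (iota \o Q) ((\sum_k kc (ga k) * b k) * cartier_fun D i)
    (iota (u * \sum_k ga k * Q k)).
Proof.
move=> oi; have [x Xx am] := cartier_sub oi.
have [_ [_ lx _ _]] := blowupP Xx.
have ly := model_germ_local lx am; have yx := model_germ_sub lx am.
split=> //; have [[j Qj] [f [R [ef xR [c c0 QE]]]]] := am.
have Rj : R j != 0 by apply: contraNneq Qj => R0; rewrite QE R0 mulr0.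
have bfj := lg_neq0 lx (xR j) Rj; have f0 := neq0_mulr bfj; have bj := neq0_mull bfj.
have [a [a1 [xa a10 fE]]] := anticanonical_unit lx ef (D_anti Xx am oi) f0.
have bjV : cubic_space (b j) by exists (C j); apply: bE.
have [r yr] := cubic_cartier_sections L_alg MiM MMi N_size N_monic N_root N_min p_tr bE bVE
  D_anti bjV oi.
have [r0 rE] := proj_germ_rational yr.
have r00 : r != 0.
  have h := lg_mul lx xa (xR j); rewrite mulrCA -fE in h.
  by rewrite (lg_fun lx (yx _ _ yr) h) mulf_neq0.
have Qj0 : Q j != 0 by rewrite -(fmorph_eq0 iota).
exists (r0 / Q j) => [|ga].
  by rewrite mulf_neq0 ?invr_neq0 // -(fmorph_eq0 iota) -rE.
have bjE : b j = \sum_k kc (k == j)%:R * b k.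
  rewrite (bigD1 j) //= eqxx (rmorph1 kc) mul1r big1 ?addr0 // => k kj.
  by rewrite (negPf kj) (rmorph0 kc) mul0r.
have QjE : iota (Q j) = \sum_k iota (k == j)%:R * (iota \o Q) k.
  rewrite (bigD1 j) //= eqxx rmorph1 mul1r big1 ?addr0 // => k kj.
  by rewrite (negPf kj) rmorph0 mul0r.
have lin : proj_germ iota b (iota \o Q) ((\sum_k kc (ga k) * b k) / b j)
    ((\sum_k iota (ga k) * (iota \o Q) k) / iota (Q j)).
  by rewrite {1}bjE QjE; apply: proj_germ_linear; rewrite -QjE.
have := lg_mul ly lin yr; rewrite mulrA divfK //.
congr (proj_germ _ _ _ _ _); rewrite rmorphM fmorph_div rmorph_sum rE.
under [in RHS]eq_bigr => k _ do rewrite rmorphM.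
by rewrite mulrC mulrA mulrAC.
Qed.

Variables (m : nat) (pt : 'I_m -> 'I_n -> F) (ip : 'I_m -> cartier_index D).
Hypothesis pt_open : forall j, cartier_open D (ip j) (iota \o pt j).

(** The code is the row space of the matrix whose columns are the rational points, each scaled by a
    nonzero factor that depends on the divisor and on the representative. *)
Lemma evaluation_matrix : exists A : 'M[F]_(n, m),
  (exists2 u : 'I_m -> F, forall j, u j != 0 & forall i j, A i j = u j * pt j i) /\
  forall c : 'rV[F]_m, (exists2 g, cartier_sections D g &
      forall j, proj_germ iota b (iota \o pt j) (g * cartier_fun D (ip j)) (iota (c 0 j)))
    <-> exists ga : 'rV[F]_n, c = ga *m A.
Proof.
have [u hu] : exists u : 'I_m -> F, forall j, u j != 0 /\ forall ga : 'I_n -> F,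
  proj_germ iota b (iota \o pt j) ((\sum_k kc (ga k) * b k) * cartier_fun D (ip j))
    (iota (u j * \sum_k ga k * pt j k)).
  apply: (@fin_all_exists _ (fun=> F) (fun j u => u != 0 /\ forall ga : 'I_n -> F,
    proj_germ iota b (iota \o pt j) ((\sum_k kc (ga k) * b k) * cartier_fun D (ip j))
    (iota (u * \sum_k ga k * pt j k)))) => j.
  by have [_ [u u0 h]] := evaluation_at_point (pt_open j); exists u.
exists (\matrix_(i, j) (u j * pt j i)); split.
  by exists u => [j|i j]; [case: (hu j) | rewrite mxE].
have AE (ga : 'rV[F]_n) j : (ga *m \matrix_(i, j) (u j * pt j i)) 0 j
     = u j * \sum_k ga 0 k * pt j k.
  by rewrite mxE mulr_sumr; apply: eq_bigr => k _; rewrite mxE mulrCA.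
move=> c; split=> [[g hg hc]|[ga ->]].
  have [c' gE] := cartier_sections_cubic L_alg MiM MMi N_size N_monic N_root N_min p_tr bE bVE
    D_anti hg.
  pose ga : 'rV[F]_n := \row_k \sum_l c' l * Dm l k.
  have gE' : g = \sum_k kc (ga 0 k) * b k.
    rewrite gE; under eq_bigr => l _ do rewrite bVE mulr_sumr.
    rewrite exchange_big; apply: eq_bigr => k _; rewrite mxE (rmorph_sum kc) mulr_suml.
    by apply: eq_bigr => l _; rewrite (rmorphM kc) mulrA.
  exists ga; apply/rowP => j; rewrite AE; apply: (fmorph_inj iota).
  have [lj _] := evaluation_at_point (pt_open j); have [_ h] := hu j.
  by apply: (lg_fun lj (hc j)); rewrite gE'; apply: h.
exists (\sum_k kc (ga 0 k) * b k).
  apply: (cubic_cartier_sections L_alg MiM MMi N_size N_monic N_root N_min p_tr bE bVE D_anti).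
  exists (fun l => \sum_k ga 0 k * C k l).
  under eq_bigr => k _ do rewrite bE mulr_sumr.
  rewrite exchange_big; apply: eq_bigr => l _; rewrite (rmorph_sum kc) mulr_suml.
  by apply: eq_bigr => k _; rewrite (rmorphM kc) mulrA.
by move=> j; rewrite AE; case: (hu j).
Qed.

Hypothesis pt_enum : enumerates_rational_points iota (anticanonical_model X b) pt.
Hypothesis F_gt2 : (2 < #|F|)%N.

Lemma code_parameters (A : 'M[F]_(n, m)) (u : 'I_m -> F) (Cd : {vspace 'rV[F]_m}) :
  (forall j, u j != 0) -> (forall i j, A i j = u j * pt j i) ->
  (forall c, c \in Cd <-> exists ga : 'rV[F]_n, c = ga *m A) ->
  has_parameters Cd (#|F| ^ 2 + 1) 7 (#|F| ^ 2 - 2 * #|F|).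
Proof.
move=> u0 AE CdE.
have mE := enumeration_card MiM MMi N_size N_monic N_root N_min p_tr bE bVE DC pt_enum.
have n7 : n = 7%N.
  pose Cm : 'M[F]_(n, 7) := \matrix_(i, l) C i l; pose Dmm : 'M[F]_(7, n) := \matrix_(l, i) Dm l i.
  apply/eqP; rewrite eqn_leq; apply/andP; split.
    apply: (@mulmx1_min F n 7 Cm Dmm); apply/matrixP => i j; rewrite !mxE -CD.
    by apply: eq_bigr => l _; rewrite !mxE.
  apply: (@mulmx1_min F 7 n Dmm Cm); apply/matrixP => i j; rewrite !mxE -DC.
  by apply: eq_bigr => l _; rewrite !mxE.
have distE (ga ga' : 'rV[F]_n) : hamming_distance (ga *m A) (ga' *m A)
    = (m - weight_zeros pt (fun i => ((ga - ga') 0 i)%R))%N.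
  rewrite /hamming_distance /weight_zeros; set Z := [set j | \sum_i _ == 0].
  have -> : (m - #|Z| = #|~: Z|)%N by rewrite -[X in (X - _)%N](card_ord m) -(cardsC Z) addKn.
  congr #|pred_of_set _|; apply/setP => j; rewrite !inE -subr_eq0.
  have -> : (ga *m A) 0 j - (ga' *m A) 0 j = u j * \sum_i (ga - ga') 0 i * pt j i.
    have -> : (ga *m A) 0 j - (ga' *m A) 0 j = ((ga - ga') *m A) 0 j.
      by rewrite mulmxBl !mxE.
    by rewrite mxE mulr_sumr; apply: eq_bigr => i _; rewrite AE mulrCA.
  by rewrite mulf_eq0 (negPf (u0 j)).
have wle (ga : 'rV[F]_n) : ga != 0 -> (weight_zeros pt (fun i => (ga 0 i)%R) <= 2 * #|F| + 1)%N.
  move=> ga0; apply: (weight_zeros_le MiM MMi N_size N_monic N_root N_min p_tr bE bVE DC CD pt_enum).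
  by have /rV0Pn[i hi] := ga0; exists i.
(* Here q > 2 enters: it makes the maximal number 2q + 1 of zeros smaller than the length q^2 + 1,
   so that no nonzero section evaluates to zero everywhere. *)
have qq : (2 * #|F| < #|F| ^ 2)%N by rewrite expnS expn1 ltn_pmul2r // (leq_trans _ F_gt2).
have inj (ga ga' : 'rV[F]_n) : ga *m A = ga' *m A -> ga = ga'.
  move=> e; apply/eqP; rewrite -subr_eq0; apply: contraT => /wle w.
  have := distE ga ga'; rewrite e /hamming_distance.
  have -> : [set j | (ga' *m A) 0 j != (ga' *m A) 0 j] = set0 by apply/setP => j; rewrite !inE eqxx.
  by rewrite cards0; move: w qq; move: (weight_zeros _ _) => w; rewrite mE; lia.
pose f : 'Hom('rV[F]_n, 'rV[F]_m) := linfun (mulmxr A).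
have CdL : Cd = limg f.
  apply/vspaceP => c; apply/idP/idP => [/CdE[ga ->]|/memv_imgP[ga _ ->]].
    by apply/memv_imgP; exists ga; rewrite ?memvf // lfunE.
  by apply/CdE; exists ga; rewrite lfunE.
split=> //.
- have f_inj : lker f == 0%VS by apply/lker0P => ga ga'; rewrite !lfunE /=; apply: inj.
  rewrite CdL (limg_dim_eq (U := fullv)); last by rewrite (eqP f_inj) capv0.
  by rewrite dimvf /dim /= mul1n.
- have [ga [i gi] hw] := weight_zeros_eq MiM MMi N_size N_monic N_root N_min p_tr bE bVE DC pt_enum.
  pose g : 'rV[F]_n := \row_i ga i.
  have g0 : g != 0 by apply/rV0Pn; exists i; rewrite !mxE.
  exists (g *m A), (0 *m A); split; try by apply/CdE; eexists.
    by apply: contraNneq g0 => /inj->.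
  rewrite distE subr0.
  have -> : weight_zeros pt (fun i => g 0 i) = weight_zeros pt ga.
    rewrite /weight_zeros; congr #|pred_of_set _|; apply/setP => j; rewrite !inE.
    by congr (_ == _); apply: eq_bigr => k _; rewrite mxE.
  by rewrite hw mE; lia.
move=> c c' /CdE[ga ->] /CdE[ga' ->] ne; rewrite distE.
have ne' : ga - ga' != 0 by rewrite subr_eq0; apply: contraNneq ne => ->.
by have := wle _ ne'; move: (weight_zeros _ _) => w; rewrite mE; lia.
Qed.

End Evaluation.

(** * Existence of the code, and its parameters for arbitrary choices *)

Section Codes.
Variables (F : finFieldType) (L : closedFieldType) (iota : {rmorphism F -> L}).
Hypothesis L_alg : forall a : L, algebraicOver iota a.
Variables (M Mi : 'M[F]_3) (p : 'I_3 -> 'I_3 -> L) (N : {poly F}) (theta : 'I_3 -> L).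
Hypotheses (MiM : Mi *m M = 1%:M) (MMi : M *m Mi = 1%:M).
Hypotheses (N_size : size N = 4%N) (N_monic : N`_3 = 1).
Hypothesis N_root : forall t, root (map_poly iota N) t <-> exists i, t = theta i.
Hypothesis N_min : forall (G : {poly F}) i, root (map_poly iota G) (theta i) -> N %| G.
Hypothesis p_tr : forall i, [/\ tr iota M (p i) ord_max = 0, tr iota M (p i) o1 != 0
  & tr iota M (p i) ord0 = theta i * tr iota M (p i) o1].
Local Notation K := (ratfun F).
Local Notation kc := (@ratfun_const F).
Local Notation X := (blowup iota p).
Local Notation bV := (bV M N).
Implicit Types (f g h s : K) (x y : germ F L).

Lemma anticanonical_code_exists : exists (m : nat) (Cd : {vspace 'rV[F]_m}),
  is_anticanonical_code iota X Cd.
Proof.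
pose pt := fun j : 'I_(card_pts F) => model_pt N (@delta F) (enum_val j).
have DC l l' : \sum_(i < 7) delta F l i * delta F i l' = (l == l')%:R.
  rewrite (bigD1 l) //= /delta eqxx mul1r big1 ?addr0 // => i ne.
  by rewrite eq_sym (negPf ne) mul0r.
have bE := bV_delta M N.
pose D := basis_divisor iota p MiM MMi N_size N_monic.
have D_anti : is_anticanonical_divisor D by exact: basis_divisor_anticanonical.
have en := model_pt_enumerates MiM MMi N_size N_monic N_root N_min p_tr bE bE DC.
have [ip hip] : exists ip : 'I_(card_pts F) -> cartier_index D,
    forall j, cartier_open D (ip j) (iota \o pt j).
  apply: (@fin_all_exists _ (fun=> cartier_index D) (fun j i => cartier_open D i (iota \o pt j))) => j.
  by have [enS _ _] := en; exact: (cartier_cover D (enS j)).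
have [A [_ hA]] := evaluation_matrix L_alg MiM MMi N_size N_monic N_root N_min p_tr bE bE
  D_anti hip.
exists (card_pts F), (limg (linfun (mulmxr A))), 7%N, bV, D, pt; split.
- exact: (bV_basis L_alg MiM MMi N_size N_monic N_root N_min p_tr).
- exact: D_anti.
- exact: en.
exists ip; first exact: hip.
move=> c; rewrite hA; split=> [/memv_imgP[ga _ ->]|[ga ->]].
  by exists ga; rewrite lfunE.
by apply/memv_imgP; exists ga; rewrite ?memvf // lfunE.
Qed.

Lemma anticanonical_code_parameters (m : nat) (Cd : {vspace 'rV[F]_m}) : (2 < #|F|)%N ->
  is_anticanonical_code iota X Cd -> has_parameters Cd (#|F| ^ 2 + 1) 7 (#|F| ^ 2 - 2 * #|F|).
Proof.
move=> F_gt2 [n [b [D [pt [[bS b_free b_span] D_anti en [ip hip hC]]]]]].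
have sP := sectionsP L_alg MiM MMi N_size N_monic N_root N_min p_tr.
have [C bE] : exists C : 'I_n -> 'I_7 -> F, forall i, b i = \sum_l kc (C i l) * bV l.
  apply: (@fin_all_exists _ (fun=> 'I_7 -> F) (fun i c => b i = \sum_l kc (c l) * bV l)) => i.
  by apply/sP.
have [Dm bVE] : exists Dm : 'I_7 -> 'I_n -> F, forall l, bV l = \sum_i kc (Dm l i) * b i.
  apply: (@fin_all_exists _ (fun=> 'I_n -> F) (fun l c => bV l = \sum_i kc (c i) * b i)) => l.
  by apply: b_span; apply/sP; exists (delta F l); apply: bV_delta.
(* Both families are bases of the same space, so the two transition matrices are inverse to each
   other. *)
have DC l l' : \sum_i Dm l i * C i l' = (l == l')%:R.
  apply/eqP; rewrite -subr_eq0; apply/eqP.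
  apply: (bV_free iota MMi N_size N_monic (c := fun k => \sum_i Dm l i * C i k - delta F l k)).
  under eq_bigr => k _ do rewrite (rmorphB kc) mulrBl.
  rewrite sumrB -(bV_delta M N) [bV l]bVE; apply/eqP; rewrite subr_eq0; apply/eqP.
  under [in RHS]eq_bigr => i _ do rewrite bE mulr_sumr.
  rewrite exchange_big; apply: eq_bigr => k _; rewrite (rmorph_sum kc) mulr_suml.
  by apply: eq_bigr => i _; rewrite (rmorphM kc) mulrA.
have CD i j : \sum_l C i l * Dm l j = (i == j)%:R.
  apply/eqP; rewrite -subr_eq0; apply/eqP.
  apply: (b_free (fun k => \sum_l C i l * Dm l k - (i == k)%:R)).
  under eq_bigr => k _ do rewrite (rmorphB kc) mulrBl.
  rewrite sumrB [X in _ - X](bigD1 i) //= eqxx (rmorph1 kc) mul1r [X in _ - (_ + X)]big1 => [|k ki].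
    rewrite addr0 [b i]bE; apply/eqP; rewrite subr_eq0; apply/eqP.
    under [in RHS]eq_bigr => l _ do rewrite bVE mulr_sumr.
    rewrite exchange_big; apply: eq_bigr => k _; rewrite (rmorph_sum kc) mulr_suml.
    by apply: eq_bigr => l _; rewrite (rmorphM kc) mulrA.
  by rewrite eq_sym (negPf ki) (rmorph0 kc) mul0r.
have [A [[u u0 AE] hA]] := evaluation_matrix L_alg MiM MMi N_size N_monic N_root N_min p_tr bE bVE
  D_anti hip.
apply: (code_parameters MiM MMi N_size N_monic N_root N_min p_tr bE bVE DC CD en F_gt2 u0 AE).
by move=> c; rewrite hC hA.
Qed.

End Codes.

(** * Frobenius and rationality *)

Section Frobenius.
Variables (F : finFieldType) (L : closedFieldType) (iota : {rmorphism F -> L}).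
Local Notation q := #|F|.

Lemma frobenius_pnat : [pchar L].-nat q.
Proof.
have [r r_pr rF] := finPcharP F.
rewrite (card_pprimeChar rF) pnatX; apply/orP; left.
have rL : r \in [pchar L] by rewrite (fmorph_pchar iota).
by rewrite (eq_pnat _ (pcharf_eq rL)) pnat_id.
Qed.

Lemma frobeniusD (a c : L) : (a + c) ^+ q = a ^+ q + c ^+ q.
Proof. exact: (exprDn_pchar _ _ frobenius_pnat). Qed.

Lemma card_gt0F : (0 < q)%N.
Proof. by rewrite (ltn_trans _ (finNzRing_gt1 F)). Qed.

Lemma frobenius0 : (0 : L) ^+ q = 0.
Proof. by rewrite expr0n eqn0Ngt card_gt0F. Qed.

Lemma frobenius_sum (I : Type) (r : seq I) (P : pred I) (f : I -> L) :
  (\sum_(i <- r | P i) f i) ^+ q = \sum_(i <- r | P i) f i ^+ q.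
Proof.
apply: (big_morph (fun a : L => a ^+ q)); [exact: frobeniusD | exact: frobenius0].
Qed.

Lemma frobenius_inj (a c : L) : a ^+ q = c ^+ q -> a = c.
Proof.
move=> h; apply/eqP; rewrite -subr_eq0.
have : (a - c) ^+ q + c ^+ q = c ^+ q by rewrite -frobeniusD subrK.
by move/eqP; rewrite -[X in _ == X]add0r (inj_eq (addIr _)) expf_eq0 => /andP[].
Qed.

Lemma frobenius_iota c : iota c ^+ q = iota c.
Proof. by rewrite -rmorphXn expf_card. Qed.

(** Over [F], X^q - X is the product of the X - c with c in [F], so it has no other root in L. *)
Lemma frobenius_fixed (a : L) : a ^+ q = a -> exists c, a = iota c.
Proof.
move=> h; have : root (map_poly iota ('X^q - 'X)) a.
  by rewrite rmorphB /= map_polyXn map_polyX /root hornerD hornerN hornerXn hornerX h subrr.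
rewrite finField_genPoly rmorph_prod /= => /rootP; rewrite horner_prod => /eqP.
case/prodf_eq0 => c _; rewrite rmorphB /= map_polyX map_polyC /= hornerXsubC subr_eq0 => /eqP ->.
by exists c.
Qed.

Lemma frobenius_horner (G : {poly F}) (t : L) :
  (map_poly iota G).[t] ^+ q = (map_poly iota G).[t ^+ q].
Proof.
rewrite !horner_coef frobenius_sum; apply: eq_bigr => i _.
by rewrite exprMn coef_map frobenius_iota -!exprM mulnC.
Qed.

Lemma prop_of_cross (P Q : 'I_3 -> L) : nonzero P -> nonzero Q ->
  (forall i j, P i * Q j = P j * Q i) -> proportional P Q.
Proof.
move=> [k Pk] [l Ql] h; have QE j : Q j = Q k / P k * P j.
  by apply: (mulfI Pk); rewrite h mulrA mulrCA mulfV // mulr1 mulrC.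
exists (Q k / P k) => //; apply: contraNneq Ql => h0.
by rewrite QE h0 mul0r.
Qed.

(* Two distinct points lie on a single line. *)
Lemma line_unique (P Q a d : 'I_3 -> L) k : nonzero P -> nonzero Q -> ~ proportional P Q ->
  a k = 1 -> d k = 0 -> \sum_j a j * P j = 0 -> \sum_j a j * Q j = 0 ->
  \sum_j d j * P j = 0 -> \sum_j d j * Q j = 0 -> forall j, d j = 0.
Proof.
move=> P0 Q0 nPQ ak dk aP aQ dP dQ.
case: (boolP [exists i, d i != 0]) => [/existsP[i di]|]; last first.
  by rewrite negb_exists => /forallP h j; have := h j; rewrite negbK => /eqP.
case: nPQ; apply: prop_of_cross => //.
have ik : i != k by apply: contraNneq di => ->; rewrite dk.
have [j ijk] : exists j, [/\ i != j, i != k & j != k].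
  have [s [s' [h1 h2 h3]]] := other_index k.
  case: (eqVneq i s) => [->|ne]; first by exists s'.
  by exists s; rewrite ne.
have S3 (f : 'I_3 -> L) : \sum_l f l = f i + f j + f k.
  case: ijk => h1 h2 h3; rewrite (bigD1 i) //= (bigD1 j) //=; last by rewrite eq_sym.
  rewrite (bigD1 k) /=; last by rewrite ![k == _]eq_sym h2 h3.
  rewrite big1 ?addr0 ?addrA // => l; case: (ord3_cases (And3 h1 h2 h3) l) => ->;
  by rewrite ?eqxx ?andbF.
have vec (R : 'I_3 -> L) : \sum_l a l * R l = 0 -> \sum_l d l * R l = 0 ->
    R i = - (d j / d i) * R j /\ R k = (a i * (d j / d i) - a j) * R j.
  rewrite !S3 ak dk mul1r mul0r addr0 => h1 h2.
  have Ri : R i = - (d j / d i) * R j.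
    apply: (mulfI di); apply/eqP; rewrite -subr_eq0 -h2; apply/eqP.
    by field.
  split=> //; apply/eqP; rewrite -subr_eq0 -h1; apply/eqP; rewrite Ri.
  by field.
have [Pi Pk] := vec P aP dP; have [Qi Qk] := vec Q aQ dQ.
have E (R : 'I_3 -> L) : R i = - (d j / d i) * R j -> R k = (a i * (d j / d i) - a j) * R j ->
    forall l, R l = (if l == i then - (d j / d i) else if l == j then 1 else a i * (d j / d i) - a j) * R j.
  case: ijk => h1 h2 h3 Ri Rk l; case: (ord3_cases (And3 h1 h2 h3) l) => ->.
  - by rewrite eqxx Ri.
  - by rewrite eq_sym (negPf h1) eqxx mul1r.
  - by rewrite ![k == _]eq_sym (negPf h2) (negPf h3) Rk.
by move=> l l'; rewrite (E P Pi Pk l) (E P Pi Pk l') (E Q Qi Qk l) (E Q Qi Qk l'); ring.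
Qed.

End Frobenius.

Lemma matrix_with_row (F : fieldType) (a : 'rV[F]_3) : a != 0 -> exists (M : 'M[F]_3) (c : F),
  [/\ M \in unitmx, c != 0 & forall j, M ord_max j = c * a 0 j].
Proof.
(* The first row of the invertible matrix [row_ebase a] spans the row space of a, which has rank
   one; reversing the rows puts it last. *)
move=> a0; pose M := row_perm (perm (@rev_ord_inj 3)) (row_ebase a).
have ra : \rank a = 1%N by rewrite rank_rV a0.
have aE j : a 0 j = col_ebase a 0 0 * row_ebase a ord0 j.
  have := mulmx_ebase a; rewrite ra => /(congr1 (fun B : 'rV[F]_3 => B 0 j)) <-.
  rewrite mxE (bigD1 ord0) //= big1 ?addr0 => [|i i0].
    by rewrite mxE big_ord1 !mxE eqxx mulr1 ?ltn0Sn.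
  rewrite mxE big_ord1 !mxE; case: eqP => [e|_]; last by rewrite mulr0 mul0r.
  by case/eqP: i0; apply: val_inj.
have c0 : col_ebase a 0 0 != 0.
  apply: contraNneq a0 => c0; apply/eqP/rowP => j.
  by rewrite aE c0 mul0r mxE.
exists M, (col_ebase a 0 0)^-1; split.
- by rewrite /M row_permE unitmx_mul unitmx_perm row_ebase_unit.
- by rewrite invr_neq0.
move=> j; rewrite aE mulKf // mxE permE; congr (row_ebase a _ j).
by apply: val_inj.
Qed.

(** * Normal form of the three points *)

Section Setup.
Variables (F : finFieldType) (L : closedFieldType) (iota : {rmorphism F -> L}).
Variable p : 'I_3 -> 'I_3 -> L.
Hypothesis p_neq0 : forall i, nonzero (p i).
Hypothesis p_collinear : collinear p.
Hypothesis p_conjugate : conjugate_points #|F| p.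
Local Notation q := #|F|.

Lemma frobenius_sum_iter m (I : Type) (r : seq I) (P : pred I) (f : I -> L) :
  (\sum_(i <- r | P i) f i) ^+ (q ^ m) = \sum_(i <- r | P i) f i ^+ (q ^ m).
Proof.
elim: m => [|m IH]; first by rewrite expn0 expr1; apply: eq_bigr => i _; rewrite expr1.
rewrite expnSr exprM IH (frobenius_sum iota); apply: eq_bigr => i _.
by rewrite exprM.
Qed.

Lemma frobenius_iota_iter m c : iota c ^+ (q ^ m) = iota c.
Proof.
elim: m => [|m IH]; first by rewrite expn0 expr1.
by rewrite expnSr exprM IH frobenius_iota.
Qed.

Lemma frobenius_horner_iter m (G : {poly F}) (t : L) :
  (map_poly iota G).[t] ^+ (q ^ m) = (map_poly iota G).[t ^+ (q ^ m)].
Proof.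
elim: m => [|m IH]; first by rewrite expn0 !expr1.
by rewrite expnSr exprM IH frobenius_horner -exprM.
Qed.

Lemma frobenius_proportional (P Q : 'I_3 -> L) : nonzero P -> nonzero Q ->
  proportional (frobenius q 1 P) (frobenius q 1 Q) -> proportional P Q.
Proof.
move=> P0 Q0 [c c0 h]; apply: prop_of_cross => // i j; apply: (frobenius_inj iota).
have := h i; have := h j; rewrite /frobenius expn1 => hj hi.
by rewrite !exprMn hi hj; ring.
Qed.

(** Normalize the equation so that one coefficient is 1. Raising it to the power q gives a line
    through the conjugates of the points, which are again among them. Two distinct points determine
    the line, so the normalized coefficients are fixed by Frobenius. *)
Lemma rational_line : exists2 a : 'rV[F]_3, a != 0 & forall i, \sum_j iota (a 0 j) * p i j = 0.
Proof.
have [a [k ak] ha] := p_collinear; have [nprop frob _] := p_conjugate.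
pose a' j := a j / a k.
have a'k : a' k = 1 by rewrite /a' mulfV.
have ha' i : \sum_j a' j * p i j = 0.
  transitivity ((a k)^-1 * \sum_j a j * p i j); last by rewrite ha mulr0.
  by rewrite mulr_sumr; apply: eq_bigr => j _; rewrite /a'; ring.
clearbody a'.
have [f hf] : exists f : 'I_3 -> 'I_3, forall i, proportional (frobenius q 1 (p i)) (p (f i)).
  exact: (@fin_all_exists _ (fun=> 'I_3) (fun i j => proportional (frobenius q 1 (p i)) (p j)) frob).
have f01 : f ord0 != f o1.
  apply/eqP => e; have := hf ord0; have := hf o1; rewrite -e => h1 h0.
  apply: (nprop ord0 o1) => //; apply: frobenius_proportional => //.
  exact: (proportional_trans h0 (proportional_sym h1)).
pose d j := a' j ^+ q - a' j.
have hd i : \sum_j d j * p (f i) j = 0.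
  under eq_bigr => j _ do rewrite mulrBl.
  rewrite sumrB ha' subr0; have [c c0 h] := hf i.
  transitivity (c * (\sum_j a' j * p i j) ^+ q); last by rewrite ha' (frobenius0 F) mulr0.
  rewrite (frobenius_sum iota) mulr_sumr; apply: eq_bigr => j _.
  by rewrite h /frobenius expn1 exprMn mulrCA.
have d0 := line_unique (p_neq0 (f ord0)) (p_neq0 (f o1)) (nprop _ _ f01) a'k
  (_ : d k = 0) (ha' _) (ha' _) (hd _) (hd _).
have [r hr] : exists r : 'I_3 -> F, forall j, a' j = iota (r j).
  apply: (@fin_all_exists _ (fun=> F) (fun j c => a' j = iota c)) => j.
  apply: frobenius_fixed; apply/eqP; rewrite -subr_eq0; apply/eqP; apply: d0.
  by rewrite /d a'k expr1n subrr.
exists (\row_j r j).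
  apply/rV0Pn; exists k; rewrite mxE -(fmorph_eq0 iota) -hr a'k oner_neq0.
  by [].
by move=> i; rewrite -[RHS](ha' i); apply: eq_bigr => j _; rewrite mxE hr.
Qed.

(** The last row of [M] is the rational line through the points, and theta_i is the ratio of the
    other two coordinates. These ratios are distinct and permuted transitively by Frobenius, so the
    product of the T - theta_i has coefficients in [F] and is the minimal polynomial of each
    theta_i. *)
Lemma normal_coordinates : exists (M Mi : 'M[F]_3) (N : {poly F}) (theta : 'I_3 -> L),
  [/\ Mi *m M = 1%:M /\ M *m Mi = 1%:M, size N = 4%N /\ N`_3 = 1,
    forall t, root (map_poly iota N) t <-> exists i, t = theta i,
    forall (G : {poly F}) i, root (map_poly iota G) (theta i) -> N %| G &
    forall i, [/\ tr iota M (p i) ord_max = 0, tr iota M (p i) o1 != 0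
      & tr iota M (p i) ord0 = theta i * tr iota M (p i) o1]].
Proof.
have [a a0 ha] := rational_line; have [M [c [Mu c0 Ma]]] := matrix_with_row a0.
have [nprop frob trans] := p_conjugate.
have MiM := mulVmx Mu; have MMi := mulmxV Mu.
have p2 i : tr iota M (p i) ord_max = 0.
  transitivity (iota c * \sum_j iota (a 0 j) * p i j); last by rewrite ha mulr0.
  by rewrite mulr_sumr; apply: eq_bigr => j _; rewrite Ma rmorphM mulrA.
have tr_frob m P l : tr iota M (frobenius q m P) l = tr iota M P l ^+ (q ^ m).
  rewrite /tr /lin frobenius_sum_iter; apply: eq_bigr => j _.
  by rewrite exprMn frobenius_iota_iter.
have propE P Q : proportional (tr iota M P) (tr iota M Q) -> proportional P Q.
  by move=> h; apply/(proportional_tr iota MiM).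
have qm m : (0 < q ^ m)%N by rewrite expn_gt0 (card_gt0F F).
(* Otherwise p i would be (1 : 0 : 0) in the new coordinates, a rational point, hence equal to its
   conjugates. *)
have p1 i : tr iota M (p i) o1 != 0.
  apply/eqP => y0; have [j ij] : exists j, i != j.
    by have [s [s' [_ h _]]] := other_index i; exists s; rewrite eq_sym.
  apply: (nprop i j ij); have [m [e e0 he]] := trans i j.
  have hj l : tr iota M (p j) l = e * tr iota M (p i) l ^+ (q ^ m).
    by rewrite -tr_frob; apply: tr_scale.
  have x0 : tr iota M (p i) ord0 != 0.
    have [k] := nonzero_tr iota MiM (p_neq0 i); apply: contraNneq => x0.
    by apply/eqP; elim/ord3P: k.
  apply: propE; exists (e * tr iota M (p i) ord0 ^+ (q ^ m) / tr iota M (p i) ord0).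
    by rewrite !mulf_neq0 ?invr_neq0 ?expf_neq0.
  apply: ord3P; rewrite ?hj.
  - by rewrite divfK.
  - by rewrite y0 expr0n eqn0Ngt qm !mulr0.
  - by rewrite p2 expr0n eqn0Ngt qm !mulr0.
pose theta i := tr iota M (p i) ord0 / tr iota M (p i) o1.
have pE i : tr iota M (p i) ord0 = theta i * tr iota M (p i) o1 by rewrite /theta divfK.
have th_inj : injective theta.
  move=> i j e; apply/eqP/negPn/negP => ij; apply: (nprop i j ij); apply: propE.
  exists (tr iota M (p j) o1 / tr iota M (p i) o1); first by rewrite mulf_neq0 ?invr_neq0.
  apply: ord3P; rewrite ?p2 ?mulr0 ?divfK // !pE e.
  by rewrite [RHS]mulrCA; congr (_ * _); rewrite divfK.
have th_frob m i j : proportional (frobenius q m (p i)) (p j) -> theta j = theta i ^+ (q ^ m).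
  move/(proportional_tr iota MiM) => [e e0 h].
  by rewrite /theta !h !tr_frob -mulf_div mulfV // mul1r expr_div_n.
clearbody theta.
have [f hf] : exists f : 'I_3 -> 'I_3, forall i, theta (f i) = theta i ^+ q.
  apply: (@fin_all_exists _ (fun=> 'I_3) (fun i j => theta j = theta i ^+ q)) => i.
  by have [j /th_frob] := frob i; rewrite expn1; exists j.
have f_inj : injective f.
  by move=> i j e; apply/th_inj/(frobenius_inj iota); rewrite -!hf e.
pose rs := [:: theta ord0; theta o1; theta ord_max].
have rsP t : t \in rs <-> exists i, t = theta i.
  split=> [|[i ->]]; first by rewrite !inE => /or3P[] /eqP->; eexists.
  by elim/ord3P: i; rewrite !inE eqxx ?orbT.
have rs_uniq : uniq rs.
  by rewrite /= !inE !(inj_eq th_inj).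
pose P := \prod_(t <- rs) ('X - t%:P).
have sP : size P = 4%N by rewrite size_prod_XsubC.
have P3 : P`_3 = 1.
  have : P \is monic by apply: monic_prod_XsubC.
  by rewrite monicE lead_coefE sP => /eqP.
have rootP t : root P t = (t \in rs) by exact: root_prod_XsubC.
(* [Q] is the Frobenius conjugate of [P]. Since Q(s^q) = P(s)^q, it vanishes at all three roots, and
   Q - P has degree less than 3, so Q = P and the coefficients lie in [F]. *)
pose Q := \poly_(i < 4) P`_i ^+ q.
have QP : Q - P = 0.
  apply: (@roots_geq_poly_eq0 _ _ rs) => //.
    apply/allP => t /rsP[i ->]; rewrite rootE hornerD hornerN subr_eq0.
    have -> : P.[theta i] = 0 by apply/eqP; rewrite -rootE rootP; apply/rsP; exists i.
    rewrite -(f_invF f_inj i) hf; set s := theta _.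
    have -> : Q.[s ^+ q] = P.[s] ^+ q.
      rewrite horner_poly horner_coef sP (frobenius_sum iota); apply: eq_bigr => j _.
      by rewrite exprMn -[in LHS]exprM -[in RHS]exprM mulnC.
    have -> : P.[s] = 0 by apply/eqP; rewrite -rootE rootP; apply/rsP; eexists.
    by rewrite (frobenius0 F).
  apply/leq_sizeP => j; rewrite leq_eqVlt => /orP[/eqP <-|hj].
    by rewrite coefB coef_poly P3 expr1n subrr.
  by rewrite coefB coef_poly ltnNge hj /= [P`__]nth_default ?subrr // sP.
have [r hr] : exists r : 'I_4 -> F, forall j : 'I_4, P`_j = iota (r j).
  apply: (@fin_all_exists _ (fun=> F) (fun (j : 'I_4) c => P`_j = iota c)) => j.
  apply: frobenius_fixed; have /eqP := congr1 (fun R : {poly L} => R`_j) QP.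
  by rewrite coefB coef_poly ltn_ord coef0 subr_eq0 => /eqP.
pose N := \poly_(j < 4) r (inord j).
have NP : map_poly iota N = P.
  apply/polyP => j; rewrite coef_map coef_poly; case: ltnP => hj; last first.
    by rewrite nth_default ?sP //= rmorph0.
  by rewrite /= -hr inordK.
exists M, (invmx M), N, theta; split.
- by split.
- split; first by rewrite -(size_map_poly iota) NP.
  by apply: (fmorph_inj iota); rewrite rmorph1 -P3 -NP coef_map.
- by move=> t; rewrite NP rootP; apply: rsP.
(* A polynomial over [F] that vanishes at one theta_i vanishes at its Frobenius conjugates, which
   are all the theta_j. *)
- move=> G i rG; rewrite -(dvdp_map iota) NP; apply: uniq_roots_dvdp; last by rewrite uniq_rootsE.
  apply/allP => t /rsP[j ->]; have [m /th_frob ->] := trans i j.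
  by rewrite rootE -frobenius_horner_iter (eqP rG) expr0n eqn0Ngt qm.
- by move=> i; split.
Qed.

End Setup.

Theorem proposition4p2 (q : nat) (F : finFieldType) (cardF : #|F| = q)
    (q_neq2 : q <> 2%N)
    (L : closedFieldType) (iota : {rmorphism F -> L})
    (L_alg : forall a : L, algebraicOver iota a)
    (p : 'I_3 -> 'I_3 -> L)
    (p_neq0 : forall i, nonzero (p i))
    (p_collinear : collinear p)
    (p_conjugate : conjugate_points q p) :
  (exists (N : nat) (C : {vspace 'rV[F]_N}),
     is_anticanonical_code iota (blowup iota p) C) /\
  (forall (N : nat) (C : {vspace 'rV[F]_N}),
     is_anticanonical_code iota (blowup iota p) C ->
     has_parameters C (q ^ 2 + 1) 7 (q ^ 2 - 2 * q)).
Proof.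
subst q.
have [M [Mi [N [theta [[MiM MMi] [N_size N_monic] N_root N_min p_tr]]]]] :=
  normal_coordinates iota p_neq0 p_collinear p_conjugate.
split; first exact: (anticanonical_code_exists L_alg MiM MMi N_size N_monic N_root N_min p_tr).
move=> m C; apply: (anticanonical_code_parameters L_alg MiM MMi N_size N_monic N_root N_min p_tr).
by rewrite ltn_neqAle eq_sym; apply/andP; split; [apply/eqP | exact: finNzRing_gt1].
Qed.
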